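(* Let $M$ be a manifold, let $H$ be a smooth, locally finitely generated, bracket generating distribution on $M$, and let $r\ge 0$ be an integer. Let $f:M\to\mathbb R$ be a function such that for every local horizontal vectorfield $X$ (a smooth vectorfield defined on an open subset $U_X\subset M$ with $X(x)\in H_x$ for all $x\in U_X$) the function $$Xf:U_X\to\mathbb R,\qquad (Xf)(x):=\left.\frac{d}{dt}\right|_{t=0} f\bigl(Fl^X_t(x)\bigr)$$ exists and is of class $C^r$. Then $f$ is of class $C^r$ on $M$.
   Context: Manifolds are smooth, finite-dimensional and paracompact; vectorfields are smooth. No continuity of $f$ is assumed a priori. $C^0$ means continuous. A distribution $H$ on $M$ is an assignment of a linear subspace $H_x\subset T_xM$ to each $x\in M$ (the dimension may vary with $x$). A local vectorfield is a smooth vectorfield defined on some open subset of $M$; it is horizontal if its values lie in $H$ at every point where it is defined. A set $\mathcal V$ of local vectorfields spans $H$ if for all $x$, $H_x$ is the linear hull of $\{X(x):X\in\mathcal V,\ x\in\text{domain of }X\}$. $H$ is smooth if it is spanned by the set of all local horizontal vectorfields. $H$ is locally finitely generated if every $x\in M$ has a neighbourhood $U$ and finitely many horizontal vectorfields $X_1,\dots,X_k$ on $U$ that span $H$ on $U$. A set of local vectorfields is involutive if it is closed under Lie brackets (taken on the intersection of the domains). The Lie hull $\mathcal L(\mathcal V)$ of a set $\mathcal V$ of local vectorfields is the smallest involutive set of local vectorfields containing $\mathcal V$. $H$ is bracket generating if the Lie hull of the set of all local horizontal vectorfields spans $TM$. $Fl^X$ denotes the maximal local flow of $X$. *)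

(* Defs.v *)
From mathcomp Require Import all_boot all_order all_algebra.
From mathcomp Require Import all_classical all_reals all_analysis.

Set Implicit Arguments.
Unset Strict Implicit.
Unset Printing Implicit Defensive.

Import Order.TTheory GRing.Theory Num.Theory.
Import numFieldNormedType.Exports.

Local Open Scope classical_set_scope.
Local Open Scope ring_scope.

(* Meaningful for open U only, where 'd is the Frechet derivative. *)
Fixpoint Ck_on (R : realType) (V W : normedModType R) (k : nat) (U : set V)
    (g : V -> W) : Prop :=
  if k is k'.+1 then
    (forall x, U x -> differentiable g x) /\
    (forall v : V, Ck_on k' U (fun x => 'd g x v))
  else forall x, U x -> {for x, continuous g}.

Definition smooth_on (R : realType) (V W : normedModType R) (U : set V)
    (g : V -> W) : Prop :=
  forall k, Ck_on k U g.

(* Hausdorffness, often part of the definition, is a separate axiom below. *)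
Definition paracompact (T : topologicalType) : Prop :=
  forall D : set (set T), D `<=` open -> \bigcup_(A in D) A = setT ->
  exists E : set (set T),
    [/\ E `<=` open,
        \bigcup_(B in E) B = setT,
        forall B, E B -> exists2 A, D A & B `<=` A
      & forall x : T, exists2 N, nbhs x N &
          finite_set [set B | E B /\ B `&` N !=set0]].

(* A topological space with a smooth atlas. Coordinate maps and their inverses
   are total functions, constrained only on chart domains and their images.
   The dimension may vary from one connected component to another. *)
Record manifold (R : realType) := Manifold {
  carrier :> topologicalType;
  chart : Type;
  cdim : chart -> nat;
  cdom : chart -> set carrier;
  cmap : forall c : chart, carrier -> 'rV[R]_(cdim c);
  cinv : forall c : chart, 'rV[R]_(cdim c) -> carrier;
  manifold_hausdorff : hausdorff_space carrier;
  manifold_paracompact : paracompact carrier;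
  cdom_open : forall c, open (cdom c);
  cdom_cover : forall x, exists c, cdom c x;
  cimg_open : forall c, open (cmap c @` cdom c);
  cmapK : forall c x, cdom c x -> cinv (cmap c x) = x;
  cmap_cont : forall c x, cdom c x -> {for x, continuous (cmap c)};
  cinv_cont : forall c p, (cmap c @` cdom c) p ->
    {for p, continuous (@cinv c)};
  transition_smooth : forall c c',
    smooth_on (cmap c @` (cdom c `&` cdom c')) (cmap c' \o @cinv c)
}.
Arguments cdom {R M} c : rename.
Arguments cmap {R M} c x : rename.
Arguments cinv {R M} c p : rename.
Arguments cdim {R M} c : rename.

Section Manifolds.
Context {R : realType}.

Definition class_C (M : manifold R) (r : nat) (U : set M) (g : M -> R) : Prop :=
  forall c : chart M,
    Ck_on r (cmap c @` (cdom c `&` U)) (fun p => g (cinv c p) : R).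

(* A tangent vector at x is the family of its coordinate vectors in all charts
   around x, related by the differentials of the transition maps. It is set to
   0 in the charts that do not contain x, so that equal tangent vectors are
   equal families. *)
Definition coordinates (M : manifold R) := forall c : chart M, 'rV[R]_(cdim c).

Definition tangent_space (M : manifold R) (x : M) : set (coordinates M) :=
  [set v | (forall c, ~ cdom c x -> v c = 0) /\
    (forall c c', cdom c x -> cdom c' x ->
       v c' = 'd (cmap c' \o cinv c) (cmap c x) (v c))].

Definition linear_hull (M : manifold R) (A : set (coordinates M)) :
    set (coordinates M) :=
  [set v | exists (n : nat) (a : 'I_n -> R) (w : 'I_n -> coordinates M),
     (forall i, A (w i)) /\ forall c, v c = \sum_(i < n) a i *: w i c].

Record tangent_distribution (M : manifold R) := TangentDistribution {
  dspace :> M -> set (coordinates M);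
  dspace_tangent : forall x, dspace x `<=` tangent_space x;
  dspace0 : forall x, dspace x (fun=> 0);
  dspaceD : forall x v w, dspace x v -> dspace x w ->
    dspace x (fun c => v c + w c);
  dspaceZ : forall x (a : R) v, dspace x v -> dspace x (fun c => a *: v c)
}.

(* The value off the domain is set to 0, so that local vectorfields with the
   same domain and the same values there are equal. *)
Record local_vf (M : manifold R) := LocalVf {
  vdom : set M;
  vval :> M -> coordinates M;
  vdom_open : open vdom;
  vval_tangent : forall x, vdom x -> tangent_space x (vval x);
  vval_out : forall x, ~ vdom x -> vval x = fun=> 0;
  vval_smooth : forall c : chart M,
    smooth_on (cmap c @` (cdom c `&` vdom)) (fun p => vval (cinv c p) c)
}.

Definition horizontal (M : manifold R) (H : tangent_distribution M) :
    set (local_vf M) :=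
  [set X | forall x, vdom X x -> H x (X x)].

Definition spans_on (M : manifold R) (U : set M) (V : set (local_vf M))
    (H : M -> set (coordinates M)) : Prop :=
  forall x, U x -> H x = linear_hull [set X x | X in V `&` [set X | vdom X x]].

Definition spans (M : manifold R) (V : set (local_vf M))
    (H : M -> set (coordinates M)) : Prop :=
  spans_on setT V H.

Definition smooth_distribution (M : manifold R) (H : tangent_distribution M) :
    Prop :=
  spans (horizontal H) H.

Definition locally_finitely_generated (M : manifold R)
    (H : tangent_distribution M) : Prop :=
  forall x : M, exists (U : set M) (k : nat) (X : 'I_k -> local_vf M),
    [/\ open_nbhs x U,
        forall i, vdom (X i) = U,
        forall i, horizontal H (X i)
      & spans_on U (range X) H].

(* Z = [X, Y], in coordinates [X, Y]^i = X^j d_j Y^i - Y^j d_j X^i. *)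
Definition is_lie_bracket (M : manifold R) (X Y Z : local_vf M) : Prop :=
  vdom Z = vdom X `&` vdom Y /\
  forall x (c : chart M), vdom Z x -> cdom c x ->
    Z x c = 'd (fun p => Y (cinv c p) c) (cmap c x) (X x c)
          - 'd (fun p => X (cinv c p) c) (cmap c x) (Y x c).

Definition lie_involutive (M : manifold R) (V : set (local_vf M)) : Prop :=
  forall X Y Z, V X -> V Y -> is_lie_bracket X Y Z -> V Z.

Definition lie_hull (M : manifold R) (V : set (local_vf M)) : set (local_vf M) :=
  smallest (@lie_involutive M) V.

Definition bracket_generating (M : manifold R) (H : tangent_distribution M) :
    Prop :=
  spans (lie_hull (horizontal H)) (@tangent_space M).

Definition integral_curve (M : manifold R) (X : local_vf M) (a b : R)
    (gamma : R -> M) : Prop :=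
  forall t, a < t < b ->
    [/\ vdom X (gamma t),
        {for t, continuous gamma}
      & forall c : chart M, cdom c (gamma t) ->
          is_derive t (1 : R) (cmap c \o gamma) (X (gamma t) c)].

(* The graph of the maximal local flow: the union of all integral curves. It is
   functional because integral curves in a Hausdorff space are unique. *)
Definition flow_graph (M : manifold R) (X : local_vf M) (t : R) (x y : M) :
    Prop :=
  exists (a b : R) (gamma : R -> M),
    [/\ a < 0 < b, a < t < b, integral_curve X a b gamma,
        gamma 0 = x & gamma t = y].

(* Equal to x when (t, x) is outside the domain of the maximal local flow. *)
Definition Fl (M : manifold R) (X : local_vf M) (t : R) (x : M) : M :=
  xget x [set y | flow_graph X t x y].

Definition flow_derivable (M : manifold R) (X : local_vf M) (f : M -> R)
    (x : M) : Prop :=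
  derivable (fun t : R => f (Fl X t x) : R) 0 1.

Definition flow_derivative (M : manifold R) (X : local_vf M) (f : M -> R)
    (x : M) : R :=
  'D_(1 : R) (fun t : R => f (Fl X t x) : R) 0.

End Manifolds.

(* Main.v *)
(* Along a trajectory of a horizontal field [X], the function [f] has derivative
   [X f]. Hence [f (Fl_t x) - f x] is the integral of [X f] over the trajectory and
   is of class [C^r] in [(t, x)], although nothing is known about [f]; the same
   holds for [f (Phi (x, t)) - f x] when [Phi (x, t)] is a composition of
   horizontal flows with times [t = (t_1, .., t_k)].
   Around a given [x0], take [Phi] such that [t |-> Phi (x0, t)] is an immersion
   and [k] is maximal. Every horizontal field is tangent to its image, otherwise
   composing with one more flow would increase [k]; hence so is every field of the
   Lie hull, and [t |-> Phi (x0, t)] is a local diffeomorphism. Inverting it,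
   [f] is [C^r] near [Phi (x0, t1)], and
   [f x = f (Phi (x, t1)) - (f (Phi (x, t1)) - f x)] is [C^r] near [x0]. *)
Require Import Defs.
From HB Require Import structures.
From mathcomp Require Import all_boot all_order all_algebra.
From mathcomp Require Import all_classical all_reals all_analysis.
From mathcomp Require Import ring lra.

Set Implicit Arguments.
Unset Strict Implicit.
Unset Printing Implicit Defensive.

Import Order.TTheory GRing.Theory Num.Theory.
Import numFieldNormedType.Exports.

Local Open Scope classical_set_scope.
Local Open Scope ring_scope.

(** * Differentials and closure properties of C^k maps *)

Section Differentials.
Context {R : realType}.
Implicit Types V W : normedModType R.

(** Tangency at a single point says nothing about brackets, which involve derivatives; it must hold
    along an open piece of the image. So when some field fails to be tangent at a time [t] close to
    the base time, the base time is first moved to [t], and only then is the flow composed. The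
    number of times never exceeds the dimension of the chart, because the rows of the jacobian stay
    independent; this bounds the process. The order [r] may be 0, whereas brackets and the inverse
    function theorem below take two derivatives of [Phi]; hence compositions of class [r.+2]. The
    order is kept finite because the box on which a local flow is shown to be of class C^k shrinks
    as k grows. The local diffeomorphism [t |-> Phi (x0, t)] gives regularity at the end of the
    trajectories and not at [x0]. To bring it back, [t] is frozen and [x] varies; for this reason
    [x] is a variable of [Phi] from the start, and all regularity is joint in [(x, t)]. *)

Lemma is_diff_lincont V W (l : V -> W) (x : V) :
  linear l -> continuous l -> is_diff x l l.
Proof.
move=> lin_l cont_l.
pose lM := GRing.isLinear.Build _ _ _ _ _ lin_l.
pose L : {linear V -> W} := HB.pack l lM.
rewrite -[l]/(L : V -> W); apply: DiffDef; first exact: linear_differentiable.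
exact: diff_lin.
Qed.

Lemma is_diffE V W (f df : V -> W) (x v : V) : is_diff x f df -> 'd f x v = df v.
Proof. by move=> [_ ->]. Qed.

Lemma lincont_bound V W (l : V -> W) : linear l -> continuous l ->
  exists2 k, 0 < k & forall x, `|l x| <= k * `|x|.
Proof.
move=> lin_l cont_l.
pose lM := GRing.isLinear.Build _ _ _ _ _ lin_l.
pose L : {linear V -> W} := HB.pack l lM.
exact: (@linear_lipschitz _ _ _ L).
Qed.

Lemma is_diff_epsP V W (f df : V -> W) (x : V) : linear df -> continuous df ->
  (forall e : R, 0 < e ->
     \forall h \near (0 : V), `|f (h + x) - f x - df h| <= e * `|h|) ->
  is_diff x f df.
Proof.
move=> lin_df cont_df fdf.
pose lM := GRing.isLinear.Build _ _ _ _ _ lin_df.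
pose L : {linear V -> W} := HB.pack df lM.
have fE : f \o shift x = cst (f x) + L +o_ (0 : V) id.
  apply/eqaddoP => e e0; near=> h => /=.
  have -> : (f \o shift x - (cst (f x) + L)) h = f (h + x) - f x - df h.
    by rewrite !fctE /= opprD addrA.
  by near: h; exact: fdf.
have dL : 'd f x = L :> (V -> W) by exact: diff_unique.
apply: DiffDef; last exact: dL.
by apply/diff_locallyP; rewrite dL.
Unshelve. all: by end_near. Qed.

Lemma differentiable_eps V W (f : V -> W) (x : V) (e : R) :
  differentiable f x -> 0 < e ->
  \forall h \near (0 : V), `|f (h + x) - f x - 'd f x h| <= e * `|h|.
Proof.
move=> /diff_locallyP[_ /eqaddoP/(_ _)] + e0 => /(_ e e0) fdf.
near=> h.
have : `|(f \o shift x - (cst (f x) + 'd f x)) h| <= e * `|h| by near: h.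
by rewrite !fctE /= opprD addrA.
Unshelve. all: by end_near. Qed.

Lemma near0_shift V (x : V) (P : set V) :
  (\forall y \near x, P y) <-> (\forall h \near (0 : V), P (h + x)).
Proof.
by rewrite nbhs0P; split; apply: filter_app; apply: nearW => h; rewrite addrC.
Qed.

Lemma near_is_diff V W (f g df : V -> W) (x : V) :
  (\forall y \near x, f y = g y) -> is_diff x f df -> is_diff x g df.
Proof.
move=> fg [dfx dfE]; rewrite -dfE; apply: is_diff_epsP => [a u v||e e0].
- by rewrite linearP.
- exact: diff_continuous.
have := differentiable_eps dfx e0.
have fgx := nbhs_singleton fg.
move/near0_shift : fg; apply: filterS2 => h fgh.
by rewrite /= in fgh; rewrite fgh fgx.
Qed.

Lemma near_differentiable V W (f g : V -> W) (x : V) :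
  (\forall y \near x, f y = g y) -> differentiable f x -> differentiable g x.
Proof. by move=> fg /differentiableP/(near_is_diff fg)[]. Qed.

Lemma near_diff V W (f g : V -> W) (x : V) :
  (\forall y \near x, f y = g y) -> differentiable f x ->
  'd f x = 'd g x :> (V -> W).
Proof. by move=> fg /differentiableP fd; have [_ ->] := near_is_diff fg fd. Qed.

Lemma is_diff_scale V W (a da : V -> R) (f df : V -> W) (x : V) :
  is_diff x a da -> is_diff x f df ->
  is_diff x (fun y => a y *: f y) (fun v => da v *: f x + a x *: df v).
Proof.
move=> dax dfx.
have bil : bilinear_for (GRing.Scale.Law.clone _ _ *:%R _)
    (GRing.Scale.Law.clone _ _ *:%R _) (@GRing.scale R W).
  split=> [u'|u] b y z /=; first by rewrite scalerDl scalerA.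
  by rewrite scalerDr !scalerA mulrC.
pose bM := bilinear_isBilinear.Build R R W W _ _ (@GRing.scale R W) bil.
pose B : {bilinear R -> W -> W} := HB.pack (@GRing.scale R W) bM.
have cB : continuous (fun p : R * W => B p.1 p.2).
  by move=> p; exact: scale_continuous.
have dB (p : R * W) : is_diff p (fun q => B q.1 q.2)
    (fun q => B p.1 q.2 + B q.1 p.2).
  by apply: DiffDef; [exact: differentiable_bilin | exact: diff_bilin].
have := @is_diff_comp _ _ _ _ _ _ _ _ x (is_diff_pair dax dfx) (dB (a x, f x)).
have -> : (fun v => da v *: f x + a x *: df v) =
    (fun q : R * W => B (a x) q.2 + B q.1 (f x)) \o (fun y => (da y, df y)).
  by apply/funext => v /=; rewrite addrC.
by [].
Qed.

Lemma is_diff_bigsum V W (m : nat) (h dh : 'I_m -> V -> W) (x : V) :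
  (forall i, is_diff x (h i) (dh i)) ->
  is_diff x (fun y => \sum_i h i y) (fun v => \sum_i dh i v).
Proof.
elim: m h dh => [|m IH] h dh dhP.
  have -> : (fun y => \sum_i h i y) = cst 0.
    by apply/funext => y; rewrite big_ord0.
  have -> : (fun v => \sum_i dh i v) = 0 by apply/funext => v; rewrite big_ord0.
  exact: is_diff_cst.
have -> : (fun y => \sum_i h i y) = h ord0 + (fun y => \sum_i h (lift ord0 i) y).
  by apply/funext => y; rewrite big_ord_recl.
have -> : (fun v => \sum_i dh i v) = dh ord0 + (fun v => \sum_i dh (lift ord0 i) v).
  by apply/funext => v; rewrite big_ord_recl.
have := IH _ _ (fun i => dhP (lift ord0 i)); exact: is_diffD (dhP ord0).
Qed.

Lemma is_diff_curve W (g : R -> W) (t : R) (v : W) :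
  is_derive t (1 : R) g v <-> is_diff t g (fun h : R => h *: v).
Proof.
split=> [[+ gv]|[dg gv]].
  move=> /derivable1_diffP dg; apply: DiffDef => //.
  by rewrite diff1E // derive1E gv.
apply: DeriveDef; first exact/derivable1_diffP.
by rewrite deriveE // gv scale1r.
Qed.

End Differentials.

Section CkToolkit.
Context {R : realType}.
Implicit Types V W : normedModType R.

Lemma open_near (T : topologicalType) (U : set T) (x : T) :
  open U -> U x -> \forall y \near x, U y.
Proof. by move=> oU Ux; exact: open_nbhs_nbhs. Qed.

(** As [U] is open, equality on [U] is equality near each of its points, which passes to the
    differentials. *)
Lemma Ck_on_ext V W k (U : set V) (f g : V -> W) : open U ->
  (forall x, U x -> f x = g x) -> Ck_on k U f -> Ck_on k U g.
Proof.
move=> oU; elim: k f g => [|k IH] f g fg /=.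
  move=> cf x Ux; rewrite /prop_for /continuous_at -(fg _ Ux).
  apply: cvg_trans (cf x Ux); apply: near_eq_cvg.
  by near=> y; apply: fg; near: y; exact: open_near.
move=> [df Cf]; have near_fg x : U x -> \forall y \near x, f y = g y.
  by move=> Ux; near=> y; apply: fg; near: y; exact: open_near.
split=> [x Ux|v]; first exact: (near_differentiable (near_fg x Ux) (df x Ux)).
apply: IH (Cf v) => x Ux /=.
by rewrite (near_diff (near_fg x Ux) (df x Ux)).
Unshelve. all: by end_near. Qed.

Lemma Ck_on_sub V W k (U U' : set V) (f : V -> W) :
  U' `<=` U -> Ck_on k U f -> Ck_on k U' f.
Proof.
move=> sU; elim: k f => [|k IH] f /=; first by move=> cf x /sU; exact: cf.
by move=> [df Cf]; split=> [x /sU|v]; [exact: df | exact: IH].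
Qed.

(** Continuity and differentiability are those of the total function [f] at a point, so any set [A]
    containing [x] serves, open or not. *)
Lemma Ck_on_local V W k (U : set V) (f : V -> W) :
  (forall x, U x -> exists2 A : set V, A x & Ck_on k A f) -> Ck_on k U f.
Proof.
elim: k f => [|k IH] f Uf /=.
  by move=> x /Uf[A Ax]; apply.
split=> [x Ux|v]; first by have [A Ax [df _]] := Uf x Ux; exact: df.
by apply: IH => x /Uf[A Ax [_ Cf]]; exists A => //; exact: Cf.
Qed.

Lemma Ck_onW V W k (U : set V) (f : V -> W) : Ck_on k.+1 U f -> Ck_on k U f.
Proof.
elim: k f => [|k IH] f [df Cf]; first by move=> x /df/differentiable_continuous.
by split=> // v; exact: IH.
Qed.

Lemma Ck_on_le V W k k' (U : set V) (f : V -> W) : (k' <= k)%N ->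
  Ck_on k U f -> Ck_on k' U f.
Proof.
move=> /subnK <-; elim: (k - k')%N => [//|j IH]; rewrite addSn => /Ck_onW.
exact: IH.
Qed.

Lemma Ck_on_continuous V W k (U : set V) (f : V -> W) x : Ck_on k U f -> U x ->
  {for x, continuous f}.
Proof. by move=> /(Ck_on_le (leq0n k)); apply. Qed.

Lemma Ck_on_cst V W k (U : set V) (a : W) : Ck_on k U (cst a : V -> W).
Proof.
elim: k a => [|k IH] a /=; first by move=> x _; exact: cst_continuous.
split=> // v; rewrite (_ : (fun x => _) = cst 0); first exact: IH.
by apply/funext => x; rewrite diff_cst.
Qed.

Lemma Ck_on_lincont V W k (U : set V) (l : V -> W) :
  linear l -> continuous l -> Ck_on k U l.
Proof.
move=> lin_l cont_l; case: k => [|k] /=; first by move=> x _; exact: cont_l.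
split=> [x _|v]; first by have [] := is_diff_lincont x lin_l cont_l.
rewrite (_ : (fun x => _) = cst (l v)); first exact: Ck_on_cst.
by apply/funext => x; have [_ ->] := is_diff_lincont x lin_l cont_l.
Qed.

(** The usual way to gain one order below: a formula for the differential whose terms are already
    known to be of class C^k. *)
Lemma Ck_onS V W k (U : set V) (f : V -> W) (df : V -> V -> W) : open U ->
  (forall x, U x -> is_diff x f (df x)) ->
  (forall v, Ck_on k U (fun x => df x v)) -> Ck_on k.+1 U f.
Proof.
move=> oU dfP Cdf; split=> [x /dfP[]//|v].
by apply: Ck_on_ext (Cdf v) => // x /dfP[_ ->].
Qed.

Lemma Ck_on_is_diff V W k (U : set V) (f : V -> W) x : Ck_on k.+1 U f -> U x ->
  is_diff x f ('d f x).
Proof. by move=> [df _] /df/differentiableP. Qed.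

Lemma Ck_on_diff V W k (U : set V) (f : V -> W) v : Ck_on k.+1 U f ->
  Ck_on k U (fun x => 'd f x v).
Proof. by move=> [_]; apply. Qed.

Lemma Ck_on_linl V V' W k (U : set V) (f : V -> V') (l : V' -> W) : open U ->
  linear l -> continuous l -> Ck_on k U f -> Ck_on k U (l \o f).
Proof.
move=> oU lin_l cont_l; elim: k f => [|k IH] f Cf.
  by move=> x Ux; apply: continuous_comp; [exact: Cf | exact: cont_l].
apply: (@Ck_onS _ _ _ _ _ (fun x => l \o 'd f x)) => // [x Ux|v].
  exact: is_diff_comp (Ck_on_is_diff Cf Ux) (is_diff_lincont _ lin_l cont_l).
by apply: (IH (fun x => 'd f x v)); exact: Ck_on_diff Cf.
Qed.

Lemma Ck_onD V W k (U : set V) (f g : V -> W) : open U ->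
  Ck_on k U f -> Ck_on k U g -> Ck_on k U (fun x => f x + g x).
Proof.
move=> oU; elim: k f g => [|k IH] f g Cf Cg.
  by move=> x Ux; apply: (@continuousD _ _ _ f g); [exact: Cf | exact: Cg].
apply: (@Ck_onS _ _ _ _ _ (fun x => 'd f x \+ 'd g x)) => // [x Ux|v].
  have := Ck_on_is_diff Cf Ux; have := Ck_on_is_diff Cg Ux => dg df.
  exact: (is_diffD df dg).
by apply: (IH (fun x => 'd f x v)); [exact: Ck_on_diff Cf|exact: Ck_on_diff Cg].
Qed.

Lemma Ck_on_scale V W k (U : set V) (a : V -> R) (f : V -> W) : open U ->
  Ck_on k U a -> Ck_on k U f -> Ck_on k U (fun x => a x *: f x).
Proof.
move=> oU; elim: k a f => [|k IH] a f Ca Cf.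
  by move=> x Ux; apply: continuousZ; [exact: Ca | exact: Cf].
apply: (@Ck_onS _ _ _ _ _ (fun x v => 'd a x v *: f x + a x *: 'd f x v)) => //.
  by move=> x Ux; apply: is_diff_scale;
    [exact: Ck_on_is_diff Ca _|exact: Ck_on_is_diff Cf _].
move=> v; apply: Ck_onD => //.
  exact: (IH _ f (Ck_on_diff v Ca) (Ck_onW Cf)).
exact: (IH a _ (Ck_onW Ca) (Ck_on_diff v Cf)).
Qed.

Lemma Ck_onM V k (U : set V) (a b : V -> R) : open U ->
  Ck_on k U a -> Ck_on k U b -> Ck_on k U (fun x => a x * b x).
Proof. exact: (@Ck_on_scale V R). Qed.

Lemma Ck_onN V W k (U : set V) (f : V -> W) : open U ->
  Ck_on k U f -> Ck_on k U (fun x => - f x).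
Proof.
move=> oU Cf; rewrite (_ : (fun x => _) = fun x => cst (-1) x *: f x).
  by apply: Ck_on_scale => //; exact: Ck_on_cst.
by apply/funext => x; rewrite scaleN1r.
Qed.

Lemma Ck_onB V W k (U : set V) (f g : V -> W) : open U ->
  Ck_on k U f -> Ck_on k U g -> Ck_on k U (fun x => f x - g x).
Proof. by move=> oU Cf Cg; apply: Ck_onD => //; exact: Ck_onN. Qed.

Lemma Ck_on_sum V W k (U : set V) (I : Type) (r : seq I) (P : pred I)
    (f : I -> V -> W) : open U -> (forall i, Ck_on k U (f i)) ->
  Ck_on k U (fun x => \sum_(i <- r | P i) f i x).
Proof.
move=> oU Cf; elim: r => [|i r IH].
  by rewrite (_ : (fun x => _) = cst 0); [exact: Ck_on_cst | apply/funext => x;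
    rewrite big_nil].
rewrite (_ : (fun x => _) = fun x =>
  (if P i then f i x else 0) + \sum_(i <- r | P i) f i x); last first.
  by apply/funext => x; rewrite big_cons; case: ifP => //; rewrite add0r.
by apply: Ck_onD => //; case: (P i); [exact: Cf | exact: Ck_on_cst].
Qed.

Lemma Ck_on_prod V k (U : set V) (I : Type) (r : seq I) (P : pred I)
    (f : I -> V -> R) : open U -> (forall i, Ck_on k U (f i)) ->
  Ck_on k U (fun x => \prod_(i <- r | P i) f i x).
Proof.
move=> oU Cf; elim: r => [|i r IH].
  by rewrite (_ : (fun x => _) = cst 1); [exact: Ck_on_cst | apply/funext => x;
    rewrite big_nil].
rewrite (_ : (fun x => _) = fun x =>
  (if P i then f i x else 1) * \prod_(i <- r | P i) f i x); last first.
  by apply/funext => x; rewrite big_cons; case: ifP => //; rewrite mul1r.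
by apply: Ck_onM => //; case: (P i); [exact: Cf | exact: Ck_on_cst].
Qed.

Lemma Ck_onV V k (U : set V) (a : V -> R) : open U ->
  (forall x, U x -> a x != 0) -> Ck_on k U a -> Ck_on k U (fun x => (a x)^-1).
Proof.
move=> oU a0; elim: k => [|k IH] Ca.
  by move=> x Ux; apply: continuousV; [exact: a0 | exact: Ca].
apply: (@Ck_onS _ _ _ _ _ (fun x v => - (a x)^-1 * (a x)^-1 * 'd a x v)) => //.
  move=> x Ux; have da : differentiable a x by have [+ _] := Ca; apply.
  apply: DiffDef; first exact: differentiableV (a0 _ Ux).
  rewrite diffV ?a0//; apply/funext => v /=.
  by rewrite expr2 invfM mulNr.
move=> v; have CV := IH (Ck_onW Ca).
apply: Ck_onM => //; last by exact: Ck_on_diff Ca.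
by apply: Ck_onM => //; exact: Ck_onN.
Qed.

Lemma Ck_on_pair V W W' k (U : set V) (f : V -> W) (g : V -> W') : open U ->
  Ck_on k U f -> Ck_on k U g -> Ck_on k U (fun x => (f x, g x)).
Proof.
move=> oU; elim: k f g => [|k IH] f g Cf Cg.
  by move=> x Ux; apply: cvg_pair; [exact: Cf | exact: Cg].
apply: (@Ck_onS _ _ _ _ _ (fun x v => ('d f x v, 'd g x v))) => // [x Ux|v].
  by apply: is_diff_pair; [exact: Ck_on_is_diff Cf _ | exact: Ck_on_is_diff Cg _].
by apply: (IH (fun x => 'd f x v)); [exact: Ck_on_diff Cf|exact: Ck_on_diff Cg].
Qed.

(** Finite dimension, without choosing a basis. [Ck_on] controls derivatives in fixed directions
    only, whereas in the chain rule the direction ['d f x v] moves with [x]; expanding it in a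
    finite frame leads back to the fixed directions [e i]. *)
Definition framed V := exists (m : nat) (e : 'I_m -> V) (l : 'I_m -> V -> R),
  [/\ forall i, linear (l i), forall i, continuous (l i) &
      forall v, v = \sum_i l i v *: e i].

Lemma Ck_on_comp V V' W k (U : set V) (U' : set V') (f : V -> V') (g : V' -> W) :
  framed V' -> open U -> open U' -> (forall x, U x -> U' (f x)) ->
  Ck_on k U f -> Ck_on k U' g -> Ck_on k U (g \o f).
Proof.
move=> [m [e [l [lin_l cont_l el]]]] oU oU' fU.
elim: k g => [|k IH] g Cf Cg.
  move=> x Ux; apply: continuous_comp; first exact: Cf.
  by apply: Cg; exact: fU.
apply: (@Ck_onS _ _ _ _ _ (fun x => 'd g (f x) \o 'd f x)) => // [x Ux|v].
  have df := Ck_on_is_diff Cf Ux; have dg := Ck_on_is_diff Cg (fU _ Ux).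
  exact: is_diff_comp.
rewrite (_ : (fun x => _) = fun x =>
    \sum_i (l i \o (fun y => 'd f y v)) x *:
      ((fun y => 'd g y (e i)) \o f) x); last first.
  apply/funext => x /=; rewrite [in LHS](el ('d f x v)) linear_sum.
  by apply: eq_bigr => i _; rewrite linearZ.
apply: Ck_on_sum => // i; apply: Ck_on_scale => //.
- by apply: Ck_on_linl => //; exact: Ck_on_diff Cf.
- by apply: (IH (fun y => 'd g y (e i))); [exact: Ck_onW | exact: Ck_on_diff Cg].
Qed.

Lemma framed_real : framed R.
Proof.
exists 1%N, (fun=> 1), (fun=> id); split=> [i a u v|i x|v] //.
by rewrite big_ord_recl big_ord0 addr0 [RHS]mulr1.
Qed.

Lemma framed_rV n : framed 'rV[R]_n.
Proof.
exists n, (delta_mx 0), (fun i (v : 'rV_n) => v 0 i); split=> [i a u v|i|v].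
- by rewrite !mxE.
- exact: coord_continuous.
- exact: row_sum_delta.
Qed.

Lemma framed_mx p q : framed 'M[R]_(p, q).
Proof.
exists #|{: 'I_p * 'I_q}|,
  (fun k => delta_mx (enum_val k).1 (enum_val k).2),
  (fun k (v : 'M[R]_(p, q)) => v (enum_val k).1 (enum_val k).2).
split=> [i a u v|i|v].
- by rewrite !mxE.
- exact: coord_continuous.
- rewrite [LHS]matrix_sum_delta pair_big /=.
  by rewrite (reindex (@enum_val {: 'I_p * 'I_q} predT)) //; apply: onW_bij;
    exact: enum_val_bij.
Qed.

Lemma framed_prod V W : framed V -> framed W -> framed (V * W)%type.
Proof.
move=> [m [e [l [lin_l cont_l el]]]] [n [e' [l' [lin_l' cont_l' el']]]].
exists (m + n)%N,
  (fun i => match fintype.split i with inl j => (e j, 0) | inr j => (0, e' j) end),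
  (fun i v => match fintype.split i with inl j => l j v.1 | inr j => l' j v.2 end).
split=> [i a u v|i|[v w]].
- by case: fintype.split => j; [exact: lin_l | exact: lin_l'].
- case: fintype.split => j x; first by apply: continuous_comp;
  [exact: cvg_fst|exact: cont_l].
  by apply: continuous_comp; [exact: cvg_snd | exact: cont_l'].
- rewrite big_split_ord /=.
  under eq_bigr do rewrite (unsplitK (inl _)).
  under [X in _ + X]eq_bigr do rewrite (unsplitK (inr _)).
  rewrite [in LHS](el v) [in LHS](el' w).
  have pair_sum (I : finType) (F : I -> V) (G : I -> W) :
      \sum_i (F i, G i) = (\sum_i F i, \sum_i G i).
    apply/esym; apply: (big_rec3 (fun x y z => (x, y) = z)) => //.
    by move=> i x y z _ <-.
  have -> : \sum_i l i v *: (e i, 0) = \sum_i (l i v *: e i, 0) :> V * W.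
    by apply: eq_bigr => i _; congr pair; rewrite scaler0.
  have -> : \sum_i l' i w *: (0, e' i) = \sum_i (0, l' i w *: e' i) :> V * W.
    by apply: eq_bigr => i _; congr pair; rewrite scaler0.
  rewrite !pair_sum !big1_eq; congr pair => /=; first by rewrite addr0.
  by rewrite add0r.
Qed.

Lemma framed_continuous V W (l : V -> W) : framed V -> linear l -> continuous l.
Proof.
move=> [m [e [c [lin_c cont_c ec]]]] lin_l.
pose lM := GRing.isLinear.Build _ _ _ _ _ lin_l.
pose L : {linear V -> W} := HB.pack l lM.
have -> : l = fun v => \sum_i c i v *: l (e i).
  apply/funext => v; rewrite [in LHS](ec v) -[l]/(L : V -> W) linear_sum.
  by apply: eq_bigr => i _; rewrite linearZ.
move=> x; have : Ck_on 0 setT (fun v => \sum_i c i v *: l (e i)).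
  apply: Ck_on_sum => [|i]; first exact: openT.
  apply: Ck_on_scale; first exact: openT.
  - exact: Ck_on_lincont.
  - exact: Ck_on_cst.
by apply.
Qed.

Lemma Ck_on_mxP V p q k (U : set V) (f : V -> 'M[R]_(p, q)) : open U ->
  Ck_on k U f <-> forall i j, Ck_on k U (fun x => f x i j).
Proof.
move=> oU; split=> [Cf i j|Cf].
  apply: (@Ck_on_linl _ _ _ _ _ f (fun v : 'M[R]_(p, q) => v i j)) => //.
  - by move=> a u v; rewrite !mxE.
  - exact: coord_continuous.
rewrite (_ : f = fun x => \sum_i \sum_j f x i j *: delta_mx i j); last first.
  by apply/funext => x; exact: matrix_sum_delta.
apply: Ck_on_sum => // i; apply: Ck_on_sum => // j; apply: Ck_on_scale => //.
exact: Ck_on_cst.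
Qed.

Lemma Ck_on_rVP V n k (U : set V) (f : V -> 'rV[R]_n) : open U ->
  Ck_on k U f <-> forall i, Ck_on k U (fun x => f x 0 i).
Proof.
move=> oU; rewrite Ck_on_mxP//.
by split=> [Cf i|Cf i j]; [exact: Cf | rewrite ord1; exact: Cf].
Qed.

Lemma Ck_on_linear V W k (U : set V) (l : V -> W) :
  framed V -> linear l -> Ck_on k U l.
Proof. by move=> fV ll; apply: Ck_on_lincont => //; exact: framed_continuous. Qed.

End CkToolkit.

(** * Mean value inequalities and local flows *)

Section Curves.
Context {R : realType}.

Lemma ler_coord_mx p q (v : 'M[R]_(p, q)) i j : `|v i j| <= `|v|.
Proof.
rewrite [leRHS]/Num.Def.normr/= mx_normrE.
exact: (le_bigmax _ (fun ij : 'I_p * 'I_q => `|v ij.1 ij.2|) (i, j)).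
Qed.

Lemma mx_norm_le p q (v : 'M[R]_(p, q)) (C : R) : 0 <= C ->
  (forall i j, `|v i j| <= C) -> `|v| <= C.
Proof.
move=> C0 vC; rewrite [leLHS]/Num.Def.normr/= mx_normrE.
by apply: bigmax_le => // -[i j] _ /=.
Qed.

Lemma ler_coord_rV n (v : 'rV[R]_n) i : `|v 0 i| <= `|v|.
Proof. exact: ler_coord_mx. Qed.

Lemma rV_norm_le n (v : 'rV[R]_n) (C : R) : 0 <= C ->
  (forall i, `|v 0 i| <= C) -> `|v| <= C.
Proof. by move=> C0 vC; apply: mx_norm_le => // i j; rewrite ord1. Qed.

Lemma is_derive_coord p q (g : R -> 'M[R]_(p, q)) (t : R) v i j :
  is_derive t (1 : R) g v -> is_derive t (1 : R) (fun s => g s i j) (v i j).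
Proof.
move=> /is_diff_curve dg; apply/is_diff_curve.
have cl : linear (fun w : 'M[R]_(p, q) => w i j) by move=> a u w; rewrite !mxE.
have := is_diff_comp dg (is_diff_lincont (g t) cl (@coord_continuous _ _ _ _ _)).
congr is_diff_def; apply/funext => h /=.
by rewrite !mxE.
Qed.

Lemma is_derive_rV n (g : R -> 'rV[R]_n) (t : R) (v : 'rV[R]_n) :
  (forall i, is_derive t (1 : R) (fun s => g s 0 i) (v 0 i)) ->
  is_derive t (1 : R) g v.
Proof.
move=> dg; have dgt : derivable g t 1.
  by apply/derivable_mxP => i j; rewrite ord1; have [] := dg j.
apply: DeriveDef => //; rewrite derive_mx //.
by apply/rowP => j; rewrite mxE; have [_ ->] := dg j.
Qed.

Lemma is_derive_continuous (W : normedModType R) (g : R -> W) (t : R) v :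
  is_derive t (1 : R) g v -> {for t, continuous g}.
Proof. by move=> [/derivable1_diffP/differentiable_continuous]. Qed.

Lemma real_mean_value (f df : R -> R) (a b C : R) : a <= b ->
  (forall t, a <= t <= b -> is_derive t (1 : R) f (df t)) ->
  (forall t, a <= t <= b -> `|df t| <= C) ->
  `|f b - f a| <= C * (b - a).
Proof.
rewrite le_eqVlt => /predU1P[->|ab] dfP dfC; first by rewrite !subrr normr0 mulr0.
have [||c] := @MVT _ f df a b ab.
- by move=> x /[!in_itv]/= /andP[ax xb]; apply: dfP; rewrite !ltW.
- apply: derivable_within_continuous => x /[!in_itv]/= xab.
  by have [] := dfP x xab.
move=> /[!in_itv]/= /andP[ac cb] ->.
rewrite normrM [`|b - a|]gtr0_norm ?subr_gt0// ler_wpM2r//.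
  by rewrite subr_ge0 ltW.
by apply: dfC; rewrite !ltW.
Qed.

(** The norm of a matrix is the largest absolute value of its entries, so the real inequality
    applies to each entry with the same constant. *)
Lemma mean_value p q (f df : R -> 'M[R]_(p, q)) (a b C : R) : a <= b ->
  (forall t, a <= t <= b -> is_derive t (1 : R) f (df t)) ->
  (forall t, a <= t <= b -> `|df t| <= C) ->
  `|f b - f a| <= C * (b - a).
Proof.
move=> ab dfP dfC; have C0 : 0 <= C.
  by apply: le_trans (dfC a _); rewrite ?lexx// normr_ge0.
apply: mx_norm_le => [|i j]; first by rewrite mulr_ge0// subr_ge0.
rewrite !mxE; apply: (@real_mean_value (fun t => f t i j) (fun t => df t i j)) =>
  // t tab.
  exact: is_derive_coord (dfP t tab).
exact: le_trans (ler_coord_mx _ _ _) (dfC t tab).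
Qed.

Lemma mean_value_dist p q (f df : R -> 'M[R]_(p, q)) (s t C : R) :
  (forall u, Num.min s t <= u <= Num.max s t -> is_derive u (1 : R) f (df u)) ->
  (forall u, Num.min s t <= u <= Num.max s t -> `|df u| <= C) ->
  `|f t - f s| <= C * `|t - s|.
Proof.
move=> dfP dfC; have [st|/ltW ts] := leP s t.
- move: dfP dfC; rewrite (min_idPl st) (max_idPr st) => dfP dfC.
  by rewrite ger0_norm ?subr_ge0//; exact: mean_value dfP dfC.
- move: dfP dfC; rewrite (min_idPr ts) (max_idPl ts) => dfP dfC.
  rewrite distrC [`|t - s|]distrC ger0_norm ?subr_ge0//; exact: mean_value dfP dfC.
Qed.

Lemma minmax_norm (t u T : R) : `|t| < T -> Num.min 0 t <= u <= Num.max 0 t ->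
  `|u| < T.
Proof.
rewrite !ltr_norml => /andP[tT Tt]; have T0 : 0 < T by lra.
have [t0|t0] := leP 0 t => /andP[u1 u2]; apply/andP; split; lra.
Qed.

Lemma minmax_norm_le (t u : R) : Num.min 0 t <= u <= Num.max 0 t -> `|u| <= `|t|.
Proof.
have [t0|t0] := leP 0 t => /andP[u1 u2].
  by rewrite !ger0_norm//; lra.
by rewrite !ler0_norm//; lra.
Qed.

Lemma minmax_dist (s t u : R) : Num.min s t <= u <= Num.max s t ->
  `|u - s| <= `|t - s|.
Proof.
have [st|/ltW ts] := leP s t => /andP[u1 u2].
  by rewrite !ger0_norm ?subr_ge0// lerD2r.
by rewrite !ler0_norm ?subr_le0// lerN2 lerD2r.
Qed.

(* As [T * L <= 1/2], the term [T * L * max |e|] is absorbed by [max |e|]. *)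
Lemma gronwall n (e de : R -> 'rV[R]_n) (T L c : R) :
  0 <= L -> 0 <= c -> T * L <= 2^-1 ->
  (forall t, `|t| < T -> is_derive t (1 : R) e (de t)) ->
  (forall t, `|t| < T -> `|de t| <= L * `|e t| + c) ->
  forall t, `|t| < T -> `|e t| <= 2 * (`|e 0| + T * c).
Proof.
move=> L0 c0 TL deP dele t tT.
have T0 : 0 < T by exact: le_lt_trans tT.
have stT s : - `|t| <= s <= `|t| -> `|s| < T.
  by rewrite -ler_norml => /le_lt_trans; apply.
have [||m] := @EVT_max _ (fun s => `|e s|) (- `|t|) `|t|.
- by have := normr_ge0 t; lra.
- apply: continuous_in_subspaceT => s; rewrite inE /= in_itv /= => /stT sT.
  by apply: continuous_comp; [exact: is_derive_continuous
    (deP s sT)|exact: norm_continuous].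
rewrite in_itv /= => mt emax; have mT := stT _ mt.
have tle : `|e t| <= `|e m|.
  by apply: emax; rewrite in_itv /= -ler_norml.
have em : `|e m - e 0| <= (L * `|e m| + c) * `|m - 0|.
  apply: (@mean_value_dist _ _ e de) => u um; first by apply: deP;
    exact: minmax_norm um.
  have uT : `|u| < T by exact: minmax_norm um.
  apply: le_trans (dele u uT) _; rewrite lerD2r ler_wpM2l//.
  apply: emax; rewrite in_itv /= -ler_norml.
  apply: le_trans (minmax_norm_le um) _.
  by rewrite ler_norml.
have : `|e m| <= `|e 0| + `|e m - e 0|
  by rewrite addrC -[in leLHS](subrK (e 0) (e m)) ler_normD.
move: em; rewrite subr0 => em.
have : (L * `|e m| + c) * `|m| <= (L * `|e m| + c) * T.
  by rewrite ler_wpM2l ?addr_ge0 ?mulr_ge0 ?normr_ge0// ltW.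
have : T * L * `|e m| <= 2^-1 * `|e m| by rewrite ler_wpM2r.
lra.
Qed.

Lemma is_derive_comp (V W : normedModType R) (g : R -> V) (f df : V -> W) t v :
  is_derive t (1 : R) g v -> is_diff (g t) f df ->
  is_derive t (1 : R) (f \o g) (df v).
Proof.
move=> /is_diff_curve dg dfg; apply/is_diff_curve.
have := is_diff_comp dg dfg; congr is_diff_def; apply/funext => h /=.
by have [_ <-] := dfg; rewrite linearZ.
Qed.

End Curves.

(** * Antiderivatives, truncation and geometric convergence *)

Section Picard.
Context {R : realType}.

Lemma antiderivative_real (g : R -> R) (T : R) : continuous g -> 0 <= T ->
  exists2 G : R -> R, G 0 = 0 &
    forall t, `|t| <= T -> is_derive t (1 : R) G (g t).
Proof.
(* Integrating from [- (T + 1)] and subtracting the value at 0 treats both signs of [t] at once; the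
   margin 1 keeps [t] in the interior of the interval, where the derivative is two-sided. *)
move=> cg T0; pose a := - (T + 1); pose u := T + 1.
pose F x := (\int[@lebesgue_measure R]_(t in [set` `[a, x]]) (g t))%R.
have gi : (@lebesgue_measure R).-integrable `[a, u] (EFin \o g).
  apply: continuous_compact_integrable; first exact: segment_compact.
  exact: continuous_subspaceT.
exists (fun t => F t - F 0); first by rewrite subrr.
move=> t; rewrite ler_norml => /andP[Tt tT].
have [|||dF F'] := @continuous_FTC1_closed _ g a t u _ gi.
- by rewrite /u; lra.
- by rewrite /a; lra.
- exact: cg.
have dFt : is_derive t (1 : R) F (g t).
  by apply: DeriveDef; [exact: dF | rewrite -derive1E; exact: F'].
by rewrite -[g t]subr0; exact: is_deriveB.
Qed.

Lemma antiderivative n (g : R -> 'rV[R]_n) (T : R) : continuous g -> 0 <= T ->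
  exists2 G : R -> 'rV[R]_n, G 0 = 0 &
    forall t, `|t| <= T -> is_derive t (1 : R) G (g t).
Proof.
move=> cg T0.
have cgi i : continuous (fun t => g t 0 i).
  move=> t; apply: (@continuous_comp _ _ _ g (fun v : 'rV[R]_n => v 0 i)).
    exact: cg.
  exact: coord_continuous.
have /choice[G GP] : forall i, exists Gi : R -> R, Gi 0 = 0 /\
    forall t, `|t| <= T -> is_derive t (1 : R) Gi (g t 0 i).
  by move=> i; have [Gi ? ?] := antiderivative_real (cgi i) T0; exists Gi.
exists (fun t => \row_i G i t).
  by apply/rowP => i; rewrite !mxE; have [] := GP i.
move=> t tT; apply: is_derive_rV => i.
rewrite (_ : (fun s => _) = G i); last by apply/funext => s; rewrite mxE.
by have [_] := GP i; exact.
Qed.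

(** Projection of the line onto [[-T, T]], for [T >= 0]. Composed with it, a function known on that
    interval becomes continuous on the whole line. *)
Definition clip (T t : R) : R := Num.max (- T) (Num.min t T).

Lemma clip_id (T t : R) : `|t| <= T -> clip T t = t.
Proof.
rewrite ler_norml /clip => /andP[Tt tT].
by rewrite (min_idPl tT) (max_idPr Tt).
Qed.

Lemma clip_le (T t : R) : 0 <= T -> `|clip T t| <= T.
Proof.
move=> T0; rewrite /clip ler_norml le_max lexx /= ge_max ge_min lexx orbT andbT.
lra.
Qed.

Lemma clip_lip (T s t : R) : `|clip T s - clip T t| <= `|s - t|.
Proof.
have main x y : x <= y -> `|clip T x - clip T y| <= `|x - y|.
  move=> xy; rewrite [leRHS]distrC [leRHS]ger0_norm ?subr_ge0// ler_norml /clip.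
  by have [?|?] := leP x T; have [?|?] := leP y T; have [?|?] := leP (- T) x;
    have [?|?] := leP (- T) y; have [?|?] := leP (- T) T; apply/andP; split; lra.
have [/main//|/ltW/main] := leP s t.
by rewrite distrC [`|t - s|]distrC.
Qed.

Lemma lip_continuous (V W : normedModType R) (f : V -> W) (L : R) :
  (forall x y, `|f x - f y| <= L * `|x - y|) -> continuous f.
Proof.
move=> fL x; apply/cvgrPdist_le => e e0.
pose K := `|L| + 1; have K0 : 0 < K by rewrite ltr_wpDl.
near=> y; apply: le_trans (fL x y) _.
apply: (@le_trans _ _ (K * `|x - y|)).
  by rewrite ler_wpM2r// (le_trans (ler_norm _))// lerDl.
rewrite -ler_pdivlMl//; near: y.
by apply: cvgr_dist_le; [exact: cvg_id | rewrite mulr_gt0 ?invr_gt0].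
Unshelve. all: by end_near. Qed.

Lemma geometric_limit n (u : nat -> 'rV[R]_n) (C : R) : 0 <= C ->
  (forall k, `|u k.+1 - u k| <= C / 2 ^+ k) ->
  exists l, forall k, `|l - u k| <= 2 * C / 2 ^+ k.
Proof.
move=> C0 uC.
have half k : C / 2 ^+ k = 2 * (C / 2 ^+ k.+1).
  by rewrite exprS invfM !mulrA [2 * C]mulrC mulfK ?pnatr_eq0.
(* The exact sum of the geometric terms from [k] to [k + j - 1]; with the bound [2 * (C / 2 ^+ k)]
   alone the induction on [j] would not close. *)
have uj k j : `|u (k + j)%N - u k| <= 2 * (C / 2 ^+ k) - 2 * (C / 2 ^+ (k + j)).
  elim: j => [|j IH]; first by rewrite addn0 !subrr normr0.
  have := ler_normD (u (k + j).+1 - u (k + j)%N) (u (k + j)%N - u k).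
  rewrite subrKA addnS => /le_trans; apply.
  have := uC (k + j)%N; have := half (k + j)%N; lra.
have cvg2 : (fun k => 2 * (C / 2 ^+ k) : R) @ \oo --> (0 : R).
  rewrite -(mulr0 2); apply: cvgMl_tmp; rewrite -(mulr0 C); apply: cvgMl_tmp.
  under eq_fun do rewrite -exprVn.
  by apply: cvg_expr; rewrite ger0_norm ?invr_ge0// invf_lt1// ltr1n.
have cu : cvgn u.
  apply/cauchy_cvgP/cauchy_ballP => e e0.
  have /cvgrPdist_lt/(_ _ e0)[N _ HN] := cvg2.
  have e20 : 0 < e / 2 by rewrite divr_gt0.
  have /cvgrPdist_lt/(_ _ e20)[N' _ HN'] := cvg2.
  have close k : (N' <= k)%N -> `|u k - u N'| < e / 2.
    move=> N'k; rewrite -(subnKC N'k); apply: le_lt_trans (uj _ _) _.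
    have := HN' N' (leqnn N'); rewrite /= sub0r normrN ger0_norm; last first.
      by rewrite !mulr_ge0// invr_ge0 exprn_ge0.
    have : 0 <= 2 * (C / 2 ^+ (N' + (k - N'))).
      by rewrite !mulr_ge0// invr_ge0 exprn_ge0.
    lra.
  exists (u @` [set k | (N' <= k)%N], u @` [set k | (N' <= k)%N]).
    by split; exists N' => // k /= ?; exists k.
  move=> [_ _] /= [[i Ni <-] [j Nj <-]].
  rewrite -ball_normE /ball_ /=.
  have := ler_distD (u N') (u i) (u j);
    rewrite [`|u N' - _|]distrC => /le_lt_trans; apply.
  by rewrite [ltRHS](splitr e) ltrD// close.
exists (limn u) => k; rewrite distrC.
have : (fun j => `|u k - u (k + j)%N|) @ \oo --> `|u k - limn u|.
  apply: cvg_norm; apply: cvgB; first exact: cvg_cst.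
  exact: cvg_comp (cvg_addnl k) cu.
move=> /cvgr_to_le; apply; near=> j.
rewrite distrC; apply: le_trans (uj k j) _.
have : 0 <= 2 * (C / 2 ^+ (k + j)) by rewrite !mulr_ge0// invr_ge0 exprn_ge0.
lra.
Unshelve. all: by end_near. Qed.

(** Serves to pass to the limit in estimates that hold up to a geometric error, first of all to show
    that a limit of iterates is a fixed point. *)
Lemma geometric_le0 (x C : R) : (forall k, x <= C / 2 ^+ k) -> x <= 0.
Proof.
move=> xC; have cv : (fun k => x - C / 2 ^+ k) @ \oo --> x - 0.
  apply: cvgB; first exact: cvg_cst.
  rewrite -(mulr0 C); apply: cvgMl_tmp; under eq_fun do rewrite -exprVn.
  by apply: cvg_expr; rewrite ger0_norm ?invr_ge0// invf_lt1// ltr1n.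
by rewrite -(subr0 x); apply: (cvgr_to_le cv); apply: nearW => k; rewrite subr_le0.
Qed.

End Picard.

(** * Existence of integral curves *)

Section PicardLindelof.
Context {R : realType} {n : nat}.
Local Notation E := 'rV[R]_n.

(** The balls of the maximum norm are cubes, so truncating each coordinate retracts onto the closed
    ball without increasing distances. A field that is Lipschitz and bounded on the ball becomes so
    on the whole space. *)
Definition retract (y0 : E) (r : R) (y : E) : E :=
  y0 + \row_i clip r ((y - y0) 0 i).

Lemma retract_id (y0 : E) (r : R) (y : E) : `|y - y0| <= r -> retract y0 r y = y.
Proof.
move=> yr; rewrite /retract -[RHS](subrKC y0); congr (_ + _).
apply/rowP => i; rewrite mxE clip_id //.
exact: le_trans (ler_coord_rV _ _) yr.
Qed.

Lemma retract_le (y0 : E) (r : R) (y : E) : 0 <= r -> `|retract y0 r y - y0| <= r.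
Proof.
move=> r0; rewrite /retract addrC addKr; apply: rV_norm_le => // i.
by rewrite mxE clip_le.
Qed.

Lemma retract_lip (y0 : E) (r : R) (a b : E) :
  `|retract y0 r a - retract y0 r b| <= `|a - b|.
Proof.
rewrite /retract opprD addrACA subrr add0r; apply: rV_norm_le => // i.
rewrite !mxE; apply: le_trans (clip_lip _ _ _) _.
by have := ler_coord_rV (a - b) i; rewrite !mxE opprB addrA subrK.
Qed.

(** Since [T * L <= 2^-1], the integral operator [Phi] halves uniform distances, and its iterates
    converge to a fixed point. All iterates after the first are [M]-Lipschitz, hence so is the
    limit, which is therefore continuous and can be integrated. *)
Lemma picard_global (X : E -> E) (L M T : R) (y : E) :
  0 <= L -> 0 < T -> T * L <= 2^-1 ->
  (forall a b, `|X a - X b| <= L * `|a - b|) -> (forall a, `|X a| <= M) ->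
  exists g : R -> E,
    g 0 = y /\ forall t, `|t| < T -> is_derive t (1 : R) g (X (g t)).
Proof.
move=> L0 T0 TL XL XM.
have M0 : 0 <= M by apply: le_trans (XM y); rewrite normr_ge0.
have T0' := ltW T0.
have cX : continuous X by exact: lip_continuous XL.
(* A primitive is chosen for every curve, an arbitrary one if the curve is not continuous, so that
   [Phi] below is a total operation on curves. *)
have /choice[A AP] : forall h : R -> E, exists G : R -> E, continuous h ->
    G 0 = 0 /\ forall t, `|t| <= T -> is_derive t (1 : R) G (h t).
  move=> h; have [ch|nch] := pselect (continuous h); last by exists 0.
  by have [G G0 GP] := antiderivative ch T0'; exists G.
(* [clip] freezes the new curve outside [[-T, T]]: it is continuous on the whole line and the
   estimates hold for all [t]. *)
pose Phi (g : R -> E) t := y + A (X \o g) (clip T t).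
have A_diff h1 h2 (C : R) : continuous h1 -> continuous h2 ->
    (forall t, `|h1 t - h2 t| <= C) ->
    forall t, `|A h1 (clip T t) - A h2 (clip T t)| <= T * C.
  move=> c1 c2 hC t; have [A10 A1] := AP _ c1; have [A20 A2] := AP _ c2.
  have C0 : 0 <= C by apply: le_trans (hC 0); rewrite normr_ge0.
  have tT := clip_le t T0'.
  have := @mean_value_dist _ _ _ (A h1 \- A h2) (h1 \- h2) 0 (clip T t) C.
  rewrite /= A10 A20 !subr0 => /(_ _ _)/le_trans; apply.
  - move=> u /minmax_norm_le /le_trans/(_ tT) uT.
    by apply: is_deriveB; [exact: A1 | exact: A2].
  - by move=> u _; exact: hC.
  - by rewrite mulrC ler_wpM2r.
have Phi_lip g : continuous g -> forall s t,
    `|Phi g s - Phi g t| <= M * `|s - t|.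
  move=> cg s t; rewrite /Phi opprD addrACA subrr add0r.
  have cXg : continuous (X \o g).
    by move=> u; apply: continuous_comp; [exact: cg | exact: cX].
  have [_ AD] := AP _ cXg.
  apply: le_trans (_ : M * `|clip T s - clip T t| <= _); last first.
    by rewrite ler_wpM2l// clip_lip.
  apply: (@mean_value_dist _ _ _ _ (X \o g)) => u /andP[u1 u2]; last exact: XM.
  apply: AD; rewrite ler_norml.
  have := clip_le s T0'; have := clip_le t T0'; rewrite !ler_norml.
  by move: u1 u2; have [?|?] := leP (clip T t) (clip T s); lra.
have Phi_cont g : continuous g -> continuous (Phi g).
  by move=> cg; exact: lip_continuous (Phi_lip g cg).
have Phi_contr g1 g2 (C : R) : continuous g1 -> continuous g2 ->
    (forall t, `|g1 t - g2 t| <= C) ->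
    forall t, `|Phi g1 t - Phi g2 t| <= C / 2.
  move=> c1 c2 gC t; rewrite /Phi opprD addrACA subrr add0r.
  have C0 : 0 <= C by apply: le_trans (gC 0); rewrite normr_ge0.
  have cXg (g : R -> E) : continuous g -> continuous (X \o g).
    by move=> cg u; apply: (@continuous_comp _ _ _ g X); [exact: cg | exact: cX].
  apply: le_trans (_ : T * (L * C) <= _).
    apply: A_diff; [exact: cXg | exact: cXg | move=> u].
    by apply: le_trans (XL _ _) _; rewrite ler_wpM2l.
  by rewrite mulrA mulrC ler_wpM2l.
pose g k := iter k Phi (cst y).
have cg k : continuous (g k).
  elim: k => [|k IH]; first by move=> t; exact: cst_continuous.
  exact: Phi_cont.
have gS k t : `|g k.+1 t - g k t| <= T * M / 2 ^+ k.
  elim: k t => [|k IH] t.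
    rewrite divr1 /g /= /Phi addrC addKr.
    have cXy : continuous (X \o (cst y : R -> E)) by move=> ?;
      exact: cst_continuous.
    have [A0 AD] := AP _ cXy; have tT := clip_le t T0'.
    rewrite -[A _ _]subr0 -A0.
    apply: le_trans (_ : M * `|clip T t - 0| <= _); last first.
      by rewrite subr0 mulrC ler_wpM2r.
    apply: (@mean_value_dist _ _ _ _ (X \o cst y)) => u; last by move=> _;
      exact: XM.
    by move=> /minmax_norm_le /le_trans/(_ tT); exact: AD.
  rewrite exprSr invfM mulrA; apply: (Phi_contr (g k.+1) (g k)) => //; exact: cg.
have TM0 : 0 <= T * M by rewrite mulr_ge0.
have /choice[h hP] : forall t, exists l, forall k,
  `|l - g k t| <= 2 * (T * M) / 2 ^+ k.
  by move=> t; exact: geometric_limit.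
have h_lip s t : `|h s - h t| <= M * `|s - t|.
  rewrite -subr_le0; apply: (@geometric_le0 _ _ (4 * (T * M))) => k.
  have e1 := hP s k.+1; have e2 := hP t k.+1.
  have e3 := Phi_lip _ (cg k) s t.
  have : `|h s - h t| <= `|h s - g k.+1 s| + `|g k.+1 s - g k.+1 t| + `|h t - g
    k.+1 t|.
    have d1 := ler_distD (g k.+1 s) (h s) (h t).
    have d2 := ler_distD (g k.+1 t) (g k.+1 s) (h t).
    rewrite [`|g k.+1 t - h t|]distrC in d2; lra.
  have : 2 * (T * M) / 2 ^+ k.+1 = T * M / 2 ^+ k.
    by rewrite exprS invfM mulrACA divff ?pnatr_eq0// mul1r.
  have : 0 <= T * M / 2 ^+ k by rewrite mulr_ge0// invr_ge0 exprn_ge0.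
  rewrite -[g k.+1]/(Phi (g k)) in e1 e2 *; lra.
have ch : continuous h by exact: lip_continuous h_lip.
have hE t : h t = Phi h t.
  apply/eqP; rewrite -subr_eq0 -normr_le0;
    apply: (@geometric_le0 _ _ (2 * (T * M))) => k.
  have e1 := hP t k.+1.
  have e2 : `|Phi (g k) t - Phi h t| <= 2 * (T * M) / 2 ^+ k / 2.
    by apply: Phi_contr => // s; rewrite distrC.
  have := ler_distD (g k.+1 t) (h t) (Phi h t).
  rewrite exprS invfM [2^-1 * _]mulrC mulrA in e1.
  rewrite -[g k.+1]/(Phi (g k)) in e1 *; lra.
have cXh : continuous (X \o h).
  by move=> u; apply: continuous_comp; [exact: ch | exact: cX].
have [A0 AD] := AP _ cXh.
exists h; split; first by rewrite hE /Phi clip_id ?normr0// A0 addr0.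
move=> t tT.
apply: (@near_eq_is_derive _ _ _ (fun s => cst y s + A (X \o h) s)).
  have : \forall s \near t, `|s| < T.
    exact: (@cvgr_norm_lt _ _ _ _ _ id t (@cvg_id _ _)).
  by apply: filterS => s sT; rewrite [RHS]hE /Phi clip_id// ltW.
rewrite -[X (h t)]add0r; apply: is_deriveD; exact/AD/ltW.
Qed.

(** The solution for the field [X \o retract y0 r] starts at distance at most [r / 2] from [y0] and
    moves by at most [T * M <= r / 2]. It stays in the ball, where the retraction is the
    identity. *)
Lemma picard (X : E -> E) (y0 : E) (r L M T : R) : 0 <= r -> 0 <= L -> 0 < T ->
  T * L <= 2^-1 -> T * M <= r / 2 ->
  (forall a b, `|a - y0| <= r -> `|b - y0| <= r -> `|X a - X b| <= L * `|a - b|) ->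
  (forall a, `|a - y0| <= r -> `|X a| <= M) ->
  forall y, `|y - y0| <= r / 2 -> exists g : R -> E, g 0 = y /\
    forall t, `|t| < T ->
      `|g t - y0| <= r /\ is_derive t (1 : R) g (X (g t)).
Proof.
move=> r0 L0 T0 TL TM XL XM y yr.
have [|||||g [g0 gP]] := @picard_global (X \o retract y0 r) L M T y => //.
- move=> a b /=; apply: le_trans (XL _ _ _ _) _; rewrite ?retract_le//.
  by rewrite ler_wpM2l// retract_lip.
- by move=> a; apply: XM; rewrite retract_le.
exists g; split=> // t tT.
have gr : `|g t - y0| <= r.
  have : `|g t - g 0| <= M * `|t - 0|.
    apply: (@mean_value_dist _ _ _ _ (X \o retract y0 r \o g)) => u.
      by move=> ut; apply: gP; exact: minmax_norm ut.
    by move=> _; apply: XM; rewrite retract_le.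
  have M0 : 0 <= M by apply: le_trans (XM y0 _); rewrite ?subrr ?normr0.
  have : M * `|t| <= M * T by rewrite ler_wpM2l// ltW.
  have := ler_distD (g 0) (g t) y0; rewrite g0 subr0; lra.
split=> //; have := gP t tT.
by rewrite /= retract_id.
Qed.

End PicardLindelof.

(** * Local estimates for maps of class C^1 and C^2 *)

Section LocalEstimates.
Context {R : realType}.
Implicit Types V W : normedModType R.

Lemma near_closed_ball V (x : V) (P : set V) : (\forall y \near x, P y) ->
  exists2 r : R, 0 < r & forall y, `|y - x| <= r -> P y.
Proof.
move=> /nbhs_ballP[e /= e0 eP]; exists (e / 2); first by rewrite divr_gt0.
move=> y yx; apply: eP; rewrite -ball_normE /ball_ /= distrC.
by apply: le_lt_trans yx _; rewrite ltr_pdivrMr// ltr_pMr// ltr1n.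
Qed.

Lemma near_ball V (x : V) (r : R) : 0 < r -> \forall y \near x, `|y - x| < r.
Proof.
move=> r0; apply/nbhs_ballP; exists r => //= y.
by rewrite -ball_normE /ball_ /= distrC.
Qed.

Lemma open_dist_lt V (x : V) (r : R) : open [set y | `|y - x| < r].
Proof.
rewrite openE => y /= yx; have := @near_ball _ y (r - `|y - x|).
rewrite subr_gt0 => /(_ yx); apply: filterS => z zy /=.
by have := ler_distD y z x; lra.
Qed.

Lemma is_derive_segment V (a v : V) (t : R) :
  is_derive t (1 : R) (fun s => a + s *: v) v.
Proof.
apply/is_diff_curve; have [_ sv] := @is_diff_scalel R V t v.
rewrite -[X in is_diff_def _ _ X]add0r; apply: is_diffD.
Qed.

Lemma is_derive_scalel V (v : V) (t : R) :
  is_derive t (1 : R) (fun s => s *: v) v.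
Proof.
by have := is_derive_segment 0 v t; under eq_fun do rewrite add0r.
Qed.

Lemma segment_dist V (x a b : V) (r t : R) : `|a - x| <= r -> `|b - x| <= r ->
  0 <= t <= 1 -> `|a + t *: (b - a) - x| <= r.
Proof.
move=> ax bx /andP[t0 t1].
have -> : a + t *: (b - a) - x = (1 - t) *: (a - x) + t *: (b - x).
  rewrite scalerBl scale1r -[RHS]addrA [- _ + _]addrC -scalerBr opprB.
  by rewrite [b - x + _]addrA subrK addrAC.
apply: le_trans (ler_normD _ _) _; rewrite !normrZ.
rewrite (ger0_norm t0) ger0_norm ?subr_ge0//.
have : (1 - t) * `|a - x| <= (1 - t) * r by rewrite ler_wpM2l// subr_ge0.
have : t * `|b - x| <= t * r by rewrite ler_wpM2l.
lra.
Qed.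

Lemma diff_frame V W (f : V -> W) m (e : 'I_m -> V) (l : 'I_m -> V -> R) x v :
  v = \sum_i l i v *: e i -> 'd f x v = \sum_i l i v *: 'd f x (e i).
Proof.
move=> el; rewrite [in LHS]el linear_sum.
by apply: eq_bigr => i _; rewrite linearZ.
Qed.

Lemma local_lipschitz V p q (U : set V) (f : V -> 'M[R]_(p, q)) (y0 : V) :
  framed V -> open U -> U y0 -> Ck_on 1 U f ->
  exists r L M : R, [/\ 0 < r, 0 <= L, 0 <= M,
    forall a, `|a - y0| <= r -> U a /\ `|f a| <= M &
    forall a b, `|a - y0| <= r -> `|b - y0| <= r ->
      `|f a - f b| <= L * `|a - b|].
Proof.
move=> [m [e [l [lin_l cont_l el]]]] oU Uy0 [df Cf].
have /choice[k kP] : forall i, exists k, 0 < k /\ forall v, `|l i v| <= k * `|v|.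
  by move=> i; have [k k0 kP] := lincont_bound (lin_l i) (cont_l i); exists k.
have cf : {for y0, continuous f} by exact/differentiable_continuous/df.
pose b i : R := `|'d f y0 (e i)| + 1.
have [r r0 rP] : exists2 r : R, 0 < r & forall y, `|y - y0| <= r ->
    [/\ U y, `|f y| < `|f y0| + 1 & forall i, `|'d f y (e i)| < b i].
  apply: near_closed_ball; near=> y; split.
  - by near: y; exact: open_near.
  - by near: y; apply: (cvgr_norm_lt _ cf); rewrite ltrDl.
  - move=> i; move: i; near: y; apply: filter_forall => i.
    by apply: (cvgr_norm_lt _ (Cf (e i) y0 Uy0)); rewrite ltrDl.
(* Expanding [v] in the frame bounds the differential at [v] by the sum of [k i * |v| * b i]. *)
pose L := \sum_i k i * b i.
have b0 i : 0 <= b i by rewrite addr_ge0.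
have L0 : 0 <= L by apply: sumr_ge0 => i _; rewrite mulr_ge0// ltW//;
  have [] := kP i.
exists r, L, (`|f y0| + 1); split=> //.
  by move=> a /rP[Ua fa _]; split=> //; exact: ltW.
move=> x y xr yr; rewrite distrC [`|x - y|]distrC.
have seg t : 0 <= t <= 1 -> `|x + t *: (y - x) - y0| <= r by exact: segment_dist.
have := @mean_value _ _ _ (fun t => f (x + t *: (y - x)))
  (fun t => 'd f (x + t *: (y - x)) (y - x)) 0 1 (L * `|y - x|) ler01.
rewrite scale0r addr0 scale1r [x + _]addrC subrK subr0 mulr1; apply.
  move=> t /seg/rP[Ut _ _].
  apply: (is_derive_comp (g := fun s => x + s *: (y - x))).
    exact: is_derive_segment.
  by apply: differentiableP; exact: df.
move=> t /seg/rP[_ _ dft]; rewrite (diff_frame _ _ (el _)).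
apply: le_trans (ler_norm_sum _ _ _) _; rewrite /L mulr_suml ler_sum// => i _.
rewrite normrZ mulrAC; apply: ler_pM => //; last exact/ltW.
by have [_] := kP i; exact.
Unshelve. all: by end_near. Qed.

(** For the maximum norm an entry of the product is a sum of [p] terms; the dimension factors in the
    later constants come from here. *)
Lemma norm_mulmx_le m p q (A : 'M[R]_(m, p)) (B : 'M[R]_(p, q)) :
  `|A *m B| <= p%:R * (`|A| * `|B|).
Proof.
apply: mx_norm_le => [|i j]; first by rewrite !mulr_ge0.
rewrite mxE; apply: le_trans (ler_norm_sum _ _ _) _.
rewrite [leRHS](_ : _ = \sum_(l < p) `|A| * `|B|); last first.
  by rewrite sumr_const card_ord mulr_natl.
apply: ler_sum => l _; rewrite normrM; apply: ler_pM => //; exact: ler_coord_mx.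
Qed.

(** Vectors are rows and act from the left: the rows of the jacobian are the partial derivatives and
    its row space is the image of the differential. For a parametrization, [<= jacobian] thus means
    tangent to the image, and [row_free] means immersive. *)
Lemma mulmx_jacobian m n (f : 'rV[R]_m -> 'rV[R]_n) x v :
  v *m jacobian f x = 'd f x v.
Proof. by rewrite /jacobian mul_rV_lin1. Qed.

Lemma Ck_on_jacobian m n k (U : set 'rV[R]_m) (f : 'rV[R]_m -> 'rV[R]_n) :
  open U -> Ck_on k.+1 U f -> Ck_on k U (jacobian f).
Proof.
move=> oU Cf; apply/Ck_on_mxP => // i j.
rewrite (_ : (fun x => _) = fun x => 'd f x (delta_mx 0 i) 0 j).
  by have /Ck_on_rVP := Ck_on_diff (delta_mx 0 i) Cf; exact.
by apply/funext => x; rewrite mxE.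
Qed.

(** The mean value inequality for [f (a + t *: (b - a)) - t *: 'd f a (b - a)], whose derivative is
    controlled by the Lipschitz bound on the jacobian. *)
Lemma local_second_order m n (U : set 'rV[R]_m) (f : 'rV[R]_m -> 'rV[R]_n) y0 :
  open U -> U y0 -> Ck_on 2 U f ->
  exists r C : R, [/\ 0 < r, 0 <= C, forall a, `|a - y0| <= r -> U a &
    forall a b, `|a - y0| <= r -> `|b - y0| <= r ->
      `|f b - f a - 'd f a (b - a)| <= C * `|b - a| ^+ 2].
Proof.
move=> oU Uy0 Cf.
have [r [L [M [r0 L0 _ rU JL]]]] :=
  local_lipschitz (framed_rV m) oU Uy0 (Ck_on_jacobian oU Cf).
exists r, (m%:R * L); split=> //; first by rewrite mulr_ge0.
  by move=> a /rU[].
move=> a b ar br.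
have seg t : 0 <= t <= 1 -> `|a + t *: (b - a) - y0| <= r by exact: segment_dist.
have := @mean_value _ _ _ (fun t => f (a + t *: (b - a)) - t *: 'd f a (b - a))
  (fun t => 'd f (a + t *: (b - a)) (b - a) - 'd f a (b - a)) 0 1
  (m%:R * L * `|b - a| ^+ 2) ler01.
rewrite !scale0r addr0 !scale1r [a + _]addrC subrK !subr0 mulr1 addrAC; apply.
  move=> t /seg tr; apply: is_deriveB.
    apply: (is_derive_comp (g := fun s => a + s *: (b - a))).
      exact: is_derive_segment.
    by apply: Ck_on_is_diff (Ck_onW Cf) _; have [] := rU _ tr.
  exact: is_derive_scalel.
move=> t t01.
have -> : 'd f (a + t *: (b - a)) (b - a) - 'd f a (b - a) =
    (b - a) *m (jacobian f (a + t *: (b - a)) - jacobian f a).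
  by rewrite mulmxBr; congr (_ - _); rewrite mulmx_jacobian.
apply: le_trans (norm_mulmx_le _ _) _.
rewrite -!mulrA ler_wpM2l// expr2 mulrA [L * _]mulrC -mulrA ler_wpM2l//.
apply: le_trans (JL _ _ (seg t t01) ar) _.
rewrite ler_wpM2l// addrC addKr normrZ; have /andP[t0 t1] := t01.
by rewrite ger0_norm// ler_piMl.
Qed.

End LocalEstimates.

(** * Differentiability of a flow in time and initial point *)

Section FlowDomain.
Context {R : realType}.
Implicit Types V W : normedModType R.

Definition flowbox V (y0 : V) (T r : R) : set (R * V) :=
  [set p | `|p.1| < T /\ `|p.2 - y0| < r].

Lemma open_flowbox V (y0 : V) (T r : R) : open (flowbox y0 T r).
Proof.
rewrite openE => -[s y] /= [sT yr].
exists ([set s' | `|s'| < T], [set y' | `|y' - y0| < r]) => /=.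
  split; last exact: (open_near (@open_dist_lt _ _ y0 r)).
  have := open_near (@open_dist_lt _ R 0 T).
  by move=> /(_ s); rewrite /= subr0 => /(_ sT); apply: filterS => s' /=;
    rewrite subr0.
by move=> [s' y'] [].
Qed.

Lemma near_flowbox V (y0 : V) (P : set (R * V)) :
  (\forall p \near ((0 : R), y0), P p) ->
  exists2 d : R, 0 < d & flowbox y0 d d `<=` P.
Proof.
move=> /nbhs_ballP[d /= d0 dP]; exists d => // -[s y] [/= sd yd]; apply: dP.
by split=> /=; rewrite -ball_normE /ball_ /= ?sub0r ?normrN// distrC.
Qed.

Lemma is_diff_quad V W (f df : V -> W) (x : V) (K : R) :
  linear df -> continuous df ->
  (\forall h \near (0 : V), `|f (h + x) - f x - df h| <= K * `|h| ^+ 2) ->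
  is_diff x f df.
Proof.
move=> lin_df cont_df fK; apply: is_diff_epsP => // e e0.
have K0 : 0 < `|K| + 1 by rewrite ltr_wpDl.
near=> h; apply: (@le_trans _ _ (K * `|h| ^+ 2)); first by near: h.
apply: (@le_trans _ _ ((`|K| + 1) * `|h| ^+ 2)).
  by rewrite ler_wpM2r ?exprn_ge0// (le_trans (ler_norm _))// lerDl.
rewrite expr2 mulrA ler_wpM2r// -ler_pdivlMl//.
near: h; apply: (@cvgr0_norm_le _ _ _ _ _ id cvg_id).
by rewrite mulr_gt0// invr_gt0.
Unshelve. all: by end_near. Qed.

Lemma prod_norm_fst V W (h : V * W) : `|h.1| <= `|h|.
Proof. by rewrite prod_normE le_max lexx. Qed.

Lemma prod_norm_snd V W (h : V * W) : `|h.2| <= `|h|.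
Proof. by rewrite prod_normE le_max lexx orbT. Qed.

Lemma is_derive_lin V W (g : R -> V) (l : V -> W) t v : linear l -> continuous l ->
  is_derive t (1 : R) g v -> is_derive t (1 : R) (l \o g) (l v).
Proof. by move=> ll cl dg; apply: is_derive_comp => //; exact: is_diff_lincont. Qed.

End FlowDomain.

Section FlowDifferentiable.
Context {R : realType} {n : nat}.
Local Notation E := 'rV[R]_n.
Variables (xi : E -> E) (y0 : E) (r1 L B C M T r : R).
Variables (phi : R * E -> E) (Lam : R * E -> 'M[R]_n).
Hypothesis L0 : 0 <= L.
Hypothesis C0 : 0 <= C.
Hypothesis xi_lip : forall a b, `|a - y0| <= r1 -> `|b - y0| <= r1 ->
  `|xi a - xi b| <= L * `|a - b|.
Hypothesis xi_bound : forall a, `|a - y0| <= r1 -> `|xi a| <= M.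
Hypothesis TL : T * L <= 2^-1.
Hypothesis phi0 : forall y, `|y - y0| < r -> phi (0, y) = y.
Hypothesis phi_ball : forall p, flowbox y0 T r p -> `|phi p - y0| <= r1.
Hypothesis phi_ode : forall s y, flowbox y0 T r (s, y) ->
  is_derive s (1 : R) (fun u => phi (u, y)) (xi (phi (s, y))).

Lemma flow_lip_init s y z : `|s| < T -> `|y - y0| < r -> `|z - y0| < r ->
  `|phi (s, y) - phi (s, z)| <= 2 * `|y - z|.
Proof.
move=> sT yr zr.
have := @gronwall R n (fun u => phi (u, y) - phi (u, z))
  (fun u => xi (phi (u, y)) - xi (phi (u, z))) T L 0 L0 (lexx 0) TL.
rewrite !phi0// mulr0 addr0; apply=> // t tT.
  by apply: is_deriveB; exact: phi_ode.
by rewrite addr0; apply: xi_lip; exact: phi_ball.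
Qed.

Lemma norm_between (s t u : R) : `|s| < T -> `|t| < T ->
  Num.min s t <= u <= Num.max s t -> `|u| < T.
Proof.
rewrite !ltr_norml => /andP[? ?] /andP[? ?].
by have [st|ts] := leP s t => /andP[? ?]; apply/andP; split; lra.
Qed.

Lemma flow_lip_time s t y : `|s| < T -> `|t| < T -> `|y - y0| < r ->
  `|phi (t, y) - phi (s, y)| <= M * `|t - s|.
Proof.
move=> sT tT yr.
apply: (@mean_value_dist _ _ _ (fun u => phi (u, y)) (fun u => xi (phi (u, y)))) =>
  u ust.
  by apply: phi_ode; split=> //; exact: (norm_between sT tT).
by apply/xi_bound/phi_ball; split=> //; exact: (norm_between sT tT).
Qed.

Lemma flow_continuous p : flowbox y0 T r p -> {for p, continuous phi}.
Proof.
case: p => s y sy; have [/= sT yr] := sy.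
have M0 : 0 <= M by apply: le_trans (xi_bound (phi_ball sy)); exact: normr_ge0.
apply/cvgrPdist_le => e e0.
(* The flow has Lipschitz constant 2 in the initial point and [M] in time. *)
pose K := 2 + M; have K0 : 0 < K by rewrite ltr_wpDr.
have close q : flowbox y0 T r q -> `|q - (s, y)| <= e / K ->
    `|phi (s, y) - phi q| <= e.
  case: q => t z [/= tT zr] qe.
  have h1 := le_trans (prod_norm_fst _) qe;
    have h2 := le_trans (prod_norm_snd _) qe.
  rewrite /= in h1 h2; have e1 := flow_lip_time tT sT yr.
  have e2 := flow_lip_init tT yr zr.
  have := ler_distD (phi (t, y)) (phi (s, y)) (phi (t, z)).
  have : M * `|s - t| <= M * (e / K) by rewrite distrC ler_wpM2l.
  have : K * (e / K) = e by rewrite mulrC divfK// gt_eqF.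
  rewrite {1}/K mulrDl; rewrite distrC in h2; lra.
near=> q; apply: close; near: q; first exact: (open_near (@open_flowbox _ _ _ _ _)).
have := @near_ball _ _ (s, y) (e / K); rewrite divr_gt0// => /(_ isT).
by apply: filterS => q /ltW.
Unshelve. all: by end_near. Qed.

Hypothesis xi_quad : forall a b, `|a - y0| <= r1 -> `|b - y0| <= r1 ->
  `|xi b - xi a - (b - a) *m jacobian xi a| <= C * `|b - a| ^+ 2.
Hypothesis jac_bound : forall a, `|a - y0| <= r1 -> `|jacobian xi a| <= B.
Hypothesis TB : T * (n%:R * B) <= 2^-1.
Hypothesis Lam0 : forall y, `|y - y0| < r -> Lam (0, y) = 1%:M.
Hypothesis Lam_ode : forall s y, flowbox y0 T r (s, y) ->
  is_derive s (1 : R) (fun u =>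
    Lam (u, y)) (Lam (s, y) *m jacobian xi (phi (s, y))).

(** The error [e] of the linear approximation vanishes at time 0, and its derivative is
    [e u *m jacobian] plus the Taylor remainder of [xi] between the two trajectories. These are at
    most [2 * |v|] apart, so the remainder is at most [4 * C * |v| ^+ 2], and [gronwall] doubles it
    and multiplies it by [T]. *)
Lemma flow_variation s y v : `|s| < T -> `|y - y0| < r -> `|v + y - y0| < r ->
  `|phi (s, v + y) - phi (s, y) - v *m Lam (s, y)| <= 8 * T * C * `|v| ^+ 2.
Proof.
move=> sT yr vyr.
have B0 : 0 <= B.
  by apply: le_trans (jac_bound (@phi_ball (s, y) _)); rewrite ?normr_ge0.
pose e u := phi (u, v + y) - phi (u, y) - v *m Lam (u, y).
pose de u := xi (phi (u, v + y)) - xi (phi (u, y)) -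
  v *m (Lam (u, y) *m jacobian xi (phi (u, y))).
have := @gronwall R n e de T (n%:R * B) (4 * C * `|v| ^+ 2) _ _ TB _ _ s sT.
have e0 : e 0 = 0 by rewrite /e !phi0// Lam0// mulmx1 addrK subrr.
rewrite e0 normr0 add0r.
move=> /(_ _ _ _ _)/le_trans; apply.
- by rewrite mulr_ge0.
- by rewrite !mulr_ge0// exprn_ge0.
- move=> t tT; apply: is_deriveB; first by apply: is_deriveB; exact: phi_ode.
  apply: (@is_derive_lin _ _ _ (fun u => Lam (u, y)) (mulmx v)).
  + by move=> a A A'; rewrite linearP.
  + by apply: framed_continuous; [exact: framed_mx | move=> a A A';
    rewrite linearP].
  + exact: Lam_ode.
- move=> t tT.
  have ay : `|phi (t, y) - y0| <= r1 by exact: phi_ball.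
  have ay' : `|phi (t, v + y) - y0| <= r1 by exact: phi_ball.
  have -> : de t = (xi (phi (t, v + y)) - xi (phi (t, y)) -
      (phi (t, v + y) - phi (t, y)) *m jacobian xi (phi (t, y))) +
      e t *m jacobian xi (phi (t, y)).
    by rewrite /de /e [X in _ = _ + X]mulmxBl mulmxA addrA subrK.
  apply: le_trans (ler_normD _ _) _; rewrite addrC; apply: lerD.
    apply: le_trans (norm_mulmx_le _ _) _.
    by rewrite -mulrA ler_wpM2l// mulrC ler_wpM2r// jac_bound.
  apply: le_trans (xi_quad ay ay') _.
  rewrite [4 * C]mulrC -mulrA ler_wpM2l//.
  have := flow_lip_init tT vyr yr; rewrite addrK => lip.
  have -> : 4 * `|v| ^+ 2 = (2 * `|v|) ^+ 2 by rewrite exprMn -natrX.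
  by rewrite lerXn2r ?nnegrE ?mulr_ge0.
- by rewrite le_eqVlt; apply/orP; left; apply/eqP; ring.
Qed.

(** The increment is split into a step in the initial point at fixed time [s], handled by
    [flow_variation], and a step in time along the displaced trajectory. *)
Lemma flow_is_diff p : flowbox y0 T r p ->
  is_diff p phi (fun h => h.1 *: xi (phi p) + h.2 *m Lam p).
Proof.
case: p => s y sy; have [/= sT yr] := sy.
have M0 : 0 <= M by apply: le_trans (xi_bound (phi_ball sy)); exact: normr_ge0.
have lin_d : linear (fun h : R * E => h.1 *: xi (phi (s, y)) + h.2 *m Lam (s, y)).
  by move=> a [u1 u2] [v1 v2] /=;
    rewrite scalerDl mulmxDl -scalemxAl scalerDr scalerA addrACA.
(* The first constant is that of [flow_variation]. In the second, [M + 2] bounds, relative to the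
   size of the increment, how far [phi] moves from [phi (s, y)], and [L] turns this into the change
   of velocity during the time step. *)
apply: (@is_diff_quad _ _ _ _ _ _ (8 * T * C + L * (M + 2))) => //.
  by apply: framed_continuous => //; apply: framed_prod;
    [exact: framed_real | exact: framed_rV].
have T0 : 0 < T by exact: le_lt_trans sT.
have : \forall h \near (0 : R * E), flowbox y0 T r (h + (s, y)).
  by have /near0_shift := open_near (@open_flowbox _ _ y0 T r) sy.
apply: filterS => -[sg v] [/= sgT vr].
have yv : `|v + y - y0| < r by [].
have h1 := prod_norm_fst (sg, v); have h2 := prod_norm_snd (sg, v); simpl in h1, h2.
set N := `|(sg, v)| in h1 h2 *.
have N0 : 0 <= N by exact: normr_ge0.
have var := flow_variation sT yr yv.
have time : `|phi (sg + s, v + y) - phi (s, v + y) - sg *: xi (phi (s, y))|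
    <= L * (M * N + 2 * N) * N.
  have := @mean_value_dist _ _ _ (fun u => phi (u, v + y) - u *: xi (phi (s, y)))
    (fun u => xi (phi (u, v + y)) - xi (phi (s,
      y))) s (sg + s) (L * (M * N + 2 * N)).
  have -> : phi (sg + s, v + y) - (sg + s) *: xi (phi (s, y)) -
      (phi (s, v + y) - s *: xi (phi (s, y))) =
      phi (sg + s, v + y) - phi (s, v + y) - sg *: xi (phi (s, y)).
    by rewrite opprB scalerDl opprD !addrA subrK addrAC.
  rewrite addrK => /(_ _ _)/le_trans; apply; last first.
    by rewrite ler_wpM2l// mulr_ge0// addr_ge0// mulr_ge0.
  - move=> u us; have uT := norm_between sT sgT us.
    have ub : `|phi (u, v + y) - y0| <= r1 by exact: phi_ball.
    apply: le_trans (xi_lip ub (phi_ball sy)) _; rewrite ler_wpM2l//.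
    have e1 := flow_lip_time sT uT yv; have e2 := flow_lip_init sT yv yr.
    have := ler_distD (phi (s, v + y)) (phi (u, v + y)) (phi (s, y)).
    have : M * `|u - s| <= M * N.
      rewrite ler_wpM2l// (le_trans _ h1)//.
      by have := minmax_dist us; rewrite addrK.
    rewrite addrK in e2; have v2 : 2 * `|v| <= 2 * N by rewrite ler_wpM2l.
    lra.
  - move=> u us; have uT := norm_between sT sgT us.
    apply: is_deriveB; first exact: phi_ode.
    exact: is_derive_scalel.
have -> : phi (sg + s, v + y) - phi (s, y) - (sg *: xi (phi (s, y)) + v *m Lam (s,
  y)) =
    (phi (sg + s, v + y) - phi (s, v + y) - sg *: xi (phi (s, y))) +
    (phi (s, v + y) - phi (s, y) - v *m Lam (s, y)).
  by rewrite [RHS]addrACA subrKA opprD.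
apply: le_trans (ler_normD _ _) _; rewrite addrC mulrDl; apply: lerD.
  apply: le_trans var _; rewrite ler_wpM2l ?mulr_ge0// ?(ltW T0)//.
  by rewrite lerXn2r ?nnegrE.
by apply: le_trans time _; rewrite expr2 mulrA ler_wpM2r// -mulrA -mulrDl.
Qed.

End FlowDifferentiable.

(** * Local flows of class C^k *)

Section LocalFlow.
Context {R : realType}.

Definition is_local_flow n (W : set 'rV[R]_n) (xi : 'rV[R]_n -> 'rV[R]_n)
    (y0 : 'rV[R]_n) (k : nat) (T r : R) (phi : R * 'rV[R]_n -> 'rV[R]_n) :=
  [/\ 0 < T, 0 < r, forall y, `|y - y0| < r -> phi (0, y) = y,
    forall s y, flowbox y0 T r (s, y) -> W (phi (s, y)) /\
      is_derive s (1 : R) (fun u => phi (u, y)) (xi (phi (s, y))) &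
    Ck_on k (flowbox y0 T r) phi].

Lemma small_time (A c : R) : 0 < c ->
  exists2 d : R, 0 < d & forall T, 0 <= T <= d -> T * A <= c.
Proof.
move=> c0; have A1 : 0 < `|A| + 1 by rewrite ltr_wpDl.
exists (c / (`|A| + 1)) => [|T /andP[T0 Td]]; first by rewrite divr_gt0.
apply: (@le_trans _ _ (T * (`|A| + 1))).
  by rewrite ler_wpM2l// (le_trans (ler_norm _))// lerDl.
by rewrite -ler_pdivlMr.
Qed.

Lemma local_flow_C0 n (W : set 'rV[R]_n) (xi : 'rV[R]_n -> 'rV[R]_n) y0 :
  open W -> W y0 -> smooth_on W xi ->
  exists T r phi, is_local_flow W xi y0 0 T r phi.
Proof.
move=> oW Wy0 Cxi.
have [r0 [L [M [r00 L0 M0 rW xiL]]]] :=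
  local_lipschitz (framed_rV n) oW Wy0 (Cxi 1%N).
have [d1 d10 d1P] : exists2 d : R, 0 < d & forall T, 0 <= T <= d -> T * L <= 2^-1.
  by apply: small_time; rewrite invr_gt0.
have [d2 d20 d2P] : exists2 d : R, 0 < d & forall T, 0 <= T <= d -> T * M <= r0 / 2.
  by apply: small_time; rewrite divr_gt0.
pose T := Num.min d1 d2.
have T0 : 0 < T by rewrite /T lt_min d10.
have TL : T * L <= 2^-1 by apply: d1P; rewrite (ltW T0) /T ge_min lexx.
have TM : T * M <= r0 / 2 by apply: d2P; rewrite (ltW T0) /T ge_min lexx orbT.
have /choice[g gP] : forall y : 'rV[R]_n, exists g : R -> 'rV[R]_n,
    `|y - y0| <= r0 / 2 -> g 0 = y /\ forall t, `|t| < T ->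
      `|g t - y0| <= r0 /\ is_derive t (1 : R) g (xi (g t)).
  move=> y; have [yr|_] := leP `|y - y0| (r0 / 2); last by exists 0.
  have [|g ?] := @picard _ _ xi y0 r0 L M T (ltW r00) L0 T0 TL TM xiL _ y yr.
    by move=> a /rW[].
  by exists g.
have phi0 y : `|y - y0| < r0 / 2 -> g y 0 = y by move=> /ltW/gP[].
have phiP s y : flowbox y0 T (r0 / 2) (s, y) ->
    `|g y s - y0| <= r0 /\ is_derive s (1 : R) (g y) (xi (g y s)).
  by move=> [/= sT /ltW/gP[_]]; apply.
exists T, (r0 / 2), (fun p => g p.2 p.1); split=> //.
- by rewrite divr_gt0.
- by move=> s y /phiP[gr dg]; split=> //; have [] := rW _ gr.
- apply: (@flow_continuous _ _ xi y0 r0 L M) => //.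
  + by move=> a /rW[].
  + by move=> [s y] /phiP[].
  + by move=> s y /phiP[].
Qed.

Section Variational.
Variables (n : nat) (xi : 'rV[R]_n -> 'rV[R]_n).

(* The equation [y' = xi y] together with [A' = A *m jacobian xi y]; started at
   [A = 1], the matrix [A] is the derivative of the flow in its initial point. *)
Definition variational (z : 'rV[R]_(n + n * n)) : 'rV[R]_(n + n * n) :=
  row_mx (xi (lsubmx z)) (mxvec (vec_mx (rsubmx z) *m jacobian xi (lsubmx z))).

Lemma smooth_variational (W : set 'rV[R]_n) : open W -> smooth_on W xi ->
  open [set z : 'rV[R]_(n + n * n) | W (lsubmx z)] /\
  smooth_on [set z : 'rV[R]_(n + n * n) | W (lsubmx z)] variational.
Proof.
move=> oW Cxi; set W' := [set z | _].
have lin_l : linear (lsubmx : 'rV[R]_(n + n * n) -> 'rV[R]_n).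
  by move=> a u v; rewrite linearP.
have cont_l : continuous (lsubmx : 'rV[R]_(n + n * n) -> 'rV[R]_n).
  by apply: framed_continuous => //; exact: framed_rV.
have oW' : open W' by apply: open_comp => // z _; exact: cont_l.
split=> // k.
have Cl : Ck_on k W' lsubmx by exact: Ck_on_lincont.
have comp_l p q (f : 'rV[R]_n -> 'M[R]_(p, q)) : Ck_on k W f ->
    Ck_on k W' (fun z => f (lsubmx z)).
  by apply: (Ck_on_comp (framed_rV n) oW' oW) => //.
rewrite (_ : variational = fun z => row_mx (xi (lsubmx z)) 0 +
    row_mx 0 (mxvec (vec_mx (rsubmx z) *m jacobian xi (lsubmx z)))); last first.
  by apply/funext => z; rewrite add_row_mx addr0 add0r.
apply: Ck_onD => //.
  apply: (@Ck_on_linl _ _ _ _ _ _ (fun z => xi (lsubmx z)) (fun v : 'rV[R]_n =>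
    row_mx v (0 : 'rV[R]_(n * n)))) => //.
  - by move=> a u v; rewrite scale_row_mx scaler0 add_row_mx addr0.
  - apply: framed_continuous; first exact: framed_rV.
    by move=> a u v; rewrite scale_row_mx scaler0 add_row_mx addr0.
  - exact/comp_l/Cxi.
have lin_r : linear (fun A : 'M[R]_n => row_mx (0 : 'rV[R]_n) (mxvec A)).
  by move=> a u v; rewrite scale_row_mx scaler0 add_row_mx addr0 linearP.
apply: (@Ck_on_linl _ _ _ _ _ _ (fun z =>
  vec_mx (rsubmx z) *m jacobian xi (lsubmx z)) (fun A : 'M[R]_n =>
  row_mx (0 : 'rV[R]_n) (mxvec A))) => //.
  by apply: framed_continuous => //; exact: framed_mx.
apply/Ck_on_mxP => // i j.
rewrite (_ : (fun z => _) = fun z : 'rV[R]_(n + n * n) =>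
  \sum_l vec_mx (rsubmx z) i l * jacobian xi (lsubmx z) l j).
  apply: Ck_on_sum => // l; apply: Ck_onM => //.
    apply: Ck_on_linear; first exact: framed_rV.
    by move=> a u v; rewrite !linearP !mxE.
  have /comp_l/Ck_on_mxP : Ck_on k W (jacobian xi)
    by exact: Ck_on_jacobian (Cxi k.+1).
  exact.
by apply/funext => z; rewrite mxE.
Qed.

End Variational.

Lemma local_flow_shrink n W (xi : 'rV[R]_n -> 'rV[R]_n) y0 k T r phi T' r' :
  0 < T' <= T -> 0 < r' <= r ->
  is_local_flow W xi y0 k T r phi -> is_local_flow W xi y0 k T' r' phi.
Proof.
move=> /andP[T'0 T'T] /andP[r'0 r'r] [T0 r0 phi0 phiP Cphi].
have sub : flowbox y0 T' r' `<=` flowbox y0 T r.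
  by move=> p [p1 p2]; split; [exact: lt_le_trans T'T|exact: lt_le_trans r'r].
split=> // [y yr'|s y /sub/phiP//|].
- by apply: phi0; exact: lt_le_trans r'r.
- exact: Ck_on_sub sub Cphi.
Qed.

(** Induction on [k], in all dimensions at once because the variational field lives in dimension
    [n + n * n]. Its flow is of class C^k; the two blocks are the flow [phi] and its derivative
    [Lam] in the initial point, so the differential of [phi] is of class C^k. The variational field
    contains the jacobian of [xi] and so costs one order, which is harmless for a smooth field. *)
Theorem local_flow k n (W : set 'rV[R]_n) (xi : 'rV[R]_n -> 'rV[R]_n) y0 :
  open W -> W y0 -> smooth_on W xi ->
  exists T r phi, is_local_flow W xi y0 k T r phi.
Proof.
elim: k n W xi y0 => [|k IH] n W xi y0 oW Wy0 Cxi; first exact: local_flow_C0.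
have [oW' Cxi'] := smooth_variational oW Cxi.
pose one : 'rV[R]_(n * n) := mxvec 1%:M.
(* The variational flow is followed only from initial data with [A = 1]. *)
pose iota (p : R * 'rV[R]_n) : R * 'rV[R]_(n + n * n) := (p.1, row_mx p.2 one).
have [|T [r [Psi [T0 r0 Psi0 PsiP CPsi]]]] := IH _ _ _ (row_mx y0 one) oW' _ Cxi'.
  by rewrite /= row_mxKl.
have iotaD p : flowbox y0 T r p -> flowbox (row_mx y0 one) T r (iota p).
  move=> [p1 p2]; split=> //=; rewrite opp_row_mx add_row_mx subrr.
  apply: le_lt_trans p2; apply: rV_norm_le => // i.
  rewrite mxE; case: fintype.split => j; first exact: ler_coord_rV.
  by rewrite mxE normr0.
pose phi p := lsubmx (Psi (iota p));
  pose Lam p := vec_mx (rsubmx (Psi (iota p))) : 'M[R]_n.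
have fE := framed_prod (@framed_real R) (framed_rV (n + n * n)).
have Ciota : Ck_on k (flowbox y0 T r) iota.
  have fV := framed_prod (@framed_real R) (@framed_rV R n).
  apply: Ck_on_pair; [exact: open_flowbox|exact: Ck_on_linear|].
  rewrite (_ : (fun p => _) = fun p : R * 'rV[R]_n =>
    row_mx p.2 (0 : 'rV[R]_(n * n)) + row_mx (0 : 'rV[R]_n) one); last first.
    by apply/funext => p; rewrite add_row_mx addr0 add0r.
  apply: Ck_onD; [exact: open_flowbox| |exact: Ck_on_cst].
  apply: Ck_on_linear => // a u v.
  by rewrite scale_row_mx scaler0 add_row_mx addr0.
have CPi : Ck_on k (flowbox y0 T r) (Psi \o iota).
  exact: Ck_on_comp fE (@open_flowbox _ _ _ _ _)
    (@open_flowbox _ _ _ _ _) iotaD Ciota CPsi.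
have oD := @open_flowbox R _ y0 T r.
have linl : linear (lsubmx : 'rV[R]_(n + n * n) -> 'rV[R]_n) by move=> a u v;
  rewrite linearP.
have linr : linear (vec_mx \o rsubmx : 'rV[R]_(n + n * n) ->
  'M[R]_n) by move=> a u v /=; rewrite !linearP.
have contl := framed_continuous (framed_rV (n + n * n)) linl.
have contr := framed_continuous (framed_rV (n + n * n)) linr.
have Cphi : Ck_on k (flowbox y0 T r) phi by exact: Ck_on_linl oD linl contl CPi.
have CLam : Ck_on k (flowbox y0 T r) Lam by exact: Ck_on_linl oD linr contr CPi.
have phi0 y : `|y - y0| < r -> phi (0, y) = y.
  move=> yr; rewrite /phi /iota /= Psi0 ?row_mxKl//.
  by have [] := iotaD (0, y); rewrite /flowbox /= ?normr0.
have Lam0 y : `|y - y0| < r -> Lam (0, y) = 1%:M.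
  move=> yr; rewrite /Lam /iota /= Psi0 ?row_mxKr ?mxvecK//.
  by have [] := iotaD (0, y); rewrite /flowbox /= ?normr0.
have phiW s y : flowbox y0 T r (s, y) -> W (phi (s, y)).
  by move=> /iotaD/PsiP[].
have phi_ode s y : flowbox y0 T r (s, y) ->
    is_derive s (1 : R) (fun u => phi (u, y)) (xi (phi (s, y))).
  move=> /iotaD/PsiP[_ /(is_derive_lin linl contl)].
  by rewrite /variational row_mxKl.
have Lam_ode s y : flowbox y0 T r (s, y) ->
    is_derive s (1 : R) (fun u =>
      Lam (u, y)) (Lam (s, y) *m jacobian xi (phi (s, y))).
  move=> /iotaD/PsiP[_ /(is_derive_lin linr contr)].
  by rewrite /variational /= row_mxKr mxvecK.
have [r1 [L [M [r10 L0 M0 r1W xiL]]]] :=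
  local_lipschitz (framed_rV n) oW Wy0 (Cxi 1%N).
have [r2 [C [r20 C0 r2W xiC]]] := local_second_order oW Wy0 (Cxi 2%N).
have [r3 [L3 [B [r30 L30 B0 r3W _]]]] :=
  local_lipschitz (framed_rV n) oW Wy0 (Ck_on_jacobian oW (Cxi 2%N)).
(* The three estimates for [xi] hold on the ball of radius [rho]; the box is then shrunk until [phi]
   maps it into this ball. *)
pose rho := Num.min r1 (Num.min r2 r3).
have rho0 : 0 < rho by rewrite !lt_min r10 r20.
have [d1 d10 d1P] : exists2 d : R, 0 < d & forall T, 0 <= T <= d -> T * L <= 2^-1.
  by apply: small_time; rewrite invr_gt0.
have [d2 d20 d2P] : exists2 d : R, 0 < d & forall T, 0 <= T <= d ->
  T * (n%:R * B) <= 2^-1.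
  by apply: small_time; rewrite invr_gt0.
have D0 : flowbox y0 T r (0, y0) by split; rewrite /= ?normr0 ?subrr ?normr0.
have [d3 d30 d3P] : exists2 d : R, 0 < d &
  flowbox y0 d d `<=` [set p | `|phi p - y0| < rho].
  apply: near_flowbox.
  have := Ck_on_continuous Cphi D0;
    rewrite /prop_for /continuous_at phi0 ?subrr ?normr0// => cphi.
  by have := @near_ball _ _ y0 rho rho0 => /cphi.
pose T' := Num.min (Num.min T d1) (Num.min d2 d3); pose r' := Num.min r d3.
have T'0 : 0 < T' by rewrite !lt_min T0 d10 d20.
have r'0 : 0 < r' by rewrite lt_min r0.
have [T'1 T'2] : T' <= T /\ T' <= d1 by rewrite /T' !ge_min !lexx ?orbT.
have [T'3 T'4] : T' <= d2 /\ T' <= d3 by rewrite /T' !ge_min !lexx ?orbT.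
have [r'1 r'2] : r' <= r /\ r' <= d3 by rewrite /r' !ge_min !lexx ?orbT.
have sub : flowbox y0 T' r' `<=` flowbox y0 T r.
  by move=> p [p1 p2]; split; [exact: lt_le_trans T'1|exact: lt_le_trans r'1].
have sub3 : flowbox y0 T' r' `<=` flowbox y0 d3 d3.
  by move=> p [p1 p2]; split; [exact: lt_le_trans T'4|exact: lt_le_trans r'2].
have phi_ball p : flowbox y0 T' r' p ->
  `|phi p - y0| <= rho by move=> /sub3/d3P/ltW.
have [rho1 rho2 rho3] : [/\ rho <= r1, rho <= r2 & rho <= r3]
  by rewrite /rho !ge_min !lexx ?orbT.
have dphi p : flowbox y0 T' r' p ->
    is_diff p phi (fun h => h.1 *: xi (phi p) + h.2 *m Lam p).
  apply: (@flow_is_diff _ _ xi y0 rho L B C M) => //.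
  - by move=> a b /le_trans/(_ rho1) ar /le_trans/(_ rho1); exact: xiL.
  - by move=> a /le_trans/(_ rho1)/r1W[].
  - by apply: d1P; rewrite (ltW T'0).
  - by move=> y yr; apply: phi0; exact: lt_le_trans r'1.
  - by move=> s y /sub/phi_ode.
  - move=> a b /le_trans/(_ rho2) ar /le_trans/(_ rho2) br.
    by rewrite mulmx_jacobian; exact: xiC.
  - by move=> a /le_trans/(_ rho3)/r3W[].
  - by apply: d2P; rewrite (ltW T'0).
  - by move=> y yr; apply: Lam0; exact: lt_le_trans r'1.
  - by move=> s y /sub/Lam_ode.
exists T', r', phi; split=> //.
- by move=> y yr; apply: phi0; exact: lt_le_trans r'1.
- by move=> s y /sub sy; split; [exact: phiW | exact: phi_ode].
- apply: (Ck_onS (@open_flowbox _ _ _ _ _) dphi) => v.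
  have oD' := @open_flowbox R _ y0 T' r'.
  apply: Ck_onD => //.
    apply: Ck_on_scale => //; first exact: Ck_on_cst.
    apply: (Ck_on_comp (framed_rV n) oD' oW _ _ (Cxi k)).
      by move=> [s y] /sub/phiW.
    exact: Ck_on_sub sub Cphi.
  have lin_v : linear (mulmx v.2 : 'M[R]_n -> 'rV[R]_n) by move=> a A A';
    rewrite linearP.
  apply: (Ck_on_linl oD' lin_v (framed_continuous (framed_mx _ _) lin_v)).
  exact: Ck_on_sub sub CLam.
Qed.

End LocalFlow.

(** * Primitives depending on a parameter *)

Section ParametricPrimitive.
Context {R : realType} {V : normedModType R}.
Variable y0 : V.
Hypothesis fV : framed V.

(** Compactness of [[-S, S]] makes continuity in [y] uniform in [t]. *)
Lemma tube (G : R * V -> R) (T r S : R) (y : V) (e : R) :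
  (forall p, flowbox y0 T r p -> {for p, continuous G}) ->
  S < T -> `|y - y0| < r -> 0 < e ->
  \forall y' \near y, forall t, `|t| <= S ->
    `|y' - y0| < r /\ `|G (t, y') - G (t, y)| <= e.
Proof.
move=> cG ST yr e0; have cS : compact `[- S, S] by exact: segment_compact.
have := (compact_near_coveringP _).1 cS V (nbhs y) (fun y' t =>
  `|y' - y0| < r /\ `|G (t, y') - G (t, y)| <= e).
move=> cov; apply: filterS (cov _ _) => [y' Hy' t tS|].
  by apply: Hy'; rewrite /= in_itv /= -ler_norml.
move=> t /= /[!in_itv]/=; rewrite -ler_norml => tS.
have ty : flowbox y0 T r (t, y) by split=> //; exact: le_lt_trans ST.
have e20 : 0 < e / 2 by rewrite divr_gt0.
have /cvgrPdist_lt/(_ _ e20) Gty := cG _ ty.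
have [[A B] /= [At By] AB] := filterI (open_near (@open_flowbox _ _ _ _ _) ty) Gty.
exists (A, B) => //= -[t' y'] /= [At' By'].
have [[_ /= y'r] h1] := AB (t', y') (conj At' By').
have [_ h2] := AB (t', y) (conj At' (nbhs_singleton By)).
split=> //; have := ler_distD (G (t, y)) (G (t', y')) (G (t', y)).
rewrite /= in h1 h2; rewrite [`|G (t', y') - G (t, y)|]distrC; lra.
Qed.

Lemma real_mean_value_dist (f df : R -> R) (s t C : R) :
  (forall u, Num.min s t <= u <= Num.max s t -> is_derive u (1 : R) f (df u)) ->
  (forall u, Num.min s t <= u <= Num.max s t -> `|df u| <= C) ->
  `|f t - f s| <= C * `|t - s|.
Proof.
move=> dfP dfC; have [st|/ltW ts] := leP s t.
- move: dfP dfC; rewrite (min_idPl st) (max_idPr st) => dfP dfC.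
  by rewrite [`|t - s|]ger0_norm ?subr_ge0//; exact: real_mean_value dfP dfC.
- move: dfP dfC; rewrite (min_idPr ts) (max_idPl ts) => dfP dfC.
  rewrite distrC [`|t - s|]distrC [`|s - t|]ger0_norm ?subr_ge0//;
    exact: real_mean_value dfP dfC.
Qed.

Lemma is_derive_bigsum (m : nat) (h : 'I_m -> R -> R) (dh : 'I_m -> R) t :
  (forall i, is_derive t (1 : R) (h i) (dh i)) ->
  is_derive t (1 : R) (fun s => \sum_i h i s) (\sum_i dh i).
Proof.
move=> dhP; rewrite (_ : (fun s => _) = \sum_i h i); first exact: is_derive_sum.
by apply/funext => s; rewrite fct_sumE.
Qed.

(** Beyond the value at time 0, no dependence on [y] is prescribed: the regularity of [u] in [y] has
    to come from [g]. *)
Definition primitive_of (T r : R) (g u : R * V -> R) :=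
  (forall y, `|y - y0| < r -> u (0, y) = 0) /\
  (forall s y, flowbox y0 T r (s, y) ->
     is_derive s (1 : R) (fun t => u (t, y)) (g (s, y))).

Lemma primitive_C0 (T r : R) (g u : R * V -> R) :
  (forall p, flowbox y0 T r p -> {for p, continuous g}) ->
  primitive_of T r g u ->
  forall p, flowbox y0 T r p -> {for p, continuous u}.
Proof.
move=> cg [u0 du] [s y] sy; have [/= sT yr] := sy.
have T0 : 0 < T by exact: le_lt_trans sT.
pose S := (`|s| + T) / 2; have [sS ST] : `|s| < S /\ S < T by rewrite /S; split;
  lra.
apply/cvgrPdist_le => e e0.
have e2 : 0 < e / 2 by rewrite divr_gt0.
(* Over a time shorter than [T], a difference [e / 2 / T] between the derivatives contributes at
   most [e / 2]. *)
have e2T : 0 < e / 2 / T by rewrite divr_gt0.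
have tb := tube cg ST yr e2T.
have cu : {for s, continuous (fun t => u (t, y))}
  by exact: is_derive_continuous (du _ _ sy).
have /cvgrPdist_le/(_ _ e2) cu' := cu.
have sS' : \forall t \near s, `|t| < S.
  exact: (@cvgr_norm_lt _ _ _ _ _ id s (@cvg_id _ _)).
exists ([set t | `|u (s, y) - u (t, y)| <= e / 2 /\
  `|t| < S], [set y' | forall t, `|t| <= S ->
    `|y' - y0| < r /\ `|g (t, y') - g (t, y)| <= e / 2 / T]) => /=.
  by split=> //; exact: filterI.
move=> [t y'] /= [[h1 tS] gyy'].
have tT : `|t| < T by exact: lt_trans ST.
have [y'r _] := gyy' t (ltW tS).
have : `|u (t, y') - u (t, y)| <= e / 2.
  have := @real_mean_value_dist (fun t => u (t, y') - u (t, y))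
    (fun t => g (t, y') - g (t, y)) 0 t (e / 2 / T).
  rewrite !u0// !subr0 => /(_ _ _)/le_trans; apply.
  - by move=> v vt; apply: is_deriveB; apply: du; split=> //; exact: minmax_norm vt.
  - by move=> v /minmax_norm_le vt; have [] := gyy' v (le_trans vt (ltW tS)).
  - rewrite -[leRHS](divfK (lt0r_neq0 T0)) ler_wpM2l// ltW//.
rewrite distrC => h2.
have := ler_distD (u (t, y)) (u (s, y)) (u (t, y')); lra.
Qed.

Lemma framed_coord_bound : exists (m : nat) (e : 'I_m -> V) (l : 'I_m -> V -> R)
  (K : R), [/\ 0 <= K, forall i, linear (l i), forall i, continuous (l i),
    forall v, v = \sum_i l i v *: e i & forall i v, `|l i v| <= K * `|v|].
Proof.
have [m [e [l [lin_l cont_l el]]]] := fV; exists m, e, l.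
have /choice[k kP] : forall i, exists k, 0 < k /\ forall v, `|l i v| <= k * `|v|.
  by move=> i; have [k k0 kP] := lincont_bound (lin_l i) (cont_l i); exists k.
have k0 i : 0 <= k i by have [/ltW] := kP i.
exists (\sum_i k i); split=> //; first by apply: sumr_ge0.
move=> i v; have [_ /(_ v)/le_trans] := kP i; apply.
by rewrite ler_wpM2r// (bigD1 i) //= lerDl sumr_ge0.
Qed.

(** Differentiation under the integral sign: the derivative of [u] in the direction [e i] of the
    frame is the primitive [w i] of the corresponding derivative of [g], of class C^k by induction.
    Uniformity in time needs a compact interval, so some time is lost; the intermediate [S] leaves
    room for the induction hypothesis. *)
Lemma primitive_Ck k (T r T' : R) (g u : R * V -> R) : T' < T ->
  Ck_on k (flowbox y0 T r) g -> primitive_of T r g u ->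
  Ck_on k (flowbox y0 T' r) u.
Proof.
elim: k T T' g u => [|k IH] T T' g u T'T Cg ugP.
  move=> p [p1 p2]; apply: (primitive_C0 Cg ugP); split=> //.
  exact: lt_trans T'T.
(* In this case the box is empty. *)
have [T'0|T'0] := leP T' 0.
  apply: Ck_on_local => -[s y] [/= sT' _]; have := normr_ge0 s; lra.
have [m [e [l [K [K0 lin_l cont_l el lK]]]]] := framed_coord_bound.
have [u0 du] := ugP.
pose S := (T' + T) / 2; have [T'S ST] : T' < S /\ S < T by rewrite /S; split; lra.
have S0 : 0 <= S by lra.
pose G i p := 'd g p (0, e i) : R.
have CG i : Ck_on k (flowbox y0 T r) (G i) by exact: Ck_on_diff Cg.
have cG i p : flowbox y0 T r p -> {for p, continuous (G i)}.
  by move=> pD; exact: Ck_on_continuous (CG i) pD.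
have /choice[w wP] : forall i, exists w : R * V -> R, primitive_of S r (G i) w.
  move=> i; have /choice[w wP] : forall y, exists w : R -> R, `|y - y0| < r ->
      w 0 = 0 /\ forall s, `|s| < S -> is_derive s (1 : R) w (G i (s, y)).
    move=> y; have [yr|_] := ltP `|y - y0| r; last by exists 0.
    have [|w w0 wP] := @antiderivative_real R (fun s => G i (clip S s, y)) S _ S0.
      move=> s; apply: (@continuous_comp _ _ _ (fun s => (clip S s, y)) (G i)).
        have cc : continuous (clip S).
          by apply: (@lip_continuous _ _ _ _ 1) => a b; rewrite mul1r;
            exact: clip_lip.
        exact: (cvg_pair (cc s) (cvg_cst y)).
      by apply: cG; split=> //=; apply: le_lt_trans ST; exact: clip_le.
    by exists w => _; split=> // s /ltW sS; have := wP s sS; rewrite clip_id.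
  exists (fun p => w p.2 p.1); split=> [y /wP[]//|s y [/= sS /wP[_]]]; exact.
(* The candidate differential: [g] in the time direction, the primitives [w i] in the directions of
   the frame. *)
pose du' (p h : R * V) := h.1 *: g p + \sum_i l i h.2 *: w i p.
have lin_du p : linear (du' p).
  move=> a [u1 u2] [v1 v2]; rewrite /du' /= scalerDl scalerDr -scalerA addrACA;
    congr (_ + _).
  rewrite scaler_sumr -big_split /=; apply: eq_bigr => i _.
  by rewrite lin_l scalerDl scalerA.
have fRV := framed_prod (@framed_real R) fV.
have T'Sb : flowbox y0 T' r `<=` flowbox y0 S r.
  by move=> p [p1 p2]; split=> //; exact: lt_trans T'S.
have STb : flowbox y0 S r `<=` flowbox y0 T r.
  by move=> p [p1 p2]; split=> //; exact: lt_trans ST.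
have dg p h : flowbox y0 T r p -> 'd g p (0, h) = \sum_i l i h *: G i p.
  move=> pD; rewrite [in LHS](el h).
  have -> : (0, \sum_i l i h *: e i) = \sum_i l i h *: ((0, e i) : R * V).
    have lin0 : linear (fun v : V => (0, v) : R * V).
      by move=> a u1 u2; congr pair; rewrite /= scaler0 addr0.
    pose lM := GRing.isLinear.Build _ _ _ _ _ lin0.
    pose L : {linear V -> (R * V)%type} := HB.pack (fun v : V => (0 : R, v)) lM.
    rewrite -[LHS]/(L _) linear_sum; apply: eq_bigr => i _.
    by rewrite linearZ.
  by rewrite linear_sum; apply: eq_bigr => i _; rewrite linearZ.
have is_du p : flowbox y0 T' r p -> is_diff p u (du' p).
  case: p => s y sy; have [/= sT' yr] := sy.
  apply: is_diff_epsP => [||e1 e10]; first exact: lin_du.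
    exact: framed_continuous.
  (* The time step costs [ep * N]; the step in [y], accumulated over a time at most [S] and over [m]
     frame directions, costs [S * (m%:R * K * N * ep)]. Together they give [e1 * N]. *)
  pose D := 1 + S * (m%:R * K); have D0 : 0 < D.
    apply: ltr_pwDl => //. by rewrite mulr_ge0// mulr_ge0.
  pose ep := e1 / D; have ep0 : 0 < ep by rewrite divr_gt0.
  have tb : \forall y' \near y, `|y' - y0| < r /\ forall i t, `|t| <= S ->
      `|G i (t, y') - G i (t, y)| <= ep.
    apply: filterI; first exact: (open_near (@open_dist_lt _ _ y0 r)).
    apply: filter_forall => i; apply: filterS (tube (cG i) ST yr ep0) => y' H t tS.
    by have [] := H t tS.
  have [d d0 dP] := near_closed_ball tb.
  have syT := STb _ (T'Sb _ sy).
  have /cvgrPdist_le/(_ _ ep0) cgs := Ck_on_continuous Cg syT.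
  have [d' d'0 d'P] := near_closed_ball (filterI cgs (open_near
    (@open_flowbox _ _ _ _ _) syT)).
  have dd : 0 < Num.min d d' by rewrite lt_min d0.
  have := @near_ball _ _ (0 : R * V) _ dd; apply: filterS => -[sg v].
  rewrite subr0 lt_min => /andP[/ltW hd /ltW hd'].
  have h1 := prod_norm_fst (sg, v); have h2 := prod_norm_snd (sg, v).
  set N := `|(sg, v)| in h1 h2 hd hd' *; rewrite /= in h1 h2.
  have N0 : 0 <= N by exact: normr_ge0.
  have yv : `|v + y - y| <= d by rewrite addrK; exact: le_trans hd.
  have box t : Num.min s (sg + s) <= t <= Num.max s (sg + s) ->
      `|g (s, y) - g (t, v + y)| <= ep /\ flowbox y0 T r (t, v + y).
    move=> st; suff : `|(t, v + y) - (s, y)| <= d' by move=> /d'P[].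
    apply: le_trans hd'.
    rewrite prod_normE /= addrK ge_max h2 andbT (le_trans _ h1)//.
    by have := minmax_dist st; rewrite addrK.
  have time : `|u (sg + s, v + y) - u (s, v + y) - sg * g (s, y)| <= ep * N.
    have := @real_mean_value_dist (fun t => u (t, v + y) - t *: g (s, y))
      (fun t => g (t, v + y) - g (s, y)) s (sg + s) ep.
    have -> : u (sg + s, v + y) - (sg + s) *: g (s, y) -
        (u (s, v + y) - s *: g (s, y)) =
        u (sg + s, v + y) - u (s, v + y) - sg * g (s, y).
      by rewrite !/(_ *: _) /=; ring.
    rewrite addrK => /(_ _ _)/le_trans; apply; last by rewrite ler_wpM2l// ltW.
    - move=> t /box[_ tb']; apply: is_deriveB; first exact: du.
      exact: is_derive_scalel.
    - by move=> t /box[]; rewrite distrC.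
  have dgb t : `|t| <= S -> `|g (t, v + y) - g (t, y) - 'd g (t, y) (0,
    v)| <= m%:R * K * N * ep.
    move=> tS; have tT : `|t| < T by exact: le_lt_trans ST.
    have := @real_mean_value R (fun th =>
      g ((t, y) + th *: (0, v)) - th *: 'd g (t, y) (0, v))
      (fun th => 'd g ((t, y) + th *: (0, v)) (0, v) - 'd g (t, y) (0,
        v)) 0 1 (m%:R * K * N * ep) ler01.
    rewrite !scale0r !scale1r addr0 !subr0 mulr1 addrAC.
    have -> : (t, y) + (0, v) = (t, v + y) :> R * V by congr pair;
      rewrite ?addr0//= addrC.
    have seg th : (t, y) + th *: (0, v) = (t, y + th *: v) :> R * V.
      by congr pair; rewrite /= scaler0 addr0.
    have segb th : 0 <= th <= 1 -> `|y + th *: v - y| <= d.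
      move=> /andP[th0 th1]; rewrite addrC addKr normrZ ger0_norm//.
      by apply: le_trans hd; apply: le_trans h2; rewrite ler_piMl.
    have segD th : 0 <= th <= 1 -> flowbox y0 T r (t, y + th *: v).
      by move=> /segb/dP[].
    apply.
    - move=> th th01; apply: is_deriveB; last first.
        exact: is_derive_scalel.
      apply: (is_derive_comp (g := fun th => (t, y) + th *: (0, v))).
        exact: is_derive_segment.
      by apply: Ck_on_is_diff Cg _; rewrite seg; exact: segD.
    - move=> th th01; rewrite seg !dg//; last exact: segD.
      rewrite -sumrB; apply: le_trans (ler_norm_sum _ _ _) _.
      rewrite [leRHS](_ : _ = \sum_(i < m) K * N * ep); last first.
        by rewrite sumr_const card_ord -!mulrA mulr_natl.
      apply: ler_sum => i _; rewrite -scalerBr normrM; apply: ler_pM => //.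
        by apply: le_trans (lK i v) _; rewrite ler_wpM2l.
      by have [_] := dP _ (segb _ th01); apply.
  have sS : `|s| < S by exact: lt_trans T'S.
  have space : `|u (s, v + y) - u (s, y) - \sum_i l i v *: w i (s, y)| <=
      S * (m%:R * K * N * ep).
    pose E t := u (t, v + y) - u (t, y) - \sum_i l i v *: w i (t, y).
    have yvr : `|v + y - y0| < r by have [] := dP _ yv.
    have E0 : E 0 = 0.
      rewrite /E !u0// subrr sub0r big1 ?oppr0// => i _.
      by have [-> //] := wP i; rewrite scaler0.
    have := @real_mean_value_dist E (fun t =>
      g (t, v + y) - g (t, y) - 'd g (t, y) (0, v)) 0 s (m%:R * K * N * ep).
    rewrite E0 !subr0 => /(_ _ _)/le_trans; apply.
    - move=> t /minmax_norm_le ts; have tS := le_lt_trans ts sS;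
      have tT := lt_trans tS ST.
      apply: is_deriveB; first by apply: is_deriveB; exact: du.
      rewrite dg//; apply: is_derive_bigsum => i.
      by apply: is_deriveZ; have [_] := wP i; apply.
    - by move=> t /minmax_norm_le ts; apply: dgb; exact: le_trans (ltW sS).
    - by rewrite mulrC ler_wpM2r ?(ltW sS)// mulr_ge0 ?(ltW ep0)// mulr_ge0//
      mulr_ge0.
  have -> : u ((sg, v) + (s, y)) - u (s, y) - du' (s, y) (sg, v) =
      (u (sg + s, v + y) - u (s, v + y) - sg * g (s, y)) +
      (u (s, v + y) - u (s, y) - \sum_i l i v *: w i (s, y)).
    by rewrite [RHS]addrACA subrKA -opprD.
  apply: le_trans (ler_normD _ _) _; apply: le_trans (lerD time space) _.
  rewrite le_eqVlt; apply/orP; left; apply/eqP.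
  rewrite -[e1](divfK (lt0r_neq0 D0)) -/ep /D; ring.
apply: (Ck_onS (@open_flowbox _ _ _ _ _) is_du) => v.
have oD := @open_flowbox R _ y0 T' r.
apply: Ck_onD => //.
  apply: Ck_on_scale => //; first exact: Ck_on_cst.
  by apply: Ck_on_sub (Ck_onW Cg) => p /T'Sb/STb.
apply: Ck_on_sum => // i; apply: Ck_on_scale => //; first exact: Ck_on_cst.
apply: (IH S _ (G i)) => //; exact: Ck_on_sub STb (CG i).
Qed.

End ParametricPrimitive.

(** * Inverse function theorem *)

Section MatrixCk.
Context {R : realType} {V : normedModType R}.
Variables (k : nat) (U : set V).
Hypothesis oU : open U.

Lemma Ck_on_mulmx m p q (A : V -> 'M[R]_(m, p)) (B : V -> 'M[R]_(p, q)) :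
  Ck_on k U A -> Ck_on k U B -> Ck_on k U (fun x => A x *m B x).
Proof.
move=> /Ck_on_mxP CA /Ck_on_mxP CB; apply/Ck_on_mxP => // i j.
rewrite (_ : (fun x => _) = fun x => \sum_l A x i l * B x l j).
  apply: Ck_on_sum => // l; apply: Ck_onM => //; [exact: CA | exact: CB].
by apply/funext => x; rewrite mxE.
Qed.

Lemma Ck_on_det n (A : V -> 'M[R]_n) : Ck_on k U A ->
  Ck_on k U (fun x => \det (A x)).
Proof.
move=> /Ck_on_mxP CA; apply: Ck_on_sum => // s.
apply: Ck_onM => //; first exact: Ck_on_cst.
by apply: Ck_on_prod => // i; exact: CA.
Qed.

Lemma Ck_on_invmx n (A : V -> 'M[R]_n) : Ck_on k U A ->
  (forall x, U x -> A x \in unitmx) -> Ck_on k U (fun x => invmx (A x)).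
Proof.
move=> CA uA; have CA' := (Ck_on_mxP _ _ oU).1 CA.
apply: (@Ck_on_ext _ _ _ _ _ (fun x => (\det (A x))^-1 *: \adj (A x))) => //.
  by move=> x Ux; rewrite /invmx uA.
apply: Ck_on_scale => //.
  apply: Ck_onV => //; last exact: Ck_on_det.
  by move=> x /uA; rewrite unitmxE unitfE.
apply/Ck_on_mxP => // i j.
rewrite (_ : (fun x => _) = fun x =>
  (-1) ^+ (j + i) * \det (row' j (col' i (A x)))).
  apply: Ck_onM => //; first exact: Ck_on_cst.
  apply: Ck_on_det; apply/Ck_on_mxP => // l l'.
  rewrite (_ : (fun x => _) = fun x => A x (lift j l) (lift i l'));
    first exact: CA'.
  by apply/funext => x; rewrite !mxE.
by apply/funext => x; rewrite !mxE.
Qed.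

End MatrixCk.

Section InverseFunction.
Context {R : realType} {n : nat}.
Local Notation E := 'rV[R]_n.

(** Newton iteration with the derivative frozen at [t0]: the map [g t = t - Phi t *m A] has zero
    jacobian at [t0], so it halves distances on a small ball, and [Psi y] is the fixed point of
    [t |-> g t + y *m A]. The order, at least 2, supplies a Lipschitz jacobian and a quadratic
    remainder. *)
Theorem inverse_function k (U : set E) (Phi : E -> E) (t0 : E) :
  open U -> U t0 -> Ck_on k.+2 U Phi -> jacobian Phi t0 \in unitmx ->
  exists (d : R) (Psi : E -> E), [/\ 0 < d,
    forall y, `|y - Phi t0| < d -> U (Psi y) /\ Phi (Psi y) = y &
    Ck_on k.+2 [set y | `|y - Phi t0| < d] Psi].
Proof.
move=> oU Ut0 CPhi uJ0; pose A := invmx (jacobian Phi t0).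
have CJ : Ck_on k.+1 U (jacobian Phi) by exact: Ck_on_jacobian.
pose U' := [set t | U t /\ \det (jacobian Phi t) != 0].
have oU' : open U'.
  rewrite openE => t [Ut Jt].
  have cdet := Ck_on_continuous (Ck_on_det oU CJ) Ut.
  exact: filterI (open_near oU Ut) (cvgr_neq0 _ cdet Jt).
have U't0 : U' t0 by split=> //; rewrite -unitfE -unitmxE.
have U'U : U' `<=` U by move=> t [].
have uJ t : U' t -> jacobian Phi t \in unitmx by move=> [_]; rewrite unitmxE unitfE.
have [g gE] : exists g : E -> E, forall t, g t = t - Phi t *m A by eexists.
have linA : linear (mulmxr A : E -> E) by move=> a u v; rewrite linearP.
have contA := framed_continuous (framed_rV n) linA.
have Cg : Ck_on k.+2 U' g.
  have CPhiA : Ck_on k.+2 U' (mulmxr A \o Phi).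
    exact: Ck_on_linl oU' linA contA (Ck_on_sub U'U CPhi).
  have Cid : Ck_on k.+2 U' (id : E -> E) by apply: Ck_on_linear => //;
    exact: framed_rV.
  by apply: (Ck_on_ext oU' _ (Ck_onB oU' Cid CPhiA)) => t _; rewrite gE.
have dg t v : U' t -> 'd g t v = v - 'd Phi t v *m A.
  move=> U't; have dP := Ck_on_is_diff CPhi (U'U _ U't).
  have dA := is_diff_comp dP (is_diff_lincont _ linA contA).
  have dgt : is_diff t g (id - (mulmxr A \o 'd Phi t)).
    rewrite (_ : g = id - (mulmxr A \o Phi));
      first exact: is_diffB (is_diff_id t) dA.
    by apply/funext => u; rewrite gE.
  by have := is_diffE v dgt; rewrite fctE; exact.
have Jg0 : jacobian g t0 = 0.
  apply/row_matrixP => i; rewrite !rowE (mulmx_jacobian g) dg//.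
  by rewrite -(mulmx_jacobian Phi) mulmxK// subrr mulmx0.
have Cg2 : Ck_on 2 U' g by exact: Ck_on_le Cg.
have [r1 [L [M [r10 L0 M0 r1U JL]]]] :=
  local_lipschitz (framed_rV n) oU' U't0 (Ck_on_jacobian oU' Cg2).
have CPhi2 : Ck_on 2 U' Phi by exact: Ck_on_le (Ck_on_sub U'U CPhi).
have [r2 [C [r20 C0 r2U PhiC]]] := local_second_order oU' U't0 CPhi2.
have [d1 d10 d1P] : exists2 d : R, 0 < d & forall T, 0 <= T <= d ->
  T * (n%:R * L) <= 2^-1.
  by apply: small_time; rewrite invr_gt0.
pose r := Num.min (Num.min r1 r2) d1.
have r0 : 0 < r by rewrite !lt_min r10 r20.
have [rr1 rr2 rd1] : [/\ r <= r1, r <= r2 & r <= d1]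
  by rewrite /r !ge_min !lexx ?orbT.
have g_lip a b : `|a - t0| <= r -> `|b - t0| <= r -> `|g a - g b| <= `|a - b| / 2.
  move=> ar br; have seg s : 0 <= s <= 1 -> `|b + s *: (a - b) - t0| <= r.
    by move=> s01; exact: segment_dist.
  have := @mean_value _ _ _ (fun s => g (b + s *: (a - b)))
    (fun s => 'd g (b + s *: (a - b)) (a - b)) 0 1 (`|a - b| / 2) ler01.
  rewrite scale0r addr0 scale1r [b + _]addrC subrK subr0 mulr1; apply.
    move=> s /seg/le_trans/(_ rr1)/r1U[Us _].
    apply: (is_derive_comp (g := fun s => b + s *: (a - b))).
      exact: is_derive_segment.
    exact: Ck_on_is_diff Cg Us.
  move=> s /seg sr; rewrite -(mulmx_jacobian g).
  apply: le_trans (norm_mulmx_le _ _) _.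
  have := JL _ t0 (le_trans sr rr1);
    rewrite subrr normr0 Jg0 subr0 => /(_ (ltW r10)) J1.
  have : L * `|b + s *: (a - b) - t0| <= L * r by rewrite ler_wpM2l.
  move=> /(le_trans J1) J2.
  rewrite mulrCA ler_wpM2l//; apply: (@le_trans _ _ (n%:R * (L * r))).
    by rewrite ler_wpM2l.
  by rewrite mulrA mulrC d1P// (ltW r0).
pose KA : R := n%:R * `|A|.
have KA0 : 0 <= KA by rewrite mulr_ge0.
have AK (v : E) : `|v *m A| <= KA * `|v|.
  by apply: le_trans (norm_mulmx_le _ _) _; rewrite [`|v| * _]mulrC mulrA.
have [d d0 dP] : exists2 d : R, 0 < d & forall T, 0 <= T <= d -> T * KA <= r / 2.
  by apply: small_time; rewrite divr_gt0.
have /choice[Psi PsiP] : forall y : E, exists t : E, `|y - Phi t0| < d ->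
    `|t - t0| <= r /\ Phi t = y.
  move=> y; have [yd|_] := ltP `|y - Phi t0| d; last by exists 0.
  pose N t := g t + y *m A.
  have Nt0 : `|N t0 - t0| <= r / 2.
    rewrite /N gE addrAC [t0 - _ - t0]addrAC subrr add0r addrC -mulmxBl.
    by apply: le_trans (AK _) _; rewrite mulrC dP// normr_ge0 ltW.
  have Nball t : `|t - t0| <= r -> `|N t - t0| <= r.
    move=> tr; have := ler_distD (N t0) (N t) t0.
    have : `|N t - N t0| <= `|t - t0| / 2.
      by rewrite /N opprD addrACA subrr addr0 g_lip// subrr normr0 ltW.
    lra.
  have Nlip a b : `|a - t0| <= r -> `|b - t0| <= r -> `|N a - N b| <= `|a - b| / 2.
    by move=> ar br; rewrite /N opprD addrACA subrr addr0; exact: g_lip.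
  pose u k := iter k N t0.
  have ub k' : `|u k' - t0| <= r.
    by elim: k' => [|k' IH]; [rewrite subrr normr0 ltW | exact: Nball].
  have uC k' : `|u k'.+1 - u k'| <= r / 2 ^+ k'.
    elim: k' => [|k' IH]; first by rewrite divr1; apply: le_trans Nt0 _; lra.
    apply: le_trans (Nlip _ _ (ub k'.+1) (ub k')) _.
    by rewrite exprSr invfM mulrA ler_wpM2r// invr_ge0.
  have [l lP] := geometric_limit (ltW r0) uC.
  have lball : `|l - t0| <= r.
    rewrite -subr_le0; apply: (@geometric_le0 _ _ (2 * r)) => k'.
    by have := ler_distD (u k') l t0; have := lP k'; have := ub k'; lra.
  have Nl : N l = l.
    apply/eqP; rewrite -subr_eq0 -normr_le0.
    apply: (@geometric_le0 _ _ (2 * r)) => k'.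
    have := ler_distD (u k'.+1) (N l) l; have := lP k'; have := lP k'.+1.
    have := Nlip _ _ lball (ub k'); rewrite -[N (u k')]/(u k'.+1).
    rewrite [`|u _ - l|]distrC exprS invfM [2^-1 * _]mulrC mulrA.
    have : 0 <= 2 * r / 2 ^+ k' by rewrite !mulr_ge0 ?invr_ge0 ?exprn_ge0// ltW.
    lra.
  exists l => _; split=> //.
  have : (y - Phi l) *m A = 0.
    by move/(congr1 (fun v => v - l)): Nl;
      rewrite /N gE subrr addrAC [l - _]addrC addrK addrC -mulmxBl.
  move=> /(congr1 (mulmxr (jacobian Phi t0))) /=; rewrite mulmxKV// mul0mx.
  by move/eqP; rewrite subr_eq0 => /eqP.
have PsiU y : `|y - Phi t0| < d -> U' (Psi y).
  by move=> /PsiP[/le_trans/(_ rr1)/r1U[]].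
(* The difference of the two values of [Psi] is [(y - z) *m A] plus a difference of values of [g];
   the latter is at most half the left-hand side and is absorbed. *)
have Psi_lip y z : `|y - Phi t0| < d -> `|z - Phi t0| < d ->
    `|Psi y - Psi z| <= 2 * KA * `|y - z|.
  move=> /PsiP[yr Py] /PsiP[zr Pz]; have := g_lip _ _ yr zr.
  have := AK (y - z); have := ler_distD (g (Psi y) - g (Psi z)) (Psi y - Psi z) 0.
  rewrite !subr0 !gE Py Pz.
  have -> : Psi y - Psi z - (Psi y - y *m A - (Psi z - z *m A)) = (y - z) *m A.
    rewrite [X in _ - (_ + X)]opprB [z *m A - _]addrC addrACA opprD addrA subrr
      add0r.
    by rewrite opprD opprK mulmxBl.
  lra.
have dPsi y : `|y - Phi t0| < d ->
    is_diff y Psi (fun w => w *m invmx (jacobian Phi (Psi y))).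
  move=> yd; have linI : linear (fun w : E => w *m invmx (jacobian Phi (Psi y))).
    by move=> a u v; rewrite mulmxDl -scalemxAl.
  pose KI := n%:R * `|invmx (jacobian Phi (Psi y))|.
  have contI := framed_continuous (framed_rV n) linI.
  (* The Taylor remainder of [Phi] at [Psi y], for an increment of size at most [2 * KA * |w|],
     multiplied by the inverse jacobian. *)
  apply: (is_diff_quad (K := KI * (C * (2 * KA) ^+ 2)) linI contI).
  have := open_near (@open_dist_lt _ _ (Phi t0) d) yd => /near0_shift.
  apply: filterS => w /= wd.
  have [yr Py] := PsiP _ yd; have [wr Pw] := PsiP _ wd.
  have := PhiC _ _ (le_trans yr rr2) (le_trans wr rr2).
  rewrite Py Pw addrK -(mulmx_jacobian Phi) => rho.
  have -> : Psi (w + y) - Psi y - w *m invmx (jacobian Phi (Psi y)) =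
      - ((w - (Psi (w + y) - Psi y) *m jacobian Phi (Psi y)) *m
      invmx (jacobian Phi (Psi y))).
    by rewrite mulmxBl mulmxK; [rewrite opprB | exact: uJ (PsiU _ yd)].
  rewrite normrN; apply: le_trans (norm_mulmx_le _ _) _.
  rewrite [`|w - _| * _]mulrC [leLHS]mulrA -[leRHS]mulrA.
  apply: ler_wpM2l; first by rewrite mulr_ge0.
  apply: le_trans rho _; rewrite -mulrA ler_wpM2l// -exprMn lerXn2r ?nnegrE
    ?mulr_ge0//.
  by have := Psi_lip _ _ wd yd; rewrite addrK.
exists d, Psi; split; [exact: d0 | move=> y yd | ].
  by split; [exact: U'U (PsiU y yd) | have [] := PsiP y yd].
have oB := @open_dist_lt _ _ (Phi t0) d.
(* Bootstrap: the differential of [Psi] is the inverse jacobian of [Phi] evaluated at [Psi], so each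
   order of [Psi] yields the next, up to the order of [Phi]. *)
suff CPsi_all : forall j, (j <= k.+2)%N -> Ck_on j [set y | `|y - Phi t0| < d] Psi.
  exact: CPsi_all k.+2 (leqnn _).
elim=> [_ y /dPsi[/differentiable_continuous]//|j IH jk].
  apply: (Ck_onS oB dPsi) => w.
  have CI : Ck_on j U' (fun t => invmx (jacobian Phi t)).
    apply: Ck_on_invmx => //; apply: Ck_on_le (Ck_on_sub U'U CJ).
    by rewrite -ltnS.
  have CPsi := IH (ltnW jk).
  have CIP : Ck_on j [set y | `|y - Phi t0| < d]
      (fun y => invmx (jacobian Phi (Psi y))).
    exact: (@Ck_on_comp _ _ _ _ _ _ _ _ (fun t => invmx (jacobian Phi t))
      (framed_rV n) oB oU' PsiU CPsi CI).
  have Cw : Ck_on j [set y : E | `|y - Phi t0| < d] (fun _ : E => w).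
    exact: (Ck_on_cst j [set y : E | `|y - Phi t0| < d] w).
  exact: (@Ck_on_mulmx _ _ _ _ oB _ _ _ (fun=> w) _ Cw CIP).
Qed.

End InverseFunction.

(** * Brackets of fields tangent to an immersion *)

Section Schwarz.
Context {R : realType} {V : normedModType R} {p q : nat}.
Variables (U : set V) (f : V -> 'M[R]_(p, q)) (x : V).
Hypothesis oU : open U.
Hypothesis Ux : U x.
Hypothesis df : forall y, U y -> differentiable f y.

(** The mean value inequality along [a] for the difference of [f] on two parallel segments, less its
    expected linear part. Since [g] is differentiable at [x], its values on both segments are
    expanded from that one point. *)
Lemma second_difference (a b : V) (e : R) : 0 < e ->
  differentiable (fun y => 'd f y a) x ->
  exists2 d : R, 0 < d & forall h : R, 0 < h <= d ->
    `|f (x + h *: a + h *: b) - f (x + h *: a) - (f (x + h *: b) - f x) -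
      (h * h) *: 'd (fun y => 'd f y a) x b| <= e * (h * h).
Proof.
(* One expansion has an increment of size at most [h * (|a| + |b|)], the other at most [h * |a|];
   the final 1 makes [c] positive. *)
move=> e0 dg; pose c := 2 * `|a| + `|b| + 1.
have c0 : 0 < c by rewrite ltr_wpDl// addr_ge0// mulr_ge0.
have ec : 0 < e / c by rewrite divr_gt0.
have := differentiable_eps dg ec; set g := fun y => 'd f y a => near_g.
have near_U : \forall h \near (0 : V), U (h + x)
  by have /near0_shift := open_near oU Ux.
have [d d0 dP] := near_closed_ball (filterI near_g near_U).
exists (d / c); first by rewrite divr_gt0.
move=> h /andP[h0 hd].
have hc : h * c <= d by rewrite -ler_pdivlMr.
have w1 th : 0 <= th <= h -> `|th *: a| <= h * `|a|.
  by move=> /andP[t0 th']; rewrite normrZ ger0_norm// ler_wpM2r.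
have w2 th : 0 <= th <= h -> `|th *: a + h *: b| <= h * (`|a| + `|b|).
  move=> /w1 ta; apply: le_trans (ler_normD _ _) _.
  by rewrite [`|h *: b|]normrZ gtr0_norm// mulrDr lerD2r.
have ha : h * `|a| <= h * c by rewrite ler_wpM2l ?(ltW h0)// /c;
  have := normr_ge0 a; have := normr_ge0 b; lra.
have hab : h * (`|a| + `|b|) <= h * c by rewrite ler_wpM2l ?(ltW h0)// /c;
  have := normr_ge0 a; lra.
have P1 th : 0 <= th <= h -> `|g (th *: a + x) - g x - 'd g x (th *: a)| <=
  e / c * (h * `|a|) /\ U (th *: a + x).
  move=> t0h; have [|P1 ?] := dP (th *: a).
    by rewrite subr0; apply: le_trans (w1 _ t0h) _; exact: le_trans ha hc.
  split=> //; apply: le_trans P1 _; rewrite ler_wpM2l ?(ltW ec)//; exact: w1.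
have P2 th : 0 <= th <= h -> `|g (th *: a + h *: b + x) - g x - 'd g x
  (th *: a + h *: b)| <= e / c * (h * (`|a| + `|b|)) /\ U (th *: a + h *: b + x).
  move=> t0h; have [|P1' ?] := dP (th *: a + h *: b).
    by rewrite subr0; apply: le_trans (w2 _ t0h) _; exact: le_trans hab hc.
  split=> //; apply: le_trans P1' _; rewrite ler_wpM2l ?(ltW ec)//; exact: w2.
pose F th := f ((x + h *: b) + th *: a) - f (x + th *: a) - th *: (h *: 'd g x b).
pose dF th := g ((x + h *: b) + th *: a) - g (x + th *: a) - h *: 'd g x b.
have dFP th : 0 <= th <= h -> is_derive th (1 : R) F (dF th).
  move=> t0h; apply: is_deriveB; last first.
    exact: is_derive_scalel.
  have Ub : U ((x + h *: b) + th *: a).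
    by have [_] := P2 th t0h; rewrite [_ + th *: a]addrC [x + _]addrC addrA.
  have Ua : U (x + th *: a) by have [_] := P1 th t0h; rewrite addrC.
  apply: is_deriveB.
    exact: is_derive_comp (is_derive_segment _ _ _) (differentiableP (df Ub)).
  exact: is_derive_comp (is_derive_segment _ _ _) (differentiableP (df Ua)).
have dFe th : 0 <= th <= h -> `|dF th| <= e * h.
  move=> t0h; have [p1 _] := P1 th t0h; have [p2 _] := P2 th t0h.
  have -> : dF th = (g (th *: a + h *: b + x) - g x - 'd g x (th *: a + h *: b)) -
      (g (th *: a + x) - g x - 'd g x (th *: a)).
    rewrite /dF linearD [x + h *: b]addrC [_ + x + th *: a]addrC addrA [x + _]addrC.
    rewrite ['d g x (h *: b)]linearZ /=.
    by apply/matrixP => i j; rewrite !mxE; ring.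
  apply: le_trans (ler_normB _ _) _; apply: le_trans (lerD p2 p1) _.
  rewrite [leRHS](_ : _ = e / c * (h * (`|a| + `|b|)) + e / c *
    (h * `|a|) + e / c * h).
    by rewrite lerDl mulr_ge0// ltW.
  by rewrite -{1}(divfK (lt0r_neq0 c0) e) {2}/c; ring.
have := mean_value (ltW h0) dFP dFe.
rewrite /F !scale0r subr0 !addr0 scalerA mulrA.
rewrite (_ : _ - _ - _ - (_ - _) = f (x + h *: a + h *: b) - f (x + h *: a) -
  (f (x + h *: b) - f x) - (h * h) *: 'd g x b); first by rewrite subr0.
by rewrite [x + h *: b + _]addrAC; apply/matrixP => i j; rewrite !mxE; ring.
Qed.

(** The second difference is symmetric in [a] and [b], and divided by [h * h] it approximates both
    sides. *)
Lemma second_diff_sym (a b : V) :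
  differentiable (fun y => 'd f y a) x -> differentiable (fun y => 'd f y b) x ->
  'd (fun y => 'd f y a) x b = 'd (fun y => 'd f y b) x a.
Proof.
move=> da db; apply/eqP; rewrite -subr_eq0 -normr_le0; apply/ler_addgt0Pl => e e0.
rewrite addr0; have e2 : 0 < e / 2 by rewrite divr_gt0.
have [d1 d10 d1P] := second_difference b e2 da.
have [d2 d20 d2P] := second_difference a e2 db.
pose h := Num.min d1 d2; have h0 : 0 < h by rewrite lt_min d10.
have hh : 0 < h * h by rewrite mulr_gt0.
have [h1 h2] : h <= d1 /\ h <= d2 by rewrite /h !ge_min !lexx orbT.
have := d1P h; rewrite h0 h1 => /(_ isT); have := d2P h; rewrite h0 h2 => /(_ isT).
set D1 := f _ - _ - _; set D2 := f _ - _ - _.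
have -> : D1 = D2 by rewrite /D1 /D2 [x + _ + _]addrAC; apply/matrixP => i j;
  rewrite !mxE; ring.
set A := _ *: _; set B := _ *: _ => hA hB.
have : `|B - A| <= e * (h * h).
  have -> : B - A = (D2 - A) - (D2 - B)
    by rewrite [X in _ = _ + X]opprB [RHS]addrC addrA subrK.
  apply: le_trans (ler_normB _ _) _; lra.
by rewrite -scalerBr normrZ gtr0_norm// mulrC ler_pM2r.
Qed.

End Schwarz.

Section BracketTangent.
Context {R : realType} {k n : nat}.
Variables (V : set 'rV[R]_k) (Phi : 'rV[R]_k -> 'rV[R]_n).
Hypothesis oV : open V.
Hypothesis CPhi : Ck_on 2 V Phi.
Hypothesis freeJ : forall t, V t -> row_free (jacobian Phi t).

Lemma mulmx_jacobian_sum (c : 'rV[R]_k) t :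
  c *m jacobian Phi t = \sum_i c 0 i *: 'd Phi t (delta_mx 0 i).
Proof.
rewrite mulmx_sum_row; apply: eq_bigr => i _.
by rewrite rowE (mulmx_jacobian Phi).
Qed.

(* Writing [X o Phi = c *m jacobian Phi] and differentiating, the derivatives of
   [c] contribute tangent vectors only. *)
Lemma diff_tangent (W : set 'rV[R]_n) (X : 'rV[R]_n -> 'rV[R]_n) t :
  open W -> Ck_on 1 W X -> V t -> W (Phi t) ->
  (forall u, V u -> W (Phi u) -> (X (Phi u) <= jacobian Phi u)%MS) ->
  exists c : 'rV[R]_k, X (Phi t) = c *m jacobian Phi t /\
    forall v, exists w : 'rV[R]_k,
      'd X (Phi t) ('d Phi t v) =
      w *m jacobian Phi t + 'd (fun u => 'd Phi u v) t c.
Proof.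
move=> oW CX Vt Wt XJ.
have CPhi1 := Ck_onW CPhi.
(* [P] is a right inverse at the point [t] only. Near [t] the product [jacobian Phi u *m P] stays
   invertible, and correcting [P] by its inverse gives coefficients [c u] that depend on [u] in a
   C^1 way. *)
pose P := pinvmx (jacobian Phi t).
have JP : jacobian Phi t *m P = 1%:M by apply: mulmxVp; exact: freeJ.
have CJ : Ck_on 1 V (jacobian Phi) by exact: (Ck_on_jacobian oV CPhi).
have CJP : Ck_on 1 V (fun u => jacobian Phi u *m P).
  by apply: (Ck_on_mulmx oV CJ); exact: (Ck_on_cst 1 V P).
pose U := [set u | [/\ V u, W (Phi u) & \det (jacobian Phi u *m P) != 0]].
have oU : open U.
  rewrite openE => u [Vu Wu du].
  have cdet := Ck_on_continuous (Ck_on_det oV CJP) Vu.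
  have cPhi := Ck_on_continuous CPhi1 Vu.
  have h1 := open_near oV Vu;
    have h2 : \forall y \near u, W (Phi y) by exact: cPhi _ (open_near oW Wu).
  have h3 : \forall y \near u, \det (jacobian Phi y *m P) != 0.
    exact: cvgr_neq0 _ cdet du.
  suff : \forall y \near u, U y by [].
  by near=> y; split; near: y; [exact: h1 | exact: h2 | exact: h3].
have Ut : U t by split=> //; rewrite JP det1 oner_neq0.
have UV : U `<=` V by move=> u [].
have [c cE] : exists c : 'rV[R]_k -> 'rV[R]_k, forall u,
    c u = X (Phi u) *m P *m invmx (jacobian Phi u *m P) by eexists.
have uP u : U u -> jacobian Phi u *m P \in unitmx by move=> [_ _];
  rewrite unitmxE unitfE.
have Xc u : U u -> X (Phi u) = c u *m jacobian Phi u.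
  move=> Uu; have [Vu Wu _] := Uu; have /submxP[D XD] := XJ u Vu Wu.
  by rewrite cE XD -(mulmxA D) mulmxK//; exact: uP.
have CXPhi : Ck_on 1 U (fun u => X (Phi u)).
  apply: (@Ck_on_comp _ _ _ _ _ _ _ Phi X (framed_rV n) oU oW).
  - by move=> u [].
  - exact: (Ck_on_sub UV CPhi1).
  - exact: CX.
have Cc : Ck_on 1 U c.
  rewrite (funext cE).
  apply: (@Ck_on_mulmx _ _ _ _ oU _ _ _ (fun u => X (Phi u) *m P) (fun u =>
    invmx (jacobian Phi u *m P))).
    apply: (@Ck_on_mulmx _ _ _ _ oU _ _ _ (fun u => X (Phi u)) (fun=> P)) => //.
    exact: (Ck_on_cst 1 U P).
  exact: (Ck_on_invmx oU (Ck_on_sub UV CJP) uP).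
exists (c t); split; first exact: Xc.
move=> v.
have dPhi i : is_diff t (fun u => 'd Phi u (delta_mx 0 i)) ('d (fun u =>
  'd Phi u (delta_mx 0 i)) t).
  exact: (Ck_on_is_diff (Ck_on_diff (delta_mx 0 i) CPhi) Vt).
have dc i : is_diff t (fun u => c u 0 i) ('d (fun u => c u 0 i) t).
  by apply: (@Ck_on_is_diff _ _ _ 0 U _ _ _ Ut); apply: ((Ck_on_rVP _ _ oU).1 Cc).
have dX : is_diff t (fun u => X (Phi u)) (fun h => 'd X (Phi t) ('d Phi t h)).
  exact: (is_diff_comp (Ck_on_is_diff CPhi1 Vt) (Ck_on_is_diff CX Wt)).
pose S u := \sum_i c u 0 i *: 'd Phi u (delta_mx 0 i).
pose dS h := \sum_i ('d (fun u => c u 0 i) t h *: 'd Phi t (delta_mx 0 i) +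
  c t 0 i *: 'd (fun u => 'd Phi u (delta_mx 0 i)) t h).
have dSP : is_diff t S dS.
  apply: is_diff_bigsum => i; exact: (is_diff_scale (dc i) (dPhi i)).
have XS : is_diff t (fun u => X (Phi u)) dS.
  apply: near_is_diff dSP; apply: filterS (open_near oU Ut) => u Uu.
  by rewrite (Xc _ Uu) mulmx_jacobian_sum.
exists (\row_i 'd (fun u => c u 0 i) t v).
have EX := etrans (esym (is_diffE v dX)) (is_diffE v XS).
apply: (etrans EX).
rewrite /dS big_split /=; congr (_ + _).
  rewrite mulmx_jacobian_sum; apply: eq_bigr => i _; congr (_ *: _).
  by rewrite [RHS]mxE.
have E2 := @diff_frame _ _ _ (fun u => 'd Phi u v) _ _ (fun i (w : 'rV[R]_k) =>
  w 0 i) t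
  (c t) (row_sum_delta (c t)).
apply: etrans (esym E2).
apply: eq_bigr => i _; congr (_ *: _).
apply: (@second_diff_sym _ _ _ _ V Phi t oV Vt) => [y Vy||].
- by have [] := Ck_on_is_diff CPhi1 Vy.
- by have [] := dPhi i.
- by have [] := Ck_on_is_diff (Ck_on_diff v CPhi) Vt.
Unshelve. all: by end_near. Qed.

(** With [a] and [b] the coefficients of [X] and [Y], each directional derivative is a tangent
    vector plus a second derivative of [Phi] in the directions [a] and [b]. These second derivatives
    are equal by symmetry and cancel in the bracket. *)
Lemma bracket_tangent (W : set 'rV[R]_n) (X Y : 'rV[R]_n -> 'rV[R]_n) t :
  open W -> Ck_on 1 W X -> Ck_on 1 W Y -> V t -> W (Phi t) ->
  (forall u, V u -> W (Phi u) -> (X (Phi u) <= jacobian Phi u)%MS) ->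
  (forall u, V u -> W (Phi u) -> (Y (Phi u) <= jacobian Phi u)%MS) ->
  ('d Y (Phi t) (X (Phi t)) - 'd X (Phi t) (Y (Phi t)) <= jacobian Phi t)%MS.
Proof.
move=> oW CX CY Vt Wt XJ YJ.
have [a [Xa dX]] := diff_tangent oW CX Vt Wt XJ.
have [b [Yb dY]] := diff_tangent oW CY Vt Wt YJ.
have [w1 e1] := dY a; have [w2 e2] := dX b.
have E1 := etrans (congr1 ('d Y (Phi t)) (etrans Xa (mulmx_jacobian Phi t a))) e1.
have E2 := etrans (congr1 ('d X (Phi t)) (etrans Yb (mulmx_jacobian Phi t b))) e2.
have sym : 'd (fun u => 'd Phi u a) t b = 'd (fun u => 'd Phi u b) t a.
  apply: (@second_diff_sym _ _ _ _ V Phi t oV Vt) => [y Vy||].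
  - by have [] := Ck_on_is_diff (Ck_onW CPhi) Vy.
  - by have [] := Ck_on_is_diff (Ck_on_diff a CPhi) Vt.
  - by have [] := Ck_on_is_diff (Ck_on_diff b CPhi) Vt.
have main (p q s1 s2 : 'rV[R]_n) : p = w1 *m jacobian Phi t + s1 ->
    q = w2 *m jacobian Phi t + s2 -> s1 = s2 -> (p - q <= jacobian Phi t)%MS.
  by move=> -> -> ->; rewrite opprD addrACA subrr addr0 -mulmxBl submxMl.
exact: main E1 E2 sym.
Qed.

End BracketTangent.

(** * Flows on the manifold *)

Section ManifoldFlow.
Context {R : realType} {M : manifold R}.
Implicit Types (c : chart M) (X : local_vf M).

Lemma cmapVK c p : (cmap c @` cdom c) p ->
  cdom c (cinv c p) /\ cmap c (cinv c p) = p.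
Proof. by move=> [x cx <-]; rewrite cmapK. Qed.

Lemma chart_imageP c (U : set M) p :
  (cmap c @` (cdom c `&` U)) p <-> (cmap c @` cdom c) p /\ U (cinv c p).
Proof.
split=> [[x [cx Ux] <-]|[cp Up]]; first by rewrite cmapK//; split=> //; exists x.
have [cx cE] := cmapVK cp.
by exists (cinv c p).
Qed.

Lemma open_chart_image c (U : set M) : open U -> open (cmap c @` (cdom c `&` U)).
Proof.
move=> oU; rewrite openE => p /chart_imageP[cp Up].
have cinvp := @cinv_cont _ _ c p cp.
have h1 : \forall q \near p, U (cinv c q) by exact: cinvp _ (open_near oU Up).
have h2 : \forall q \near p, (cmap c @` cdom c) q.
  exact: (open_near (@cimg_open _ _ c) cp).
suff : \forall q \near p, (cmap c @` (cdom c `&` U)) q by [].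
by near=> q; apply/chart_imageP; split; near: q.
Unshelve. all: by end_near. Qed.

Definition chart_field c X (p : 'rV[R]_(cdim c)) : 'rV[R]_(cdim c) :=
  X (cinv c p) c.

Lemma chart_field_smooth c X :
  smooth_on (cmap c @` (cdom c `&` vdom X)) (@chart_field c X).
Proof. exact: vval_smooth. Qed.

Lemma lift_integral_curve c X (a b : R) (g : R -> 'rV[R]_(cdim c)) :
  (forall t, a < t < b -> (cmap c @` (cdom c `&` vdom X)) (g t) /\
     is_derive t (1 : R) g (@chart_field c X (g t))) ->
  integral_curve X a b (cinv c \o g).
Proof.
move=> gP t tab; have [/chart_imageP[cg Xg] dg] := gP t tab.
have [cx cE] := cmapVK cg; split=> //=.
  apply: (@continuous_comp _ _ _ g (@cinv _ _ c)).
    exact: is_derive_continuous dg.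
  exact: cinv_cont.
move=> c' c'x; have [_ /(_ c c' cx c'x) ->] := vval_tangent Xg; rewrite cE.
have tr : Ck_on 1 (cmap c @` (cdom c `&` cdom c')) (cmap c' \o cinv c).
  exact: transition_smooth.
have gt : (cmap c @` (cdom c `&` cdom c')) (g t) by apply/chart_imageP.
exact: is_derive_comp dg (Ck_on_is_diff tr gt).
Qed.

Lemma is_derive_shift_arg (W : normedModType R) (g : R -> W) (t0 s : R) v :
  is_derive (t0 + s) (1 : R) g v -> is_derive s (1 : R) (fun u => g (t0 + u)) v.
Proof.
move=> dg; have sh := @is_derive_segment R R t0 1 s.
have shE : (fun u : R => t0 + u *: (1 : R)) = (fun u => t0 + u).
  by apply/funext => u; rewrite [_ *: _]mulr1.
rewrite shE in sh; have /is_diff_curve dg' := dg.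
by have := is_derive_comp sh dg'; rewrite scale1r.
Qed.

(** By continuity both curves stay for a short time in a chart ball on which the field is Lipschitz;
    there [gronwall] applies with [c = 0] and initial distance 0. *)
Lemma integral_curve_unique_near X (a b t0 : R) (g1 g2 : R -> M) :
  integral_curve X a b g1 -> integral_curve X a b g2 -> a < t0 < b ->
  g1 t0 = g2 t0 -> \forall t \near t0, g1 t = g2 t.
Proof.
move=> I1 I2 t0ab g12; have [X1 c1 _] := I1 _ t0ab; have [_ c2 _] := I2 _ t0ab.
have [c cx] := cdom_cover (g1 t0).
pose p0 := cmap c (g1 t0).
have oW := @open_chart_image c _ (@vdom_open _ _ X).
have Wp0 : (cmap c @` (cdom c `&` vdom X)) p0 by exists (g1 t0).
have [r [L [B [r0 L0 B0 _ XL]]]] :=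
  local_lipschitz (framed_rV _) oW Wp0 (@chart_field_smooth c X 1).
have near_in (g : R -> M) : {for t0, continuous g} -> g t0 = g1 t0 ->
    \forall t \near t0, cdom c (g t) /\ `|cmap c (g t) - p0| <= r.
  move=> cg gE; have cx' : cdom c (g t0) by rewrite gE.
  have h1 : \forall t \near t0, cdom c (g t).
    exact: cg _ (open_near (@cdom_open _ _ c) cx').
  have cc : {for t0, continuous (cmap c \o g)}.
    by apply: continuous_comp => //; exact: cmap_cont.
  have h2 : \forall t \near t0, `|cmap c (g t) - p0| < r.
    rewrite /p0 -gE; have hb := @near_ball _ _ (cmap c (g t0)) r r0.
    exact: (cc _ hb).
  by near=> t; split; [|apply: ltW]; near: t.
have h1 := near_in g1 c1 erefl; have h2 := near_in g2 c2 (esym g12).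
have h3 : \forall t \near t0, a < t < b.
  have : open [set t : R | a < t < b] by rewrite -[X in open X]/[set` `]a, b[];
    exact: interval_open.
  by move/open_near; exact.
have [d d0 dP] := near_closed_ball (filterI h1 (filterI h2 h3)).
have [d' d'0 d'P] : exists2 d : R, 0 < d & forall T, 0 <= T <= d -> T * L <= 2^-1.
  by apply: small_time; rewrite invr_gt0.
pose T := Num.min d d'; have T0 : 0 < T by rewrite lt_min d0.
have [Td Td'] : T <= d /\ T <= d' by rewrite /T !ge_min !lexx orbT.
have TL : T * L <= 2^-1 by apply: d'P; rewrite (ltW T0).
have inT s : `|s| < T -> [/\ cdom c (g1 (t0 + s)) /\
  `|cmap c (g1 (t0 + s)) - p0| <= r,
    cdom c (g2 (t0 + s)) /\ `|cmap c (g2 (t0 + s)) - p0| <= r & a < t0 + s < b].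
  move=> sT; have := dP (t0 + s);
    rewrite addrC addKr => /(_ (le_trans (ltW sT) Td)).
  by move=> [? [? ?]].
have main s : `|s| < T -> g1 (t0 + s) = g2 (t0 + s).
  move=> sT.
  have := @gronwall R _ (fun s => cmap c (g1 (t0 + s)) - cmap c (g2 (t0 + s)))
    (fun s => X (g1 (t0 + s)) c - X (g2 (t0 + s)) c) T L 0 L0 (lexx 0) TL _ _ s sT.
  rewrite addr0 g12 subrr normr0 mulr0 addr0 mulr0 => G.
  have {G} : `|cmap c (g1 (t0 + s)) - cmap c (g2 (t0 + s))| <= 0.
    apply: G => u uT; have [[u1 r1] [u2 r2] uab] := inT u uT.
      have [_ _ /(_ c u1) D1] := I1 _ uab; have [_ _ /(_ c u2) D2] := I2 _ uab.
      by apply: is_deriveB; apply: is_derive_shift_arg.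
    rewrite addr0; have := XL _ _ r1 r2.
    by rewrite /chart_field !cmapK.
  have [[u1 _] [u2 _] _] := inT s sT.
  rewrite normr_le0 subr_eq0 => /eqP E.
  by rewrite -(cmapK u1) E cmapK.
have := @near_ball _ R t0 T T0; apply: filterS => t tT.
by have := main (t - t0) tT; rewrite addrC subrK.
Unshelve. all: by end_near. Qed.

(** The set of agreement is open in the interval by local uniqueness and closed in it because [M] is
    Hausdorff; the interval is connected. *)
Lemma integral_curve_unique X (a b : R) (g1 g2 : R -> M) :
  integral_curve X a b g1 -> integral_curve X a b g2 -> a < 0 < b ->
  g1 0 = g2 0 -> forall t, a < t < b -> g1 t = g2 t.
Proof.
move=> I1 I2 ab0 g12; pose I := [set` `]a, b[] : set R.
have IP t : I t <-> a < t < b by rewrite /I /= in_itv.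
pose B := I `&` [set t | g1 t = g2 t].
have cI : connected I by apply/connected_intervalP; exact: interval_is_interval.
suff BI : B = I by move=> t /IP It; have [] : B t by rewrite BI.
apply: cI.
- by exists 0; split=> //; apply/IP.
- exists (interior [set t | g1 t = g2 t]); first exact: open_interior.
  apply/seteqP; split=> t [It Et]; split=> //.
    exact: (integral_curve_unique_near I1 I2 ((IP t).1 It) Et).
  exact: interior_subset Et.
- exists (closure B); first exact: closed_closure.
  apply/seteqP; split=> t [It Et]; split=> //; first exact: subset_closure.
  have [_ c1 _] := I1 t ((IP t).1 It); have [_ c2 _] := I2 t ((IP t).1 It).
  apply: (@manifold_hausdorff _ M) => A1 A2 n1 n2.
  have m1 : \forall s \near t, A1 (g1 s) by exact: c1.
  have m2 : \forall s \near t, A2 (g2 s) by exact: c2.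
  have [s [[_ /= gs] [a1 a2]]] := Et _ (filterI m1 m2).
  by exists (g1 s); split=> //; rewrite gs.
Qed.

(** [Fl] picks some point of the flow graph; comparing two curves on the intersection of their
    intervals shows that only one point is available. *)
Lemma Fl_integral_curve X (a b t : R) (g : R -> M) :
  integral_curve X a b g -> a < 0 < b -> a < t < b -> Fl X t (g 0) = g t.
Proof.
move=> Ig ab0 tab; apply: xget_unique.
  by exists a, b, g; split.
move=> y [a' [b' [g' [ab0' tab' Ig' g0 <-]]]].
pose A := Num.max a a'; pose B := Num.min b b'.
have sub (h : R -> M) a1 b1 : integral_curve X a1 b1 h -> a1 <= A -> B <= b1 ->
    integral_curve X A B h.
  move=> Ih aA Bb s /andP[As sB]; apply: Ih.
  by rewrite (le_lt_trans aA As) (lt_le_trans sB Bb).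
apply: (@integral_curve_unique X A B).
- by apply: sub Ig' _ _; rewrite /A /B ?le_max ?ge_min lexx orbT.
- by apply: sub Ig _ _; rewrite /A /B ?le_max ?ge_min lexx.
- move: ab0 ab0' => /andP[? ?] /andP[? ?].
  by rewrite /A /B gt_max lt_min; apply/andP; split; apply/andP.
- exact: g0.
- move: tab tab' => /andP[? ?] /andP[? ?].
  by rewrite /A /B gt_max lt_min; apply/andP; split; apply/andP.
Qed.

(** The hypothesis concerns time 0 only, but from every starting point: shifting time makes [g t0]
    the starting point, and the shifted curve is the flow line through it. *)
Lemma flow_derivative_along X (f : M -> R) (a b t0 : R) (g : R -> M) :
  (forall x, vdom X x -> flow_derivable X f x) ->
  integral_curve X a b g -> a < t0 < b ->
  is_derive t0 (1 : R) (f \o g) (flow_derivative X f (g t0)).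
Proof.
move=> fX Ig t0ab; have [Xt _ _] := Ig _ t0ab; have [at0 t0b] := andP t0ab.
have Ish : integral_curve X (a - t0) (b - t0) (fun s => g (t0 + s)).
  move=> s /andP[s1 s2]; have [] := Ig (t0 + s); first by apply/andP; split; lra.
  move=> Xs cs ds; split=> //.
    apply: (@continuous_comp _ _ _ (fun s => t0 + s) g) => //.
    by apply: continuousD; [exact: cst_continuous | ].
  by move=> c cc; exact: (@is_derive_shift_arg _ (cmap c \o g) t0 s _ (ds c cc)).
have D : is_derive 0 (1 : R) (fun t =>
  f (Fl X t (g t0))) (flow_derivative X f (g t0)).
  by apply: DeriveDef; [exact: fX Xt | ].
have ab0 : a - t0 < 0 < b - t0 by apply/andP; split; lra.
have FlE : \forall t \near (0 : R), f (Fl X t (g t0)) = f (g (t0 + t)).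
  have : open [set t : R | a - t0 < t < b - t0].
    by rewrite -[X in open X]/[set` `]a - t0, b - t0[]; exact: interval_open.
  move=> /open_near/(_ ab0); apply: filterS => t tab.
  by have := Fl_integral_curve Ish ab0 tab; rewrite addr0 => ->.
have D' := near_eq_is_derive FlE D.
have := @is_derive_shift_arg R (fun t =>
  f (g (t0 + t))) (- t0) t0 (flow_derivative X f (g t0)).
rewrite addNr => /(_ D').
by congr is_derive; apply/funext => s /=; rewrite addrA subrr add0r.
Qed.

End ManifoldFlow.

(** * Compositions of horizontal flows *)

Section Slices.
Context {R : realType}.
Implicit Types V W Z : normedModType R.

Lemma open_preimage V W (D : set W) (h : V -> W) :
  (forall x, {for x, continuous h}) -> open D -> open [set x | D (h x)].
Proof. by move=> ch; apply: open_comp => x _; exact: ch. Qed.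

Lemma Ck_on_slice V W Z k (D : set W) (g : W -> Z) (h : V -> W) : framed W ->
  open D -> (forall j, Ck_on j setT h) -> Ck_on k D g ->
  open [set x | D (h x)] /\ Ck_on k [set x | D (h x)] (fun x => g (h x)).
Proof.
move=> fW oD Ch Cg; have oD' : open [set x | D (h x)].
  by apply: open_preimage => // x; exact: (Ch 0%N x I).
split=> //; have Ch' : Ck_on k [set x | D (h x)] h by apply: Ck_on_sub (Ch k).
by apply: (@Ck_on_comp _ _ _ _ _ _ _ h g fW oD' oD).
Qed.

Lemma Ck_on_pairr V W (x : V) k : framed W -> Ck_on k setT (fun t : W => (x, t)).
Proof.
move=> fW; apply: (Ck_on_pair openT); first exact: (Ck_on_cst k setT x).
exact: Ck_on_linear.
Qed.

Lemma Ck_on_pairl V W (t : W) k : framed V -> Ck_on k setT (fun x : V => (x, t)).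
Proof.
move=> fV; apply: (Ck_on_pair openT); last exact: (Ck_on_cst k setT t).
exact: Ck_on_linear.
Qed.

End Slices.

Section HorizontalFlow.
Context {R : realType} {M : manifold R}.
Variables (r : nat) (f : M -> R) (c : chart M).
Local Notation n := (cdim c).
Local Notation F := (fun p : 'rV[R]_n => f (cinv c p) : R).

(** As a function of time, the increment of [F] vanishes at 0 and has derivative
    [flow_derivative X f] along the flow, which is of class C^r in time and initial point. So
    [primitive_Ck] applies to a difference of values of an arbitrary function [F]. *)
Lemma flow_increment (X : local_vf M) (y1 : 'rV[R]_n) k :
  (r <= k)%N ->
  (forall x, vdom X x -> flow_derivable X f x) ->
  class_C r (vdom X) (flow_derivative X f) ->
  (cmap c @` (cdom c `&` vdom X)) y1 ->
  exists T rho phi,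
    is_local_flow (cmap c @` (cdom c `&` vdom X))
      (@chart_field _ _ c X) y1 k T rho phi /\
    Ck_on r (flowbox y1 T rho) (fun p => F (phi p) - F p.2).
Proof.
move=> rk fX CX Wy1; set W := cmap c @` _ in Wy1 *.
have oW : open W by apply: open_chart_image; exact: vdom_open.
have [T [rho [phi fl]]] := local_flow k oW Wy1 (@chart_field_smooth _ _ c X).
have [T0 rho0 phi0 phiP Cphi] := fl.
have oD := @open_flowbox R _ y1 T rho.
pose g p := flow_derivative X f (cinv c (phi p)).
pose u p := F (phi p) - F p.2.
have Cg : Ck_on r (flowbox y1 T rho) g.
  apply: (@Ck_on_comp _ _ _ _ _ _ _ phi (fun p =>
    flow_derivative X f (cinv c p)) (framed_rV _) oD oW).
  - by move=> [s y] /phiP[].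
  - exact: Ck_on_le rk Cphi.
  - exact: CX.
have prim : primitive_of y1 T rho g u.
  split=> [y yr|s y sy]; first by rewrite /u phi0// subrr.
  have [/= sT yr] := sy.
  have Ig : integral_curve X (- T) T (cinv c \o (fun t => phi (t, y))).
    apply: lift_integral_curve => t; rewrite -ltr_norml => tT.
    exact: (phiP t y (conj tT yr)).
  have := @flow_derivative_along _ _ X f (- T) T s _ fX Ig;
    rewrite -ltr_norml => /(_ sT) D.
  have D' : is_derive s (1 : R) (fun t => F (phi (t, y))) (g (s, y)) := D.
  have D0 := is_derive_cst (F y) s (1 : R).
  have := is_deriveB D' D0; rewrite subr0; exact.
(* Half the time, because [primitive_Ck] concludes on a strictly shorter interval. *)
exists (T / 2), rho, phi; split.
  by apply: (local_flow_shrink _ _ fl);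
    rewrite ?lexx ?rho0// divr_gt0//= ler_pdivrMr// ler_peMr ?ler1n// ltW.
apply: (primitive_Ck (framed_rV _) _ Cg prim).
by rewrite ltr_pdivrMr// ltr_pMr// ltr1n.
Qed.

End HorizontalFlow.

(** At time 0 the flow is the identity in the initial point, and its time derivative is the
    field. *)
Lemma flow_diff_origin (R : realType) n (W : set 'rV[R]_n) xi y1 T rho
    (phi : R * 'rV[R]_n -> 'rV[R]_n) s v :
  is_diff (0, y1) phi ('d phi (0, y1)) ->
  (forall y, `|y - y1| < rho -> phi (0, y) = y) ->
  (forall s y, flowbox y1 T rho (s, y) -> W (phi (s, y)) /\
      is_derive s (1 : R) (fun u => phi (u, y)) (xi (phi (s, y)))) ->
  0 < T -> 0 < rho ->
  'd phi (0, y1) (s, v) = s *: xi y1 + v.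
Proof.
move=> dphi phi0 phiP T0 rho0.
have box0 : flowbox y1 T rho (0, y1) by split; rewrite /= ?normr0// subrr normr0.
have phi0y : phi (0, y1) = y1 by rewrite phi0// subrr normr0.
have -> : (s, v) = s *: ((1, 0) : R * 'rV[R]_n) + (0, v).
  by congr pair; rewrite /= ?scaler0 ?add0r// [_ *: _]mulr1 addr0.
rewrite linearD linearZ /=; congr (_ *: _ + _).
  have d1 : is_derive 0 (1 : R) (fun u : R => (u, y1)) ((1, 0) : R * 'rV[R]_n).
    apply/is_diff_curve; have := is_diff_pair (is_diff_id (0 : R)) (is_diff_cst y1
      (0 : R)).
    congr is_diff_def; apply/funext => h /=.
    by congr pair; rewrite /= ?scaler0// [RHS]mulr1.
  have [_ e1] := is_derive_comp d1 dphi.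
  have [_ [_ e2]] := phiP _ _ box0.
  by rewrite -[LHS]e1 -[in RHS]phi0y -[RHS]e2.
have d2 := is_diff_pair (is_diff_cst (0 : R) y1) (is_diff_id y1).
have d3 := is_diff_comp d2 dphi.
have near_id : \forall y \near y1, (phi \o (fun y => (cst 0 y, id y))) y = y.
  have := near_ball y1 rho0; apply: filterS => y yr.
  by rewrite /= phi0.
have := is_diffE v (near_is_diff near_id d3).
by have [_ ->] := is_diff_id y1.
Qed.

(** * Regularity at a point by maximal compositions *)

Section Reach.
Context {R : realType} {M : manifold R}.
Variables (H : tangent_distribution M) (r : nat) (f : M -> R).
Hypothesis H_bracket : bracket_generating H.
Hypothesis Xf_Cr : forall X : local_vf M, horizontal H X ->
  (forall x, vdom X x -> flow_derivable X f x) /\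
  class_C r (vdom X) (flow_derivative X f).
Variables (c : chart M) (x0 : 'rV[R]_(cdim c)).
Local Notation n := (cdim c).
Local Notation E := 'rV[R]_n.
Local Notation O := (cmap c @` cdom c).
Local Notation F := (fun p : E => f (cinv c p) : R).

(* [Phi (x, t)] is reached from [x] along horizontal trajectories, so that
   [F (Phi p) - F p.1] is regular although nothing is known about [F] itself. *)
Definition reaches k (D : set (E * 'rV[R]_k)) (t1 : 'rV[R]_k)
    (Phi : E * 'rV[R]_k -> E) :=
  [/\ open D, D (x0, t1), Ck_on r.+2 D Phi,
    forall p, D p -> O (Phi p) & Ck_on r D (fun p => F (Phi p) - F p.1)] /\
  row_free (jacobian (fun t => Phi (x0, t)) t1).

(** The empty composition: the jacobian has no rows, and the increment of [F] is 0. *)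
Lemma reaches0 : O x0 -> exists D t1 Phi, @reaches 0 D t1 Phi.
Proof.
move=> Ox0; have fEk := framed_prod (framed_rV n) (@framed_rV R 0).
exists [set p | O p.1], 0, fst; split;
  last by rewrite /row_free -leqn0 rank_leq_row.
split=> //.
- apply: open_preimage; last exact: cimg_open.
  by move=> p; apply: (framed_continuous (l := fst)).
- exact: Ck_on_linear.
- have -> : (fun p : E * 'rV[R]_0 => F p.1 - F p.1) = cst 0.
    by apply/funext => p; rewrite subrr.
  exact: Ck_on_cst.
Qed.

(** Tangent vectors are compatible families over all charts; the chain rule for transition maps
    extends any [w] to such a family. Through it, bracket generation speaks about every vector of
    the chart [c]. *)
Lemma tangent_coord (p w : E) : O p ->
  exists2 v, tangent_space (cinv c p) v & v c = w.
Proof.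
move=> Op; have [cx cE] := cmapVK Op.
pose v (c' : chart M) := if pselect (cdom c' (cinv c p)) then
  'd (cmap c' \o cinv c) p w else 0.
have vE c' : cdom c' (cinv c p) -> v c' = 'd (cmap c' \o cinv c) p w.
  by rewrite /v; case: pselect.
exists v.
- split=> [c' nc'|c1 c2 x1 x2]; first by rewrite /v; case: pselect.
  rewrite !vE//.
  have tr (c3 c4 : chart M) q : (cmap c3 @` (cdom c3 `&` cdom c4)) q ->
    differentiable (cmap c4 \o cinv c3) q.
    by have [+ _] := transition_smooth c3 c4 1; apply.
  have p1 : (cmap c @` (cdom c `&` cdom c1)) p by apply/chart_imageP.
  have cE1 : (cmap c1 \o cinv c) p = cmap c1 (cinv c p) by [].
  have q1 : (cmap c1 @` (cdom c1 `&` cdom c2)) (cmap c1 (cinv c p))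
    by exists (cinv c p).
  have D1 := differentiableP (tr _ _ _ p1);
    have D2 := differentiableP (tr _ _ _ q1).
  have D12 := is_diff_comp D1 D2.
  have E12 : \forall q \near p,
    ((cmap c2 \o cinv c1) \o (cmap c1 \o cinv c)) q = (cmap c2 \o cinv c) q.
    have oc := @open_chart_image _ _ c _ (@cdom_open _ _ c1).
    have := open_near oc p1; apply: filterS => q /chart_imageP[_ q1'].
    by rewrite /= cmapK.
  by have := is_diffE w (near_is_diff E12 D12).
- rewrite vE//; have near_id : \forall q \near p, q = (cmap c \o cinv c) q.
    have := open_near (@cimg_open _ _ c) Op; apply: filterS => q Oq.
    by have [_ /= ->] := cmapVK Oq.
  exact: (is_diffE w (near_is_diff near_id (is_diff_id p))).
Qed.

(** Minimality of the Lie hull replaces an induction over iterated brackets: the fields tangent to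
    the image wherever they are defined on it form an involutive set [T] containing the horizontal
    ones. Bracket generation then puts every vector in the row space. *)
Lemma all_tangent_full k (V : set 'rV[R]_k) (Phi : 'rV[R]_k -> E) t1 :
  open V -> V t1 -> Ck_on 2 V Phi -> (forall t, V t -> O (Phi t)) ->
  (forall t, V t -> row_free (jacobian Phi t)) ->
  (forall X t, horizontal H X -> V t -> vdom X (cinv c (Phi t)) ->
     (chart_field X (Phi t) <= jacobian Phi t)%MS) ->
  row_full (jacobian Phi t1).
Proof.
move=> oV Vt1 CPhi OPhi freeJ tanX.
pose T := [set Z : local_vf M | forall t, V t -> vdom Z (cinv c (Phi t)) ->
  (chart_field Z (Phi t) <= jacobian Phi t)%MS].
have invT : lie_involutive T.
  move=> X Y Z TX TY [domZ ZE] t Vt Zt; have [ct cE] := cmapVK (OPhi t Vt).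
  rewrite /chart_field (ZE _ c Zt ct) cE.
  have oW := @open_chart_image _ _ c _ (openI (@vdom_open _ _ X)
    (@vdom_open _ _ Y)).
  have := Zt; rewrite domZ => -[Xt Yt].
  have Wt : (cmap c @` (cdom c `&` (vdom X `&` vdom Y))) (Phi t).
    by apply/chart_imageP; split; [exact: OPhi | split].
  have sub (X' : local_vf M) : (vdom X `&` vdom Y `<=` vdom X') ->
      Ck_on 1 (cmap c @` (cdom c `&` (vdom X `&` vdom Y))) (@chart_field _ _ c X').
    move=> XX'; apply: (Ck_on_sub _ (@chart_field_smooth _ _ c X' 1)) =>
      p /chart_imageP[cp /XX' Xp].
    exact/chart_imageP.
  apply: (@bracket_tangent _ _ _ V Phi oV CPhi freeJ _ (@chart_field _ _ c X)
    (@chart_field _ _ c Y) t oW (sub X _) (sub Y _) Vt Wt).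
  - by move=> p [].
  - by move=> p [].
  - by move=> u Vu /chart_imageP[_ [Xu _]]; exact: TX.
  - by move=> u Vu /chart_imageP[_ [_ Yu]]; exact: TY.
have hullT : lie_hull (horizontal H) `<=` T.
  by apply: smallest_sub => // X hX t Vt Xt; exact: tanX.
apply/row_fullP.
have full (w : E) : (w <= jacobian Phi t1)%MS.
  have [v tv <-] := tangent_coord w (OPhi _ Vt1).
  have [m [a [z [zP ->]]]] : linear_hull [set X (cinv c (Phi t1)) |
      X in lie_hull (horizontal H) `&` [set X | vdom X (cinv c (Phi t1))]] v.
    by rewrite -(H_bracket (x := cinv c (Phi t1)) I).
  apply: summx_sub => i _; apply: scalemx_sub.
  by have [X [/hullT TX Xt] <-] := zP i; exact: TX.
apply/row_fullP; rewrite -sub1mx; apply/row_subP => i; exact: full.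
Qed.

(** The new variable is the time spent on the flow of [X] after [Phi], with base value 0. There the
    differential gains the row [X (Phi (x0, t1))], independent of the others by hypothesis. Writing
    [k + 1] and not [k.+1] lets [lsubmx] and [rsubmx] separate old and new times. *)
Lemma reach_extend k (D : set (E * 'rV[R]_k)) t1 Phi (X : local_vf M) :
  @reaches k D t1 Phi -> horizontal H X -> vdom X (cinv c (Phi (x0, t1))) ->
  ~~ (chart_field X (Phi (x0, t1)) <= jacobian (fun t => Phi (x0, t)) t1)%MS ->
  exists D' t1' Phi', @reaches (k + 1) D' t1' Phi'.
Proof.
move=> [[oD Dt1 CPhi OPhi CG] freeJ] hX Xt1 notin.
set y1 := Phi (x0, t1) in Xt1 notin *.
have [fX CX] := Xf_Cr hX.
have Wy1 : (cmap c @` (cdom c `&` vdom X)) y1 by apply/chart_imageP; split=> //;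
  exact: OPhi.
have rK : (r <= r.+2)%N by rewrite leqW// leqW.
have [T [rho [phi [fl Cu]]]] := flow_increment rK fX CX Wy1.
have [T0 rho0 phi0 phiP Cphi] := fl.
pose lft (p : E * 'rV[R]_(k + 1)) : E * 'rV[R]_k := (p.1, lsubmx p.2).
pose arg (p : E * 'rV[R]_(k + 1)) : R * E := (rsubmx p.2 0 0, Phi (lft p)).
pose D' := [set p | D (lft p) /\ flowbox y1 T rho (arg p)].
pose Phi' p := phi (arg p).
pose t1' : 'rV[R]_(k + 1) := row_mx t1 0.
have fE1 := framed_prod (framed_rV n) (@framed_rV R (k + 1)).
have fEk := framed_prod (framed_rV n) (@framed_rV R k).
have fRE := framed_prod (@framed_real R) (@framed_rV R n).
have Clft j : Ck_on j setT lft.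
  by apply: Ck_on_linear => // a u v; congr pair; rewrite /= linearP.
have Crs j : Ck_on j setT (fun p : E * 'rV[R]_(k + 1) => rsubmx p.2 0 0 : R).
  by apply: Ck_on_linear => // a u v; rewrite /= linearP !mxE.
have [oDl CPhil] := Ck_on_slice fEk oD Clft CPhi.
have [_ CGl] := Ck_on_slice fEk oD Clft CG.
have Carg : Ck_on r.+2 [set p | D (lft p)] arg.
  by apply: (Ck_on_pair oDl) => //; exact: Ck_on_sub (Crs _).
have oD' : open D'.
  rewrite openE => p [Dp ap].
  have ca := Ck_on_continuous Carg Dp.
  have h1 : \forall q \near p, D (lft q) by exact: (open_near oDl Dp).
  have h2 : \forall q \near p, flowbox y1 T rho (arg q).
    exact: ca _ (open_near (@open_flowbox _ _ _ _ _) ap).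
  suff : \forall q \near p, D' q by [].
  by near=> q; split; near: q.
have D'D : D' `<=` [set p | D (lft p)] by move=> p [].
have D'box p : D' p -> flowbox y1 T rho (arg p) by move=> [].
have Carg' : Ck_on r.+2 D' arg by exact: Ck_on_sub D'D Carg.
have obox := @open_flowbox R _ y1 T rho.
have D't1' : D' (x0, t1').
  split; first by rewrite /lft /= row_mxKl.
  by rewrite /arg /lft /= row_mxKl row_mxKr mxE; split;
    rewrite /= ?normr0// subrr normr0.
have CPhi' : Ck_on r.+2 D' Phi'.
  exact: (@Ck_on_comp _ _ _ _ _ _ _ arg phi fRE oD' obox D'box Carg' Cphi).
exists D', t1', Phi'; split.
  split=> //.
  - move=> p /D'box ap; have := phiP (arg p).1 (arg p).2.
    by rewrite -surjective_pairing => /(_ ap)[/chart_imageP[Op _] _].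
  (* The increments telescope: from [Phi (lft p)] along the flow of [X], and before that from the
     starting point to [Phi (lft p)]. *)
  - have C1 : Ck_on r D' (fun p => F (phi (arg p)) - F (arg p).2).
      exact: (@Ck_on_comp _ _ _ _ _ _ _ arg _ fRE oD' obox D'box
        (Ck_on_le rK Carg') Cu).
    have C2 := Ck_on_sub D'D CGl.
    apply: (Ck_on_ext oD' _ (Ck_onD oD' C1 C2)) => p _.
    by rewrite /= subrKA.
pose Phi0 t := Phi (x0, t).
have [oV CPhi0] := Ck_on_slice fEk oD (fun j =>
  @Ck_on_pairr _ _ _ x0 j (framed_rV k)) CPhi.
have dPhi0 : is_diff t1 Phi0 ('d Phi0 t1) by exact: Ck_on_is_diff CPhi0 Dt1.
have lin_l : linear (lsubmx : 'rV[R]_(k + 1) -> 'rV[R]_k) by move=> a u v;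
  rewrite linearP.
have lin_r : linear (fun t : 'rV[R]_(k + 1) => rsubmx t 0 0 : R).
  by move=> a u v; rewrite linearP !mxE.
have cl := framed_continuous (framed_rV (k + 1)) lin_l.
have cr := framed_continuous (framed_rV (k + 1)) lin_r.
have dl : is_diff t1' (lsubmx : 'rV[R]_(k + 1) ->
  'rV[R]_k) lsubmx by exact: is_diff_lincont.
have dr : is_diff t1' (fun t : 'rV[R]_(k + 1) => rsubmx t 0 0 : R) (fun t =>
  rsubmx t 0 0).
  exact: is_diff_lincont.
have lt1 : lsubmx t1' = t1 by rewrite row_mxKl.
have rt1 : rsubmx t1' 0 0 = 0 :> R by rewrite row_mxKr mxE.
have dPl : is_diff t1' (Phi0 \o lsubmx) ('d Phi0 t1 \o lsubmx).
  by apply: (is_diff_comp dl); rewrite lt1.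
have darg := is_diff_pair dr dPl.
have box0 : flowbox y1 T rho (0, y1) by split; rewrite /= ?normr0// subrr normr0.
have dphi := Ck_on_is_diff Cphi box0.
have dPhi' : is_diff t1' (fun t => Phi' (x0, t))
    (fun h => 'd phi (0, y1) (rsubmx h 0 0, 'd Phi0 t1 (lsubmx h))).
  by apply: (is_diff_comp darg); rewrite /= rt1 lt1.
apply: inj_row_free => h hJ.
have dphiE s v := flow_diff_origin s v dphi phi0 phiP T0 rho0.
have key : rsubmx h 0 0 *: chart_field X y1 + lsubmx h *m jacobian Phi0 t1 = 0.
  rewrite (mulmx_jacobian Phi0) -dphiE -(is_diffE h dPhi').
  by rewrite -(mulmx_jacobian (fun t => Phi' (x0, t))).
(* Otherwise [key] could be solved for the value of [X], which would lie in the old row space,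
   against [notin]. *)
have s0 : rsubmx h 0 0 = 0.
  apply/eqP; apply: contraNT notin => s0.
  have -> : chart_field X y1 =
    (- (rsubmx h 0 0)^-1 *: lsubmx h) *m jacobian Phi0 t1.
    rewrite -scalemxAl; move/eqP: key; rewrite addrC addr_eq0 => /eqP ->.
    by rewrite scalerN scaleNr opprK scalerA mulVf// scale1r.
  exact: submxMl.
rewrite s0 scale0r add0r in key.
have l0 : lsubmx h = 0 by apply: (row_free_inj freeJ); rewrite key mul0mx.
rewrite -[h]hsubmxK l0 [rsubmx h](_ : _ = 0) ?row_mx0//.
by apply/rowP => j; rewrite ord1 s0 mxE.
Unshelve. all: by end_near. Qed.

Lemma reach_regular_full (D : set (E * E)) t1 Phi : @reaches n D t1 Phi ->
  exists2 A : set E, A x0 & Ck_on r A F.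
Proof.
move=> [[oD Dt1 CPhi OPhi CG] freeJ].
pose Phi0 t := Phi (x0, t); pose V := [set t | D (x0, t)].
have fEE := framed_prod (@framed_rV R n) (@framed_rV R n).
have [oV CPhi0] := Ck_on_slice fEE oD (fun j =>
  @Ck_on_pairr _ _ _ x0 j (framed_rV n)) CPhi.
have [_ CG0] := Ck_on_slice fEE oD (fun j =>
  @Ck_on_pairr _ _ _ x0 j (framed_rV n)) CG.
have CF0 : Ck_on r V (fun t => F (Phi0 t)).
  apply: (Ck_on_ext oV _ (Ck_onD oV CG0 (Ck_on_cst r V (F x0)))) => t _ /=.
  by rewrite subrK.
have uJ : jacobian Phi0 t1 \in unitmx by rewrite -row_free_unit.
have [d [Psi [d0 PsiP CPsi]]] := inverse_function oV Dt1 CPhi0 uJ.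
have rK : (r <= r.+2)%N by rewrite leqW// leqW.
have oB := @open_dist_lt R _ (Phi0 t1) d.
have CFB : Ck_on r [set y | `|y - Phi0 t1| < d] F.
  have PsiV y : `|y - Phi0 t1| < d -> V (Psi y) by move=> /PsiP[].
  have C1 := @Ck_on_comp _ _ _ _ r _ _ Psi (fun t =>
    F (Phi0 t)) (framed_rV n) oB oV PsiV (Ck_on_le rK CPsi) CF0.
  apply: (Ck_on_ext oB _ C1) => y /PsiP[_ PhiPsi] /=.
  by rewrite /Phi0 PhiPsi.
have [oS CPhi1] := Ck_on_slice fEE oD (fun j =>
  @Ck_on_pairl _ _ _ t1 j (framed_rV n)) CPhi.
have [_ CG1] := Ck_on_slice fEE oD (fun j =>
  @Ck_on_pairl _ _ _ t1 j (framed_rV n)) CG.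
pose A := [set x | D (x, t1) /\ `|Phi (x, t1) - Phi0 t1| < d].
have oA : open A.
  rewrite openE => x [Dx xd].
  have cx := Ck_on_continuous CPhi1 Dx.
  have h1 : \forall y \near x, D (y, t1) by exact: (open_near oS Dx).
  have h2 : \forall y \near x, `|Phi (y, t1) - Phi0 t1| < d.
    exact: (cx _ (open_near oB xd)).
  suff : \forall y \near x, A y by [].
  by near=> y; split; near: y.
exists A; first by split=> //; rewrite subrr normr0.
have AS : A `<=` [set x | D (x, t1)] by move=> x [].
have AB x : A x -> `|Phi (x, t1) - Phi0 t1| < d by move=> [].
have C2 := @Ck_on_comp _ _ _ _ r A _ (fun x => Phi (x, t1)) F (framed_rV n) oA oB AB
  (Ck_on_le rK (Ck_on_sub AS CPhi1)) CFB.
apply: (Ck_on_ext oA _ (Ck_onB oA C2 (Ck_on_sub AS CG1))) => x _ /=.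
by rewrite opprB addrC subrK.
Unshelve. all: by end_near. Qed.

Lemma row_free_leq p q (A : 'M[R]_(p, q)) : row_free A -> (p <= q)%N.
Proof. by rewrite /row_free => /eqP <-; exact: rank_leq_col. Qed.

(** Either all horizontal fields are tangent over the open set [U] of times, and [all_tangent_full]
    gives rank [n], hence [n <= k]; or some field is transverse at some time of [U], and a flow can
    be added. *)
Lemma reach_step k (D : set (E * 'rV[R]_k)) t1 Phi : @reaches k D t1 Phi ->
  (n <= k)%N \/ exists D' t1' Phi', @reaches (k + 1) D' t1' Phi'.
Proof.
move=> [[oD Dt1 CPhi OPhi CG] freeJ].
pose Phi0 t := Phi (x0, t); pose P := pinvmx (jacobian Phi0 t1).
have fEk := framed_prod (@framed_rV R n) (@framed_rV R k).
have [oV CPhi0] := Ck_on_slice fEk oD (fun j =>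
  @Ck_on_pairr _ _ _ x0 j (framed_rV k)) CPhi.
set V := [set t | D (x0, t)] in oV CPhi0.
have CJ := Ck_on_jacobian oV CPhi0.
have Cdet := Ck_on_det oV (Ck_on_mulmx oV CJ (Ck_on_cst r.+1 V P)).
(* With [P] fixed, invertibility of the product is an open condition that implies [row_free]; at
   [t1] the product is the identity. *)
pose U := [set t | V t /\ \det (jacobian Phi0 t *m P) != 0].
have oU : open U.
  rewrite openE => t [Vt dt].
  have h1 : \forall u \near t, V u by exact: (open_near oV Vt).
  have h2 : \forall u \near t, \det (jacobian Phi0 u *m P) != 0.
    exact: (cvgr_neq0 _ (Ck_on_continuous Cdet Vt) dt).
  suff : \forall u \near t, U u by [].
  by near=> u; split; near: u.
have UV : U `<=` V by move=> t [].
have Ut1 : U t1 by split=> //; rewrite mulmxVp// det1 oner_neq0.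
have freeU t : U t -> row_free (jacobian Phi0 t).
  move=> [_ dt]; apply: inj_row_free => h hJ.
  have uJP : jacobian Phi0 t *m P \in unitmx by rewrite unitmxE unitfE.
  by rewrite -[h](mulmxK uJP) mulmxA hJ !mul0mx.
have [[X [t [hX Ut Xt nt]]]|none] := pselect (exists X t, [/\ horizontal H X, U t,
    vdom X (cinv c (Phi0 t)) &
    ~~ (chart_field X (Phi0 t) <= jacobian Phi0 t)%MS]).
  (* The base time is now [t], the point where tangency fails; membership in [U] provides what
     [reaches] asks of it. *)
  right; apply: (@reach_extend k D t Phi X _ hX Xt nt).
  by split; [split=> //; exact: UV | exact: freeU].
left; have C2 : Ck_on 2 U Phi0 by exact: (Ck_on_le _ (Ck_on_sub UV CPhi0)).
have OU t : U t -> O (Phi0 t) by move=> /UV; exact: OPhi.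
have : row_full (jacobian Phi0 t1).
  apply: (all_tangent_full oU Ut1 C2 OU freeU) => X t hX Ut Xt.
  by apply: contrapT => /negP nt; apply: none; exists X, t.
by rewrite /row_full => /eqP <-; exact: rank_leq_row.
Unshelve. all: by end_near. Qed.

(** The maximality of the number of times, as an induction: [d] bounds the extensions still
    possible. Independent rows force [k <= n], so with [d = 0] a further extension is absurd. *)
Lemma reach_regular d k (D : set (E * 'rV[R]_k)) t1 Phi : (n <= k + d)%N ->
  @reaches k D t1 Phi -> exists2 A : set E, A x0 & Ck_on r A F.
Proof.
elim: d k D t1 Phi => [|d IH] k D t1 Phi nkd reach.
all: have [nk|[D' [t1' [Phi' reach']]]] := reach_step reach.
- have [_ /row_free_leq kn] := reach.
  (* Replacing [k] by [n] in the types makes the jacobian square, as the inverse function theorem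
     requires. *)
  have kE : k = n by apply/eqP; rewrite eqn_leq kn nk.
  by move: reach; subst k => /reach_regular_full.
- have [_ /row_free_leq] := reach'; rewrite addn1 ltnNge.
  by rewrite addn0 in nkd; rewrite nkd.
- have [_ /row_free_leq kn] := reach.
  have kE : k = n by apply/eqP; rewrite eqn_leq kn nk.
  by move: reach; subst k => /reach_regular_full.
- by apply: (IH _ _ _ _ _ reach'); rewrite -addnA add1n.
Qed.

End Reach.

Theorem theorem4p5 (R : realType) (M : manifold R) (H : tangent_distribution M)
    (r : nat) (f : M -> R)
    (H_smooth : smooth_distribution H)
    (H_lfg : locally_finitely_generated H)
    (H_bracket : bracket_generating H)
    (Xf_Cr : forall X : local_vf M, horizontal H X ->
       (forall x, vdom X x -> flow_derivable X f x) /\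
       class_C r (vdom X) (flow_derivative X f)) :
  class_C r setT f.
Proof.
move=> c; apply: Ck_on_local => p [x [cx _] <-].
have Op : (cmap c @` cdom c) (cmap c x) by exists x.
have [D [t1 [Phi reach]]] := reaches0 r f Op.
(* Starting from no flow at all, at most [cdim c] extensions can occur. *)
exact: (reach_regular H_bracket Xf_Cr (leq_addl 0 (cdim c)) reach).
Qed.
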